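(* Let $\lambda>0$, $0<\alpha\le1$, $0<\nu\le1$, $\beta<0$ and $\gamma\in\mathbb{R}$. The probability mass function $p^{\alpha,\beta,\gamma}_\nu(n,t)=\Pr\{N^{\alpha,\beta,\gamma}_\nu(t,\lambda)=n\}$ of the Saigo space and time fractional Poisson process (SSTFPP) $\{N^{\alpha,\beta,\gamma}_\nu(t,\lambda)\}$ is $$p^{\alpha,\beta,\gamma}_\nu(n,t)=\frac{(-1)^n}{n!}\sum_{k=0}^{\infty}\frac{C_k(-\lambda^\nu t^{-\beta})^k}{\Gamma(1-k\beta)}\,\frac{\Gamma(k\nu+1)}{\Gamma(k\nu+1-n)},\qquad n\ge0,$$ where $$C_k=\prod_{j=1}^k\frac{\Gamma(1+\gamma-j\beta)}{\Gamma(1+\gamma+\alpha-(j-1)\beta)}.$$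
   Context: Saigo fractional integral: for real numbers $a>0$, $b$ and $c$, $$I_t^{a,b,c}f(t)=\frac{t^{-a-b}}{\Gamma(a)}\int_0^t(t-s)^{a-1}\,{}_2F_1\!\left(a+b,-c;a;1-\frac{s}{t}\right)f(s)\,ds,$$ where $f$ is a continuous real-valued function on $(0,\infty)$ of order $O(t^\epsilon)$ with $\epsilon>\max\{0,b-c\}-1$. Here ${}_2F_1$ is the Gauss hypergeometric function ${}_2F_1(p,q;r;z)=\sum_{k=0}^\infty\frac{(p)^{\overline{k}}(q)^{\overline{k}}}{(r)^{\overline{k}}}\frac{z^k}{k!}$, $|z|<1$, with $p,q\in\mathbb{C}$, $r\in\mathbb{C}\setminus\{0,-1,-2,\ldots\}$ and $(x)^{\overline{k}}=x(x+1)\cdots(x+k-1)$ the rising factorial. Caputo-type Saigo fractional derivative: for real numbers $\alpha>0$, $\beta$ and $\gamma$, with $m-1<\alpha\le m$, $m\in\mathbb{N}$, $$\partial_t^{\alpha,\beta,\gamma}f(t)=I_t^{-\alpha+m,\,-\beta-m,\,\alpha+\gamma}f^{(m)}(t),$$ where $f^{(m)}$ is the $m$-th derivative of $f$ (so $m=1$ when $0<\alpha\le1$). The SSTFPP $\{N^{\alpha,\beta,\gamma}_\nu(t,\lambda)\}$, for parameters $0<\alpha,\nu\le1$, $\beta<0$, $\gamma\in\mathbb{R}$ (and intensity $\lambda>0$), is defined as the stochastic process whose state probabilities $p^{\alpha,\beta,\gamma}_\nu(n,t)=\Pr\{N^{\alpha,\beta,\gamma}_\nu(t,\lambda)=n\}$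 satisfy $$\partial_t^{\alpha,\beta,\gamma}p^{\alpha,\beta,\gamma}_\nu(n,t)=-\lambda^\nu(1-B)^\nu p^{\alpha,\beta,\gamma}_\nu(n,t),\qquad n\ge0,$$ equivalently $$\partial_t^{\alpha,\beta,\gamma}p^{\alpha,\beta,\gamma}_\nu(n,t)=-\lambda^\nu\sum_{r=0}^n(-1)^r\frac{(\nu)_r}{r!}\,p^{\alpha,\beta,\gamma}_\nu(n-r,t),\qquad n\ge0,$$ with $p^{\alpha,\beta,\gamma}_\nu(-1,t)=0$ and subject to the initial conditions $p^{\alpha,\beta,\gamma}_\nu(0,0)=1$ and $p^{\alpha,\beta,\gamma}_\nu(n,0)=0$ for $n\ge1$. Here $B$ is the backward shift operator on the state space, $B\,p(n,t)=p(n-1,t)$; $(1-B)^\nu=\sum_{r=0}^\infty\frac{(\nu)_r}{r!}(-1)^rB^r$; and $(\nu)_r=\nu(\nu-1)\cdots(\nu-r+1)$ is the falling factorial, with $(\nu)_0=1$. The empty product equals $1$, so $C_0=1$. The ratio $\Gamma(k\nu+1)/\Gamma(k\nu+1-n)$ is the falling factorial $(k\nu)_n$ (with $1/\Gamma$ equal to $0$ at non-positive integers).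
   Formalization: State probabilities are also required to be right-continuous at t=0, and if p'(n,t)=O(t^ε), then also ε+1+β>max{0,β-γ}-1; otherwise the initial conditions do not determine p (e.g. α=ν=1, β=-3, γ>1 has another solution). *)

(* Defs.v *)
From HB Require Import structures.
From mathcomp Require Import all_boot all_order all_algebra.
From mathcomp Require Import all_classical all_reals all_analysis.

Set Implicit Arguments.
Unset Strict Implicit.
Unset Printing Implicit Defensive.

Import Order.TTheory GRing.Theory Num.Theory.
Import numFieldNormedType.Exports.

Local Open Scope classical_set_scope.
Local Open Scope ring_scope.

Definition rising {R : realType} (x : R) (k : nat) : R :=
  \prod_(i < k) (x + i%:R).

Definition falling {R : realType} (x : R) (k : nat) : R :=
  \prod_(i < k) (x - i%:R).

Definition euler_integral {R : realType} (x : R) : R :=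
  \int[@lebesgue_measure R]_(u in `]0, +oo[) (u `^ (x - 1) * expR (- u)).

(* For x <= 0, Gamma is continued by
   Gamma x = Gamma (x + m) / (x (x + 1) ... (x + m - 1)), with m such that
   1 <= x + m < 2.  At x = 0, -1, -2, ... the denominator vanishes, so that
   Gamma x = 0 and (Gamma x)^-1 = 0, the latter being the usual convention. *)
Definition Gamma {R : realType} (x : R) : R :=
  if 0 < x then euler_integral x
  else let m := `|Num.floor x|.+1%N in
       euler_integral (x + m%:R) / rising x m.

Definition hyp2F1 {R : realType} (p q r z : R) : R :=
  limn (series (fun k : nat =>
    rising p k * rising q k / rising r k * (z ^+ k / k`!%:R))).

Definition saigo_integral {R : realType} (a b c : R) (f : R -> R) (t : R) : R :=
  t `^ (- a - b) / Gamma a *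
  \int[@lebesgue_measure R]_(s in `]0, t[)
    ((t - s) `^ (a - 1) * hyp2F1 (a + b) (- c) a (1 - s / t) * f s).

(* The integral makes sense for a > 0 only.  At a = 0, which the Caputo-type
   derivative reaches when its order alpha is an integer, Saigo's extension
   I^{a,b,c} f = (d/dt)^n I^{a+n,b-n,c-n} f  (-n < a <= 1 - n) applies with
   n = 1; in particular I^{0,0,c} f = f. *)
Definition saigo {R : realType} (a b c : R) (f : R -> R) : R -> R :=
  if a == 0 then ((saigo_integral 1 (b - 1) (c - 1) f)^`())%classic
  else saigo_integral a b c f.

(* The class of functions on which I^{a,b,c} acts (a does not matter); the
   order is understood as t -> 0+. *)
Definition saigo_dom {R : realType} (b c eps : R) (f : R -> R) : Prop :=
  [/\ {in `]0, +oo[, continuous f},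
      f =O_ (0^'+) (fun t => t `^ eps)
    & Num.max 0 (b - c) - 1 < eps].

(* The integer m with m - 1 < alpha <= m, for alpha > 0. *)
Definition caputo_index {R : realType} (alpha : R) : nat := `|Num.ceil alpha|%N.

Definition caputo_saigo {R : realType} (alpha beta gamma : R) (f : R -> R) :
    R -> R :=
  let m := caputo_index alpha in
  saigo (m%:R - alpha) (- beta - m%:R) (alpha + gamma) (f^`(m))%classic.

(* f^(m) = O(t^eps) is in the domain of the integral that defines the
   derivative of f, which is then of order t^(eps + m + beta); the last
   condition says that this order is in turn admissible for
   I^{alpha,beta,gamma}, the left inverse (up to a Taylor polynomial) of the
   derivative.  Without it the derivative has homogeneous solutions that vanish
   at 0, such as t^(- beta - 1) if 0 < alpha <= 1, beta < -1 and
   alpha + gamma > 0, so initial values do not determine the solution.  If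
   0 < alpha <= 1, beta >= -1 and gamma >= -1, it follows from saigo_dom. *)
Definition caputo_saigo_dom {R : realType} (alpha beta gamma : R)
    (f : R -> R) : Prop :=
  let m := caputo_index alpha in
  (forall k : nat, (k < m)%N ->
     forall t : R, 0 < t -> derivable (f^`(k))%classic t 1) /\
  exists eps : R,
    saigo_dom (- beta - m%:R) (alpha + gamma) eps (f^`(m))%classic /\
    Num.max 0 (beta - gamma) - 1 < eps + m%:R + beta.

Definition state_prob {R : realType} {d : measure_display}
    {T : measurableType d} (P : probability T R) (N : R -> T -> nat)
    (n : nat) (t : R) : R :=
  fine (P [set w | N t w = n]).

(* Only the times t >= 0 matter.  Since p(m, _) = 0 for m < 0, the series
   (1 - B)^nu p(n, t) stops at r = n. *)
Record is_SSTFPP {R : realType} {d : measure_display} {T : measurableType d}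
    (P : probability T R) (lambda alpha beta gamma nu : R)
    (N : R -> T -> nat) : Prop := IsSSTFPP {
  SSTFPP_measurable : forall t : R, 0 <= t -> measurable_fun setT (N t) ;
  SSTFPP_init : forall n : nat, state_prob P N n 0 = (n == 0)%:R ;
  SSTFPP_cvg0 : forall n : nat,
    state_prob P N n t @[t --> 0^'+] --> state_prob P N n 0 ;
  SSTFPP_dom : forall n : nat,
    caputo_saigo_dom alpha beta gamma (state_prob P N n) ;
  SSTFPP_eq : forall (n : nat) (t : R), 0 < t ->
    caputo_saigo alpha beta gamma (state_prob P N n) t =
    - lambda `^ nu *
      \sum_(r < n.+1)
        (-1) ^+ r * (falling nu r / r`!%:R) * state_prob P N (n - r) t
}.

Definition coefC {R : realType} (alpha beta gamma : R) (k : nat) : R :=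
  \prod_(1 <= j < k.+1)
    (Gamma (1 + gamma - j%:R * beta) /
     Gamma (1 + gamma + alpha - (j%:R - 1) * beta)).

Definition pmf_term {R : realType} (lambda alpha beta gamma nu : R)
    (n : nat) (t : R) (k : nat) : R :=
  coefC alpha beta gamma k * (- lambda `^ nu * t `^ (- beta)) ^+ k /
    Gamma (1 - k%:R * beta) *
  (Gamma (k%:R * nu + 1) / Gamma (k%:R * nu + 1 - n%:R)).

(* Main.v *)
Require Import Defs.
From HB Require Import structures.
From mathcomp Require Import all_boot all_order all_algebra.
From mathcomp Require Import all_classical all_reals all_analysis.
From mathcomp Require Import measurable_realfun.
From mathcomp Require Import ring lra.
Import Order.TTheory GRing.Theory Num.Theory.
Import numFieldNormedType.Exports.
Local Open Scope classical_set_scope.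
Local Open Scope ring_scope.

(** The integral equations.  Let [I] be the Saigo integral with parameters [alpha],
    [beta], [gamma], and [D] the Caputo-type derivative.  Since [I (D f) t = f t - f 0],
    the system of the state probabilities and their initial values becomes
      [p n t = (n == 0) - lambda `^ nu * I (\sum_(r <= n) c r * p (n - r)) t],
    where the [c r] are the coefficients of [(1 - B) ^ nu].  The integral maps
    [t `^ (- (k * beta))] to a multiple of [t `^ (- ((k + 1) * beta))], the factor being a
    quotient of Gammas.  So the iterates of the equations are the partial sums of a
    power series in [t `^ (- beta)].  Its coefficients are the stated ones: the Gammas
    multiply up to [C_k / Gamma (1 - k * beta)], and the [k]-fold convolution of the [c r]
    is a falling factorial of [k * nu] by the Chu-Vandermonde identity ([iterate_coefE]).
    The remainder after [k] iterations starts from a function bounded by 1, and at the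
    [j]-th iteration it is multiplied at most by a constant times the [j]-th absolute
    moment of the kernel of [I].  These moments tend to 0, so the remainder tends to 0,
    which yields both the convergence of the series and its value ([iterate_series]).

    The inversion.  Rescaled to the unit interval, [I] and [D] are, up to powers of [t],
    operators [f |-> c * f t + \int k v * f (t * v) dv] ([mellin_op]), where [D] acts through
    the derivative of [f].  Such an operator multiplies every power by a moment of its
    kernel.  The kernels are hypergeometric; integrated term by term against a power,
    they give a hypergeometric series at 1, which Gauss's theorem ([gauss_summation])
    sums to Gammas.  The product of the moments of [I] and [D] turns out to be [1 / y],
    the moment of the kernel 1, that is, of the fundamental theorem of calculus.  The
    identity extends from powers to all functions that occur: by Weierstrass's theorem
    these are limits of combinations of powers for a weighted uniform norm
    ([power_adherent_bigO]), for which the operators are bounded ([mellin_op_comp]).  At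
    [alpha = 1], where [D] is the derivative of an integral, the same argument
    identifies this integral as a primitive ([caputo_saigo_kernel_1]).

    The parameters.  The iteration needs [beta - gamma < 1] and [alpha + gamma > -1],
    which make the moments of [I] finite.  These inequalities follow from the existence
    of the process: otherwise [D (p 0)] would tend to 0 at 0, whereas by the equation it
    tends to [- lambda `^ nu] ([SSTFPP_parameters]).

    Gauss's theorem is derived from a telescoping relation between the parameters [r] and
    [r + 1] and the limit of the sum as [r] grows; the facts on Gamma and Beta come from
    the Bohr-Mollerup theorem ([gamma_like_unique]), whose log-convexity hypothesis is
    obtained by integrating a tangent inequality. *)

Set Implicit Arguments.
Unset Strict Implicit.
Unset Printing Implicit Defensive.

(** * Improper integrals *)

Section ImproperIntegrals.
Context {R : realType}.
Local Notation mu := (@lebesgue_measure R).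
Implicit Types (a b : nat -> R) (D : set R) (f g F : R -> R).

(** An open interval and a half-line are treated alike, by the fundamental theorem of
    calculus on the segments. *)
Definition exhausts a b D :=
  [/\ forall n, a n < b n, forall n, `[a n, b n]%classic `<=` `[a n.+1, b n.+1]%classic
    & \bigcup_n `[a n, b n]%classic = D].

Lemma exhausts_sub a b D n : exhausts a b D -> `[a n, b n]%classic `<=` D.
Proof. by move=> [_ _ <-] x abx; exists n. Qed.

Lemma exhausts_nd a b D m n x : exhausts a b D -> (m <= n)%N ->
  `[a m, b m]%classic x -> `[a n, b n]%classic x.
Proof.
move=> [_ nd _]; elim: n => [|n IH]; first by rewrite leqn0 => /eqP ->.
by rewrite leq_eqVlt => /orP[/eqP -> //|/IH abx /abx]; exact: nd.
Qed.

Lemma exhausts_measurable a b D : exhausts a b D -> measurable D.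
Proof.
by move=> [_ _ <-]; apply: bigcup_measurable => n _; exact: measurable_itv.
Qed.

Lemma FTC2_within f F (x y : R) : x < y ->
  (forall z, x <= z <= y -> {for z, continuous f} /\ is_derive z 1 F (f z)) ->
  (\int[mu]_(z in `[x, y]) (f z)%:E = (F y - F x)%:E)%E.
Proof.
move=> xy cdF; have cf z (h : x <= z <= y) := (cdF z h).1.
have dF z (h : x <= z <= y) := (cdF z h).2.
rewrite (@continuous_FTC2 _ f F x y) //.
- apply: continuous_in_subspaceT => z; rewrite inE /= in_itv /=; exact: cf.
- have cF z : x <= z <= y -> {for z, continuous F}.
    move=> /dF dz; apply: differentiable_continuous.
    by apply/derivable1_diffP; apply: ex_derive.
  split.
  + move=> z; rewrite in_itv /= => /andP[/ltW xz /ltW zy].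
    by have [] := dF z _; rewrite ?xz.
  + apply: cvg_at_right_filter; apply: cF; by rewrite lexx ltW.
  + apply: cvg_at_left_filter; apply: cF; by rewrite lexx ltW.
- move=> z; rewrite in_itv /= => /andP[/ltW xz /ltW zy].
  rewrite derive1E; apply: derive_val; apply: dF; by rewrite xz zy.
Qed.

Lemma continuous_measurable_on f D : open D ->
  (forall x, D x -> {for x, continuous f}) -> measurable_fun D f.
Proof.
move=> oD cf; apply: open_continuous_measurable_fun => //.
by move=> x; rewrite inE; exact: cf.
Qed.

(** A nonnegative function with a primitive that increases by at most [M] on every
    segment has integral at most [M], by monotone convergence. *)
Lemma exhausts_integrable {a b D f} F (M : R) : exhausts a b D -> open D ->
  (forall x, D x -> 0 <= f x) ->
  (forall x, D x -> {for x, continuous f} /\ is_derive x 1 F (f x)) ->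
  (forall n, F (b n) - F (a n) <= M) -> mu.-integrable D (EFin \o f).
Proof.
move=> ex oD f0 cdF FM.
have cf x (h : D x) := (cdF x h).1.
have mf := continuous_measurable_on oD cf.
apply/integrableP; split; first exact/measurable_EFinP.
have -> : (\int[mu]_(x in D) `|(EFin \o f) x| = \int[mu]_(x in D) (f x)%:E)%E.
  by apply: eq_integral => x; rewrite inE => /f0 fx; rewrite /= ger0_norm.
have [ab nd DE] := ex.
have lim : (\int[mu]_(x in `[a n, b n]) (f x)%:E)%E @[n --> \oo] -->
    (\int[mu]_(x in D) (f x)%:E)%E.
  rewrite -[in X in _ --> X]DE; apply: ge0_nondecreasing_set_cvg_integral.
  - by apply/nondecreasing_seqP => n; rewrite subsetEset; exact: nd.
  - by move=> n; exact: measurable_itv.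
  - move=> n; apply/measurable_EFinP; apply: measurable_funS mf.
      exact: exhausts_measurable ex.
    exact: exhausts_sub ex.
  - by move=> n x /(exhausts_sub ex) Dx; rewrite lee_fin f0.
apply: (@le_lt_trans _ _ M%:E); last by rewrite ltry.
apply: (cvge_le _ lim); near=> n.
suff -> : (\int[mu]_(x in `[a n, b n]) (f x)%:E = (F (b n) - F (a n))%:E)%E.
  by rewrite lee_fin FM.
by apply: FTC2_within => // z zn; apply: cdF; apply: (exhausts_sub (n := n) ex);
    rewrite /= in_itv.
Unshelve. all: by end_near. Qed.

Lemma Rdominated_cvg D (f_ : nat -> R -> R) f g : measurable D ->
  (forall n, measurable_fun D (f_ n)) -> mu.-integrable D (EFin \o g) ->
  (forall x, D x -> f_ n x @[n --> \oo] --> f x) ->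
  (forall n x, D x -> `|f_ n x| <= g x) ->
  mu.-integrable D (EFin \o f) /\
  \int[mu]_(x in D) f_ n x @[n --> \oo] --> \int[mu]_(x in D) f x.
Proof.
move=> mD mf_ ig ff fg.
have mf : measurable_fun D f by apply: measurable_fun_cvg mf_ ff.
have [|||||fi _ lim] := @dominated_convergence _ _ R mu D mD
  (fun n => EFin \o f_ n) (EFin \o f) (EFin \o g).
- by move=> n; apply/measurable_EFinP; exact: mf_.
- exact/measurable_EFinP.
- by apply: aeW => x Dx; apply: cvg_EFin; [near=> n | exact: ff].
- exact: ig.
- by apply: aeW => x n Dx; rewrite /= lee_fin fg.
split => //.
have : (fine (\int[mu]_(x in D) (f_ n x)%:E)%E) @[n --> \oo] --> \int[mu]_(x in D) f x.
  apply: fine_cvg; rewrite /Rintegral fineK //; exact: integrable_fin_num.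
by [].
Unshelve. all: by end_near. Qed.

(** Dominated convergence along the segments, with [`|f|] as dominating function:
    no value of [F] at the ends of [D] is involved. *)
Lemma exhausts_FTC {a b D f} F (l : R) : exhausts a b D -> open D ->
  mu.-integrable D (EFin \o f) ->
  (forall x, D x -> {for x, continuous f} /\ is_derive x 1 F (f x)) ->
  F (b n) - F (a n) @[n --> \oo] --> l -> \int[mu]_(x in D) f x = l.
Proof.
move=> ex oD fi cdF Fl.
have cf x (h : D x) := (cdF x h).1.
have mD := exhausts_measurable ex.
have mf := continuous_measurable_on oD cf.
have [ab nd DE] := ex.
have mn n : measurable_fun D (f \_ `[a n, b n]%classic).
  apply: measurable_funS (measurableT) _ _; first exact: subsetT.
  apply/(measurable_restrictT _ _).1 => //.
  by apply: measurable_funS mf => //; exact: exhausts_sub ex.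
have lim : \int[mu]_(x in `[a n, b n]) f x @[n --> \oo] --> l.
  apply: cvg_trans Fl; apply: near_eq_cvg; near=> n.
  suff : (\int[mu]_(x in `[a n, b n]) (f x)%:E = (F (b n) - F (a n))%:E)%E.
    by rewrite /Rintegral => ->.
  by apply: FTC2_within => // z zn; apply: cdF; apply: (exhausts_sub (n := n) ex);
    rewrite /= in_itv.
apply: cvg_unique lim => //.
have [|x Dx|n x Dx|_ ] := @Rdominated_cvg D (fun n => f \_ `[a n, b n]%classic)
   f (fun x => `|f x|) mD mn.
- exact: integrable_norm.
- move: (Dx); rewrite -{1}DE => -[N _ abN].
  apply: cvg_near_cst; near=> n; rewrite /= patchE mem_set //; apply: exhausts_nd ex _ abN.
  by near: n; exact: nbhs_infty_ge.
- by rewrite patchE; case: ifP; rewrite ?normr0.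
apply: cvg_trans; apply: near_eq_cvg; near=> n.
rewrite -Rintegral_mkcondr setIidr //; exact: exhausts_sub ex.
Unshelve. all: by end_near. Qed.

Lemma cvg_near_eq (u v : nat -> R) (l : R) : (\forall n \near \oo, u n = v n) ->
  u n @[n --> \oo] --> l -> v n @[n --> \oo] --> l.
Proof. by move=> uv; apply: cvg_trans; apply: near_eq_cvg. Qed.

Section RealIntegrable.
Context (D : set R) (mD : measurable D).

Lemma integrable_scale f (k : R) : mu.-integrable D (EFin \o f) ->
  mu.-integrable D (EFin \o (fun x => k * f x)).
Proof.
move=> fi; have -> : EFin \o (fun x => k * f x) = (fun x => (k%:E * (f x)%:E)%E).
  by apply/funext => x /=; rewrite EFinM.
exact: integrableZl.
Qed.

Lemma integrable_add f g : mu.-integrable D (EFin \o f) -> mu.-integrable D (EFin \o g) ->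
  mu.-integrable D (EFin \o (fun x => f x + g x)).
Proof. move=> fi gi; exact: (@integrableD _ _ _ mu D mD (EFin \o f) (EFin \o g)). Qed.

Lemma integrable_sub f g : mu.-integrable D (EFin \o f) -> mu.-integrable D (EFin \o g) ->
  mu.-integrable D (EFin \o (fun x => f x - g x)).
Proof. move=> fi gi; exact: (@integrableB _ _ _ mu D mD (EFin \o f) (EFin \o g)). Qed.

Lemma integrable_dominated f g : measurable_fun D f -> mu.-integrable D (EFin \o g) ->
  (forall x, D x -> `|f x| <= g x) -> mu.-integrable D (EFin \o f).
Proof.
move=> mf gi fg; apply: le_integrable gi => //; first exact/measurable_EFinP.
by move=> x Dx; rewrite lee_fin (le_trans (fg x Dx)) // ler_norm.
Qed.

Lemma integrable_measurable f : mu.-integrable D (EFin \o f) -> measurable_fun D f.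
Proof. by move=> /integrableP[/measurable_EFinP]. Qed.

Lemma eq_integrable_on f g : (forall x, D x -> f x = g x) ->
  mu.-integrable D (EFin \o f) -> mu.-integrable D (EFin \o g).
Proof.
move=> fg; apply: eq_integrable => // x; rewrite inE => Dx.
by rewrite /= fg.
Qed.

Lemma eq_Rintegral_on f g : (forall x, D x -> f x = g x) ->
  \int[mu]_(x in D) f x = \int[mu]_(x in D) g x.
Proof. by move=> fg; apply: eq_Rintegral => x; rewrite inE; exact: fg. Qed.

End RealIntegrable.

End ImproperIntegrals.

(** * Gamma and Beta functions *)

Section GammaBeta.
Context {R : realType}.
Local Notation mu := (@lebesgue_measure R).
Implicit Types (x y s u : R) (f g : R -> R).

Lemma exhausts_01 : exhausts (fun n => n.+3%:R^-1 : R)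
  (fun n => 1 - n.+3%:R^-1) `]0, 1[%classic.
Proof.
have i0 n : 0 < n.+3%:R^-1 :> R by rewrite invr_gt0.
have ih n : n.+3%:R^-1 < 2^-1 :> R by rewrite ltf_pV2 ?posrE// ltr_nat.
have im n : n.+4%:R^-1 <= n.+3%:R^-1 :> R by rewrite lef_pV2 ?posrE// ler_nat.
split => [n|n u /=|].
- by move: (ih n); move: n.+3%:R^-1 => v; lra.
- rewrite !in_itv /=; move: (im n).
  by move: n.+3%:R^-1 n.+4%:R^-1 => v w ? /andP[? ?]; apply/andP; split; lra.
- apply/seteqP; split => [u [n _]|u] /=; rewrite !in_itv /=.
    by move: (i0 n); move: n.+3%:R^-1 => v ? /andP[? ?]; apply/andP; split; lra.
  move=> /andP[u0 u1]; pose m := Num.min u (1 - u).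
  have m0 : 0 < m by rewrite /m lt_min u0 subr_gt0.
  have [N] := ltr_add_invr (y := 0) (x := m) m0 => H.
  exists N => //=; rewrite in_itv /=.
  have : N.+3%:R^-1 <= m.
    apply: le_trans (ltW _); last by rewrite add0r in H; exact: H.
    by rewrite lef_pV2 ?posrE// ler_nat ltnW.
  by rewrite /m le_min; move: N.+3%:R^-1 => v /andP[? ?]; apply/andP; split; lra.
Qed.

Lemma exhausts_0y : exhausts (fun n => n.+2%:R^-1 : R)
  (fun n => n.+2%:R) `]0, +oo[%classic.
Proof.
have im n : n.+3%:R^-1 <= n.+2%:R^-1 :> R by rewrite lef_pV2 ?posrE// ler_nat.
split => [n|n u /=|].
- apply: (@lt_trans _ _ 1); first by rewrite invf_lt1 // ltr1n.
  by rewrite ltr1n.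
- rewrite !in_itv /= => /andP[? ?]; apply/andP; split; first exact: le_trans (im n) _.
  by apply: le_trans (_ : n.+2%:R <= _) => //; rewrite ler_nat.
- apply/seteqP; split => [u [n _]|u] /=; rewrite !in_itv /= andbT.
    by move=> /andP[+ _]; apply: lt_le_trans; rewrite invr_gt0.
  move=> u0.
  have [N] := ltr_add_invr (y := 0) (x := u) u0 => H.
  pose M := (maxn N (Num.truncn u))%N.
  exists M => //=; rewrite in_itv /=; apply/andP; split.
    apply: le_trans (ltW _); last by rewrite add0r in H; exact: H.
    by rewrite lef_pV2 ?posrE// ler_nat ltnS ltnW // ltnS leq_maxl.
  apply: le_trans (ltW (truncnS_gt u)) _.
  by rewrite ler_nat ltnS (leq_trans (leq_maxr N _)) // leqnSn.
Qed.

Lemma powR_add u x y : 0 < u -> u `^ (x + y) = u `^ x * u `^ y.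
Proof. by move=> u0; rewrite powRD // (gt_eqF u0) implybT. Qed.

Lemma one_powR y : 1 `^ y = 1 :> R. Proof. by rewrite powR1. Qed.

Lemma powR_le1 u y : 0 <= u <= 1 -> 0 <= y -> u `^ y <= 1.
Proof.
by move=> /andP[u0 u1] y0; rewrite -(one_powR y) ge0_ler_powR ?nnegrE.
Qed.

Lemma continuous_powR x u : 0 < u -> {for u, continuous (fun v : R => v `^ x)}.
Proof.
move=> u0; apply: differentiable_continuous; apply/derivable1_diffP.
by apply: derivable_powR; rewrite in_itv /= andbT.
Qed.

Lemma is_derive_onem_powR x u : u < 1 ->
  is_derive u 1 (fun v : R => (1 - v) `^ x) (- (x * (1 - u) `^ (x - 1))).
Proof.
move=> u1; have u0 : 0 < 1 - u by rewrite subr_gt0.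
have /= := @is_derive1_comp _ (fun v => v `^ x) (fun v : R => 1 - v) u
   _ _ (is_derive1_powR x u0) _.
have d1 : is_derive u 1 (fun v : R => 1 - v) (-1).
  by apply: is_derive_eq; rewrite add0r mul1r.
by move=> /(_ _ d1) H; apply: is_derive_eq H _; rewrite mulrN1.
Qed.

Lemma continuous_onem_powR x u : u < 1 ->
  {for u, continuous (fun v : R => (1 - v) `^ x)}.
Proof.
move=> u1; apply: differentiable_continuous; apply/derivable1_diffP.
by have d := is_derive_onem_powR x u1; exact: ex_derive.
Qed.

(** Weighted arithmetic-geometric mean of [h] and 1: with [L = ln h], divide by
    [expR (s * L)] and bound the two exponentials below by their tangents at 0. *)
Lemma powR_le_affine (h : R) s : 0 < h -> 0 <= s <= 1 ->
  h `^ s <= 1 - s + s * h.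
Proof.
move=> h0 /andP[s0 s1]; pose L := ln h.
have hE : h = expR L by rewrite lnK.
have hs : h `^ s = expR (s * L) by rewrite /powR gt_eqF.
have e0 := expR_gt0 (s * L).
have -> : 1 - s + s * h =
    expR (s * L) * ((1 - s) * expR (- (s * L)) + s * expR ((1 - s) * L)).
  rewrite mulrDr !mulrA ![expR (s * L) * _]mulrC -!mulrA -!expRD.
  by rewrite subrr expR0 mulr1 -mulrDl (_ : s + (1 - s) = 1) ?mul1r -?hE //; ring.
rewrite hs ler_pMr //.
have l1 : 1 - s * L <= expR (- (s * L)) by exact: expR_ge1Dx.
have l2 : 1 + (1 - s) * L <= expR ((1 - s) * L) by exact: expR_ge1Dx.
have : (1 - s) * (1 - s * L) <= (1 - s) * expR (- (s * L)).
  by rewrite ler_wpM2l // subr_ge0.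
have : s * (1 + (1 - s) * L) <= s * expR ((1 - s) * L) by rewrite ler_wpM2l.
nra.
Qed.

(** The concave function [h `^ s] lies below its tangent at [c]. Integrated against
    a density with mean [c], this is the log-convexity of Gamma and Beta. *)
Lemma powR_le_tangent (h c : R) s : 0 < h -> 0 < c -> 0 <= s <= 1 ->
  h `^ s <= c `^ s * (1 - s + s * (h / c)).
Proof.
move=> h0 c0 s01; have hc : 0 < h / c by rewrite divr_gt0.
have -> : h `^ s = c `^ s * (h / c) `^ s.
  by rewrite -powRM ?ltW // mulrC divfK // gt_eqF.
by rewrite ler_pM2l ?powR_gt0 //; exact: powR_le_affine.
Qed.

(** The last condition is log-convexity, combined with the recursion: between [x] and
    [x + 1] it bounds [f (x + s)] by [f x ^ (1 - s) * (x * f x) ^ s]. *)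
Definition gamma_like f := [/\ forall x, 0 < x -> 0 < f x,
  forall x, 0 < x -> f (x + 1) = x * f x &
  forall x s, 0 < x -> 0 <= s <= 1 -> f (x + s) <= x `^ s * f x].

(** Log-convexity of [f] bounds [f (x + s)] above; that of [g] from [x + s] to [x + 1]
    bounds [g (x + s)] below. The two bounds differ by a factor that tends to 1 as [x] grows. *)
Lemma gamma_like_quotient_le f g x s : gamma_like f -> gamma_like g ->
  0 < x -> 0 <= s <= 1 -> f (x + s) / g (x + s) <= (1 + x^-1) * (f x / g x).
Proof.
move=> [f0 fS fs] [g0 gS gs] x0 /andP[s0 s1].
have xs0 : 0 < x + s by rewrite ltr_wpDr.
have H1 : f (x + s) <= x `^ s * f x by apply: fs => //; rewrite s0.
have H2 : x * g x <= (x + s) `^ (1 - s) * g (x + s).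
  rewrite -gS // (_ : x + 1 = x + s + (1 - s)); last by ring.
  apply: gs => //; apply/andP; split; lra.
have H3 : x `^ s <= (x + s) `^ s by rewrite ge0_ler_powR // ?nnegrE ?lerDl // ltW.
have H4 : (x + s) `^ s * (x + s) `^ (1 - s) = x + s.
  rewrite -powR_add //.
  by rewrite (_ : s + (1 - s) = 1) ?powRr1 ?(ltW xs0) //; ring.
have gx := g0 _ x0; have gxs := g0 _ xs0; have fx := f0 _ x0.
have fxs := f0 _ xs0.
rewrite ler_pdivrMr // !mulrA mulrAC ler_pdivlMr //.
have -> : 1 + x^-1 = (x + 1) / x by field; rewrite gt_eqF.
rewrite (_ : _ / x * _ * _ = (x + 1) * f x * g (x + s) / x); last first.
  by field; rewrite gt_eqF.
rewrite ler_pdivlMr //.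
set P := (x + s) `^ s in H3 H4; set Q := (x + s) `^ (1 - s) in H2 H4.
have Q0 : 0 < Q by rewrite powR_gt0.
apply: (@le_trans _ _ (P * f x * (Q * g (x + s)))).
  rewrite -mulrA [g x * x]mulrC; apply: ler_pM => //; first exact: ltW.
    by rewrite mulr_ge0 // ltW.
  by apply: le_trans H1 _; rewrite ler_wpM2r // ltW.
rewrite (_ : P * f x * (Q * g (x + s)) = (P * Q) * (f x * g (x + s))); last by ring.
rewrite H4 -mulrA ler_wpM2r ?mulr_ge0 ?(ltW fx) ?(ltW gxs) //; lra.
Qed.

Lemma gamma_likeS f g x n : gamma_like f -> gamma_like g ->
  0 < x -> f (x + n%:R) / g (x + n%:R) = f x / g x.
Proof.
move=> [f0 fS fs] [g0 gS gs] x0; elim: n => [|n <-]; first by rewrite addr0.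
have xn : 0 < x + n%:R by rewrite ltr_wpDr.
rewrite -natr1 addrA fS // gS //; field; rewrite !gt_eqF //; exact: g0.
Qed.

(** The quotient is 1-periodic, so the factor [1 + 1 / x] may be replaced by its limit
    along [x + n]. *)
Lemma gamma_like_quotient_nonincreasing f g x s : gamma_like f -> gamma_like g ->
  0 < x -> 0 <= s <= 1 -> f (x + s) / g (x + s) <= f x / g x.
Proof.
move=> hf hg x0 s01; have xs0 : 0 < x + s by rewrite ltr_wpDr //; case/andP: s01.
have H n : f (x + s) / g (x + s) <= (1 + (x + n%:R)^-1) * (f x / g x).
  have xn : 0 < x + n%:R by rewrite ltr_wpDr.
  rewrite -(gamma_likeS n hf hg x0) -(gamma_likeS n hf hg xs0).
  rewrite [x + s + _]addrAC; exact: gamma_like_quotient_le.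
have : (1 + (x + n.+1%:R)^-1) * (f x / g x) @[n --> \oo] --> (1 + 0) * (f x / g x).
  apply: cvgMl; apply: cvgD; first exact: cvg_cst.
  apply: squeeze_cvgr (cvg_cst 0) cvg_harmonic; near=> n.
  have xn : 0 < x + n.+1%:R by rewrite ltr_wpDr.
  by rewrite invr_ge0 ltW //= lef_pV2 ?posrE // lerDr ltW.
rewrite addr0 mul1r => L; apply: (cvgr_to_ge L); near=> n; exact: H.
Unshelve. all: by end_near. Qed.

(** The Bohr-Mollerup theorem: exchanging [f] and [g] in the previous inequality makes
    the quotient constant on unit intervals, and it is 1-periodic. *)
Lemma gamma_like_unique f g x : gamma_like f -> gamma_like g ->
  0 < x -> f x / g x = f 1 / g 1.
Proof.
move=> hf hg x0; have [f0 _ _] := hf; have [g0 _ _] := hg.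
have E y s : 0 < y -> 0 <= s <= 1 -> f (y + s) / g (y + s) = f y / g y.
  move=> y0 s01; have ys0 : 0 < y + s by rewrite ltr_wpDr //; case/andP: s01.
  apply: le_anti; rewrite gamma_like_quotient_nonincreasing //=.
  have := gamma_like_quotient_nonincreasing hg hf y0 s01.
  rewrite -[g y / f y]invf_div -[g (y + s) / _]invf_div.
  by rewrite lef_pV2 // posrE divr_gt0 // ?f0 ?g0.
pose n := Num.truncn x.
have /andP[nx xn] := truncn_itv (ltW x0).
have h := gamma_likeS 1 hf hg x0; rewrite -h.
have -> : x + 1 = 1 + n%:R + (x - n%:R) by ring.
rewrite E ?gamma_likeS ?ltr_wpDr //.
rewrite subr_ge0 nx /= lerBlDl natr1 ltW //.
Qed.

Lemma cvg_invn : (n.+2%:R^-1 : R) @[n --> \oo] --> 0.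
Proof.
apply: squeeze_cvgr (cvg_cst 0) cvg_harmonic; near=> n.
by rewrite invr_ge0 ler0n /= lef_pV2 ?posrE // ler_nat.
Unshelve. all: by end_near. Qed.

Lemma cvg_invn_powR x : 0 < x -> (n.+2%:R^-1 : R) `^ x @[n --> \oo] --> 0.
Proof.
move=> x0; have h : (n.+2%:R^-1 : R) @[n --> \oo] --> 0^'+.
  move=> P nP; have [N _ HN] := cvg_invn nP.
  by exists N => // n /HN /=; apply; change (0 < n.+2%:R^-1 :> R); rewrite invr_gt0.
exact: (cvg_comp _ _ h (powR_cvg0 x0)).
Qed.

(** From [v / p <= expR (v / p)], raised to the power [p]. *)
Lemma le_powR_expR p u : 0 < p -> 0 <= u ->
  (1 + u) `^ p <= p `^ p * expR 1 * expR u.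
Proof.
move=> p0 u0; have v0 : 0 < 1 + u by rewrite ltr_wpDr.
have : (1 + u) / p <= expR ((1 + u) / p).
  by apply: le_trans (expR_ge1Dx _); rewrite lerDr.
move=> /(ge0_ler_powR (ltW p0)).
rewrite !nnegrE divr_ge0 ?(ltW v0) ?(ltW p0) ?expR_ge0 // => /(_ isT isT) H.
have -> : 1 + u = p * ((1 + u) / p) by rewrite mulrC divfK // gt_eqF.
rewrite powRM ?divr_ge0 ?(ltW v0) ?(ltW p0) // -mulrA ler_pM2l ?powR_gt0 //.
apply: le_trans H _; rewrite -expRD /powR gt_eqF ?expR_gt0 // expRK.
by rewrite mulrC divfK // gt_eqF.
Qed.

Definition gamma_kernel x u : R := u `^ (x - 1) * expR (- u).

Lemma continuous_gamma_kernel x u : 0 < u ->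
  {for u, continuous (gamma_kernel x)}.
Proof.
move=> u0; apply: cvgM; first exact: continuous_powR.
apply: continuous_comp; first exact: opp_continuous.
exact: continuous_expR.
Qed.

Lemma is_derive_powR_expRN x u : 0 < u ->
  is_derive u 1 (fun v => v `^ x * expR (- v))
    (x * gamma_kernel x u - gamma_kernel (x + 1) u).
Proof.
move=> u0; have d1 := is_derive1_powR x u0.
apply: is_derive_eq.
rewrite /gamma_kernel addrK /GRing.scale /=; ring.
Qed.

Lemma gamma_kernel_ge0 x u : 0 <= gamma_kernel x u.
Proof. by rewrite mulr_ge0 ?powR_ge0 ?expR_ge0. Qed.

(** The function [(u / (1 + u)) `^ x / x] is bounded, and a multiple of its
    derivative dominates the integrand by [le_powR_expR]. *)
Lemma integrable_gamma_kernel x : 0 < x ->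
  mu.-integrable `]0, +oo[ (EFin \o gamma_kernel x).
Proof.
move=> x0; pose C := (x + 1) `^ (x + 1) * expR 1.
have C0 : 0 < C by rewrite mulr_gt0 ?expR_gt0 ?powR_gt0 ?addr_gt0.
pose h u := C * (u `^ (x - 1) * (1 + u) `^ (- x - 1)).
pose F u := C * (x^-1 * (u `^ x * (1 + u) `^ (- x))).
have oD : open (`]0, +oo[%classic : set R) by exact: interval_open.
have sp u : 0 < u -> 0 < 1 + u by move=> u0; rewrite ltr_pwDl // ltW.
have d1 p u : 0 < u ->
    is_derive u 1 (fun v => (1 + v) `^ p) (p * (1 + u) `^ (p - 1)).
  move=> u0; have d2 : is_derive u 1 (fun v : R => 1 + v) 1.
    have := is_deriveD (is_derive_cst (1 : R) u 1) (is_derive_id u 1).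
    by move=> H; apply: is_derive_eq H _; rewrite add0r.
  have /= H := @is_derive1_comp _ (fun v => v `^ p) (fun v : R => 1 + v) u
     _ _ (is_derive1_powR p (sp _ u0)) d2.
  by apply: is_derive_eq H _; rewrite mulr1.
have c1 p u : 0 < u -> {for u, continuous (fun v : R => (1 + v) `^ p)}.
  move=> u0; apply: differentiable_continuous; apply/derivable1_diffP.
  by have d := d1 p _ u0; exact: ex_derive.
have ih : mu.-integrable `]0, +oo[ (EFin \o h).
  apply: (exhausts_integrable (F := F) (M := C * x^-1) exhausts_0y oD).
  - move=> u _; by rewrite !mulr_ge0 ?powR_ge0 // ltW.
  - move=> u /=; rewrite in_itv /= andbT => u0; split.
      apply: cvgM; first exact: cvg_cst.
      apply: cvgM; [exact: continuous_powR | exact: c1].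
    have e1 := is_derive1_powR x u0; have e2 := d1 (- x) _ u0.
    apply: is_derive_eq; rewrite /h /GRing.scale /=.
    have -> : u `^ x = u * u `^ (x - 1).
      by rewrite mulr_powRB1 // ltW.
    have -> : (1 + u) `^ (- x) = (1 + u) * (1 + u) `^ (- x - 1).
      rewrite -{2}[1 + u]powRr1 ?ltW ?sp // -powR_add ?sp //.
      by congr (_ `^ _); ring.
    field; by rewrite gt_eqF.
  - move=> n; rewrite /F -mulrBr ler_pM2l // -mulrBr -[leRHS]mulr1.
    rewrite ler_pM2l ?invr_gt0 //.
    have a0 : 0 < n.+2%:R^-1 :> R by rewrite invr_gt0.
    rewrite lerBlDr; apply: ler_wpDr; first by rewrite mulr_ge0 ?powR_ge0.
    have b0 : 0 < n.+2%:R :> R by [].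
    rewrite powRN ler_pdivrMr ?powR_gt0 ?sp // mul1r.
    by rewrite ge0_ler_powR ?nnegrE ?lerDr // ?ltW ?sp.
apply: le_integrable ih => //.
- apply/measurable_EFinP; apply: continuous_measurable_on => // u /=.
  by rewrite in_itv /= andbT; exact: continuous_gamma_kernel.
- move=> u /=; rewrite in_itv /= andbT => u0.
  rewrite lee_fin !ger0_norm ?gamma_kernel_ge0 //; last first.
    by rewrite !mulr_ge0 ?powR_ge0 // ltW.
  rewrite /gamma_kernel /h mulrCA ler_wpM2l ?powR_ge0 //.
  rewrite -opprD powRN expRN ler_pdivlMr ?powR_gt0 ?sp // mulrC ler_pdivrMr ?expR_gt0 //.
  apply: le_powR_expR; last exact: ltW.
  by rewrite addr_gt0.
Qed.

Lemma Rintegral_gt0 (D : set R) f (a b : R) : measurable D ->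
  mu.-integrable D (EFin \o f) -> (forall u, D u -> 0 <= f u) ->
  a < b -> `[a, b] `<=` D -> (forall u, a <= u <= b -> {for u, continuous f}) ->
  (forall u, a <= u <= b -> 0 < f u) -> 0 < \int[mu]_(u in D) f u.
Proof.
move=> mD fi f0 ab abD cf fp.
have [|c cab cm] := @EVT_min _ f a b (ltW ab).
  by apply: continuous_in_subspaceT => z; rewrite inE /= in_itv /=; exact: cf.
have fc : 0 < f c by apply: fp; rewrite in_itv /= in cab.
apply: (@lt_le_trans _ _ (f c * (b - a))); first by rewrite mulr_gt0 // subr_gt0.
rewrite -lee_fin /Rintegral fineK; last exact: integrable_fin_num.
apply: (@le_trans _ _ (\int[mu]_(u in `[a, b]) (f u)%:E)%E); last first.
  apply: ge0_subset_integral => //.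
  - by have := measurable_int _ fi.
apply: (@le_trans _ _ (\int[mu]_(u in `[a, b]) (f c)%:E)%E).
  rewrite integral_cst //= lebesgue_measure_itv /= lte_fin ab EFinM.
  by rewrite -EFinB.
apply: le_integral => //.
- apply: continuous_compact_integrable => //; first exact: segment_compact.
  by apply: continuous_subspaceT => z; exact: cvg_cst.
- by apply: integrableS fi.
- by move=> u; rewrite inE => uab; rewrite lee_fin cm // inE.
Qed.

Lemma euler_integral_gt0 x : 0 < x -> 0 < euler_integral x.
Proof.
move=> x0; apply: (Rintegral_gt0 (a := 1) (b := 2)) => //.
- exact: integrable_gamma_kernel.
- by move=> u _; exact: gamma_kernel_ge0.
- by rewrite ltr1n.
- by move=> u /=; rewrite !in_itv /= andbT => /andP[+ _]; apply: lt_le_trans.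
- move=> u /andP[u1 _]; apply: continuous_gamma_kernel; exact: lt_le_trans u1.
- move=> u /andP[u1 _]; rewrite mulr_gt0 ?expR_gt0 ?powR_gt0 //.
  exact: lt_le_trans u1.
Qed.

Lemma euler_integralS x : 0 < x ->
  euler_integral (x + 1) = x * euler_integral x.
Proof.
move=> x0; have x10 : 0 < x + 1 by rewrite addr_gt0.
have i1 := integrable_gamma_kernel x0; have i2 := integrable_gamma_kernel x10.
have i3 : mu.-integrable `]0, +oo[ (EFin \o (fun u => x * gamma_kernel x u)).
  exact: integrable_scale.
suff : \int[mu]_(u in `]0, +oo[)
    (x * gamma_kernel x u - gamma_kernel (x + 1) u) = 0.
  rewrite RintegralB // RintegralZl // => /eqP.
  by rewrite subr_eq0 => /eqP ->.
apply: (exhausts_FTC (F := fun v => v `^ x * expR (- v)) exhausts_0y).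
- exact: interval_open.
- exact: integrable_sub.
- move=> u /=; rewrite in_itv /= andbT => u0; split.
    apply: cvgB; last exact: continuous_gamma_kernel.
    by apply: cvgM; [exact: cvg_cst | exact: continuous_gamma_kernel].
  exact: is_derive_powR_expRN.
rewrite -[X in _ --> X]subr0; apply: cvgB; last first.
  pose v n : R := n.+2%:R^-1.
  apply: (@squeeze_cvgr _ _ _ _ (fun=> 0) (fun n => v n `^ x)).
  - near=> n; rewrite mulr_ge0 ?powR_ge0 ?expR_ge0 //=.
    by rewrite ler_piMr ?powR_ge0 // -expR0 ler_expR oppr_le0 invr_ge0.
  - exact: cvg_cst.
  - exact: cvg_invn_powR.
pose C := (x + 1) `^ (x + 1) * expR 1.
apply: (@squeeze_cvgr _ _ _ _ (fun=> 0) (fun n => C * harmonic n)).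
- near=> n; rewrite mulr_ge0 ?powR_ge0 ?expR_ge0 //=.
  have n0 : 0 < n.+2%:R :> R by [].
  have H := le_powR_expR x10 (ltW n0).
  have nn : n.+1%:R <= n.+2%:R :> R by rewrite ler_nat.
  have n1 : 0 <= n.+1%:R :> R by [].
  have n1' : 0 < n.+1%:R :> R by [].
  move: n.+2%:R n.+1%:R n0 n1 n1' nn H => m k m0 k0 k1 km H.
  rewrite expRN ler_pdivrMr ?expR_gt0 // mulrAC ler_pdivlMr //.
  apply: le_trans H; rewrite (powR_add x 1) ?ltr_wpDr ?(ltW m0) //.
  have m1 : 0 <= 1 + m by rewrite addr_ge0 ?(ltW m0).
  rewrite (powRr1 m1); apply: ler_pM; rewrite ?powR_ge0 //.
    by rewrite ge0_ler_powR ?nnegrE ?(ltW x0) ?(ltW m0) // lerDr.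
  by rewrite (le_trans km) // lerDr.
- exact: cvg_cst.
- rewrite -[X in _ --> X](mulr0 C); apply: cvgM; first exact: cvg_cst.
  exact: cvg_harmonic.
Unshelve. all: by end_near. Qed.

Lemma euler_integral1 : euler_integral (1 : R) = 1.
Proof.
have := integrable_gamma_kernel (@ltr01 R); rewrite /euler_integral => i1.
apply: (exhausts_FTC (F := fun v => - expR (- v)) exhausts_0y).
- exact: interval_open.
- exact: i1.
- move=> u /=; rewrite in_itv /= andbT => u0.
  split; first exact: continuous_gamma_kernel.
  apply: is_derive_eq.
  by rewrite subrr powRr0 mulrN1 opprK mul1r.
suff L : - expR (- n.+2%:R) - - expR (- (n.+2%:R^-1 : R)) @[n --> \oo] -->
    (- 0 - - expR (- 0) : R) by rewrite oppr0 expR0 sub0r opprK in L.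
apply: cvgB; apply: cvgN.
  have := @cvgn_expR R; rewrite -(@cvg_shiftn 2 _ (fun n => expR (1 *- n))).
  by apply: cvg_trans; apply: near_eq_cvg; near=> n; rewrite /= addn2.
apply: continuous_cvg; first exact: continuous_expR.
by apply: cvgN; exact: cvg_invn.
Unshelve. all: by end_near. Qed.

(** Integrate the tangent inequality at [c = x], the mean of [u] for the density
    [gamma_kernel x], by the recursion. *)
Lemma euler_integral_log_convex x s : 0 < x -> 0 <= s <= 1 ->
  euler_integral (x + s) <= x `^ s * euler_integral x.
Proof.
move=> x0 s01; have [s0 s1] := andP s01.
have x10 : 0 < x + 1 by rewrite addr_gt0.
have xs0 : 0 < x + s by rewrite ltr_wpDr.
have i1 := integrable_gamma_kernel x0; have i2 := integrable_gamma_kernel x10.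
have i3 := integrable_gamma_kernel xs0.
pose a := x `^ s * (1 - s); pose b := x `^ s * (s / x).
have j1 : mu.-integrable `]0, +oo[ (EFin \o (fun u => a * gamma_kernel x u)).
  exact: integrable_scale.
have j2 : mu.-integrable `]0, +oo[
    (EFin \o (fun u => b * gamma_kernel (x + 1) u)).
  exact: integrable_scale.
apply: (@le_trans _ _ (\int[mu]_(u in `]0, +oo[)
    (a * gamma_kernel x u + b * gamma_kernel (x + 1) u))).
  apply: le_Rintegral => //.
    exact: integrable_add.
  move=> u /=; rewrite in_itv /= andbT => u0.
  rewrite /gamma_kernel (_ : x + s - 1 = s + (x - 1)); last by ring.
  rewrite (_ : x + 1 - 1 = 1 + (x - 1)); last by ring.
  rewrite (powR_add s (x - 1)) // (powR_add 1 (x - 1)) // (powRr1 (ltW u0)).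
  have H := powR_le_tangent u0 x0 s01.
  set A := u `^ (x - 1); set E := expR _.
  have AE : 0 <= A * E by rewrite mulr_ge0 ?powR_ge0 ?expR_ge0.
  rewrite -!mulrA.
  apply: (@le_trans _ _ (x `^ s * (1 - s + s * (u / x)) * (A * E))).
    by rewrite ler_wpM2r.
  rewrite /a /b le_eqVlt; apply/orP; left; apply/eqP; ring.
rewrite RintegralD // !RintegralZl //.
rewrite -/(euler_integral x) -/(euler_integral (x + 1)) euler_integralS //.
rewrite /a /b le_eqVlt; apply/orP; left; apply/eqP; field.
by rewrite gt_eqF.
Qed.

Lemma gamma_like_euler_integral : gamma_like (@euler_integral R).
Proof.
split; [exact: euler_integral_gt0 | exact: euler_integralS |].
exact: euler_integral_log_convex.
Qed.

Opaque euler_integral.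

Definition beta_kernel x y u : R := (1 - u) `^ (x - 1) * u `^ (y - 1).

(** The exponent of [1 - u] comes first, because the kernels below are expanded in
    powers of [1 - u]. *)
Definition Beta x y : R := \int[mu]_(u in `]0, 1[) beta_kernel x y u.

Lemma open_itv01 : open (`]0, 1[%classic : set R).
Proof. exact: interval_open. Qed.

Lemma continuous_beta_kernel x y u : 0 < u < 1 ->
  {for u, continuous (beta_kernel x y)}.
Proof.
move=> /andP[u0 u1]; apply: cvgM; last exact: continuous_powR.
exact: continuous_onem_powR.
Qed.

Lemma beta_kernel_ge0 x y u : 0 <= beta_kernel x y u.
Proof. by rewrite mulr_ge0 ?powR_ge0. Qed.

Lemma beta_kernelSl x y u : u < 1 ->
  beta_kernel (x + 1) y u = (1 - u) * beta_kernel x y u.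
Proof.
move=> u1; rewrite /beta_kernel (_ : x + 1 - 1 = 1 + (x - 1)); last by ring.
by rewrite (powR_add 1 (x - 1)) ?subr_gt0 // powRr1 ?mulrA // subr_ge0 ltW.
Qed.

Lemma beta_kernelSr x y u : 0 < u ->
  beta_kernel x (y + 1) u = u * beta_kernel x y u.
Proof.
move=> u0; rewrite /beta_kernel (_ : y + 1 - 1 = 1 + (y - 1)); last by ring.
by rewrite (powR_add 1 (y - 1)) // powRr1 ?(ltW u0) // mulrCA.
Qed.

Lemma integrable_powR01 y : 0 < y ->
  mu.-integrable `]0, 1[ (EFin \o (fun u => u `^ (y - 1))).
Proof.
move=> y0; apply: (exhausts_integrable (F := fun u => y^-1 * u `^ y) (M := y^-1)
  exhausts_01 open_itv01).
- by move=> u _; exact: powR_ge0.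
- move=> u /=; rewrite in_itv /= => /andP[u0 _].
  have d1 := is_derive1_powR y u0; split; first exact: continuous_powR.
  apply: is_derive_eq; rewrite /GRing.scale /=; field; by rewrite gt_eqF.
- move=> n; rewrite lerBlDr; apply: ler_wpDr.
    by rewrite mulr_ge0 ?powR_ge0 ?invr_ge0 // ltW.
  have h0 : 0 < n.+3%:R^-1 :> R by rewrite invr_gt0.
  have h1 : n.+3%:R^-1 <= 1 :> R by rewrite invf_le1 ?ler1n.
  rewrite ler_piMr ?invr_ge0 ?(ltW y0) //.
  by apply: powR_le1; rewrite ?(ltW y0) // subr_ge0 h1 lerBlDr lerDl ltW.
Qed.

Lemma integrable_onem_powR01 x : 0 < x ->
  mu.-integrable `]0, 1[ (EFin \o (fun u => (1 - u) `^ (x - 1))).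
Proof.
move=> x0; apply: (exhausts_integrable (F := fun u => - (x^-1 * (1 - u) `^ x))
  (M := x^-1) exhausts_01 open_itv01).
- by move=> u _; exact: powR_ge0.
- move=> u /=; rewrite in_itv /= => /andP[_ u1].
  have d1 := is_derive_onem_powR x u1; split; first exact: continuous_onem_powR.
  apply: is_derive_eq; rewrite /GRing.scale /=; field; by rewrite gt_eqF.
- move=> n; rewrite opprK addrC lerBlDr; apply: ler_wpDr.
    by rewrite mulr_ge0 ?powR_ge0 ?invr_ge0 // ltW.
  have h0 : 0 < n.+3%:R^-1 :> R by rewrite invr_gt0.
  have h1 : n.+3%:R^-1 <= 1 :> R by rewrite invf_le1 ?ler1n.
  rewrite ler_piMr ?invr_ge0 ?(ltW x0) //.
  by apply: powR_le1; rewrite ?(ltW x0) // subr_ge0 h1 lerBlDr lerDl ltW.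
Qed.

(** On each half of the interval one of the two factors is bounded. *)
Lemma integrable_beta_kernel x y : 0 < x -> 0 < y ->
  mu.-integrable `]0, 1[ (EFin \o beta_kernel x y).
Proof.
move=> x0 y0; have h0 : 0 < 2^-1 :> R by rewrite invr_gt0.
pose A p : R := 1 + 2^-1 `^ (p - 1).
have A0 p : 0 <= A p by rewrite addr_ge0 ?powR_ge0.
have AE p v : 2^-1 <= v -> v <= 1 -> v `^ (p - 1) <= A p.
  move=> hv v1; have v0 : 0 < v by exact: lt_le_trans hv.
  have [p1|p1] := leP 0 (p - 1).
    apply: (@le_trans _ _ 1); last by rewrite lerDl powR_ge0.
    by rewrite -[leRHS](powRr0 v) ger_powR // v0.
  apply: (@le_trans _ _ (2^-1 `^ (p - 1))); last by rewrite lerDr.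
  rewrite -[p - 1]opprK !(powRN _ (- (p - 1))) lef_pV2 ?posrE ?powR_gt0 //.
  by rewrite ge0_ler_powR ?nnegrE ?(ltW v0) ?(ltW h0) // oppr_ge0 ltW.
have i1 := integrable_powR01 y0; have i2 := integrable_onem_powR01 x0.
have iD := integrable_add (measurable_itv _) (integrable_scale (measurable_itv _) (A x) i1)
  (integrable_scale (measurable_itv _) (A y) i2).
apply: (integrable_dominated (measurable_itv _) _ iD).
  apply: continuous_measurable_on; first exact: open_itv01.
  by move=> u /=; rewrite in_itv /=; exact: continuous_beta_kernel.
move=> u /=; rewrite in_itv /= => /andP[u0 u1].
rewrite ger0_norm ?beta_kernel_ge0 // /beta_kernel.
have [hu|hu] := leP u 2^-1.
  apply: ler_wpDr; first by rewrite mulr_ge0 ?powR_ge0.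
  by rewrite ler_wpM2r ?powR_ge0 // AE //; lra.
apply: ler_wpDl; first by rewrite mulr_ge0 ?powR_ge0.
by rewrite mulrC ler_wpM2r ?powR_ge0 // AE // ltW.
Qed.

Lemma Beta_gt0 x y : 0 < x -> 0 < y -> 0 < Beta x y.
Proof.
move=> x0 y0; apply: (Rintegral_gt0 (a := 3^-1) (b := 2^-1)) => //.
- exact: integrable_beta_kernel.
- by move=> u _; exact: beta_kernel_ge0.
- by rewrite ltf_pV2 ?posrE // ltr_nat.
- by move=> u /=; rewrite !in_itv /= => /andP[? ?]; apply/andP; split; lra.
- by move=> u /andP[? ?]; apply: continuous_beta_kernel; apply/andP; split; lra.
- by move=> u /andP[? ?]; rewrite mulr_gt0 ?powR_gt0 //; lra.
Qed.

Lemma BetaD x y : 0 < x -> 0 < y -> Beta x y = Beta (x + 1) y + Beta x (y + 1).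
Proof.
move=> x0 y0; have x1 : 0 < x + 1 by rewrite addr_gt0.
have y1 : 0 < y + 1 by rewrite addr_gt0.
rewrite /Beta -RintegralD //; [|exact: integrable_beta_kernel..].
apply: eq_Rintegral_on => u /=; rewrite in_itv /= => /andP[u0 u1].
by rewrite beta_kernelSl // beta_kernelSr //; ring.
Qed.

Lemma is_derive_beta_kernel x y u : 0 < u < 1 ->
  is_derive u 1 (fun v => (1 - v) `^ x * v `^ y)
    (y * beta_kernel (x + 1) y u - x * beta_kernel x (y + 1) u).
Proof.
move=> /andP[u0 u1]; have d1 := is_derive1_powR y u0.
have d2 := is_derive_onem_powR x u1.
apply: is_derive_eq; rewrite /beta_kernel !addrK /GRing.scale /=; ring.
Qed.

Lemma cvg_powR01 x y : 0 < x -> 0 < y ->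
  (n.+3%:R^-1 : R) `^ x * (1 - n.+3%:R^-1) `^ y @[n --> \oo] --> 0.
Proof.
move=> x0 y0.
have H : (n.+3%:R^-1 : R) `^ x @[n --> \oo] --> 0.
  have := cvg_invn_powR x0.
  rewrite -(@cvg_shiftn 1 _ (fun n => (n.+2%:R^-1 : R) `^ x)).
  by apply: cvg_trans; apply: near_eq_cvg; near=> n; rewrite /= addn1.
apply: (squeeze_cvgr _ (cvg_cst 0) H); near=> n.
have h0 : 0 < n.+3%:R^-1 :> R by rewrite invr_gt0.
have h1 : n.+3%:R^-1 <= 1 :> R by rewrite invf_le1 ?ler1n.
rewrite mulr_ge0 ?powR_ge0 //= ler_piMr ?powR_ge0 //.
by apply: powR_le1; rewrite ?(ltW y0) // subr_ge0 h1 lerBlDr lerDl ltW.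
Unshelve. all: by end_near. Qed.

(** The difference is the integral of the derivative of [(1 - v) `^ x * v `^ y], which
    vanishes at both ends. *)
Lemma Beta_balance x y : 0 < x -> 0 < y -> y * Beta (x + 1) y = x * Beta x (y + 1).
Proof.
move=> x0 y0; have x1 : 0 < x + 1 by rewrite addr_gt0.
have y1 : 0 < y + 1 by rewrite addr_gt0.
have i1 := integrable_beta_kernel x1 y0; have i2 := integrable_beta_kernel x0 y1.
have j1 := integrable_scale (measurable_itv _) y i1; have j2 := integrable_scale (measurable_itv _) x i2.
suff : \int[mu]_(u in `]0, 1[)
    (y * beta_kernel (x + 1) y u - x * beta_kernel x (y + 1) u) = 0.
  by rewrite RintegralB // !RintegralZl // => /eqP; rewrite subr_eq0 => /eqP.
apply: (exhausts_FTC (F := fun v => (1 - v) `^ x * v `^ y) exhausts_01 open_itv01).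
- exact: integrable_sub.
- move=> u /=; rewrite in_itv /= => u01; split; last exact: is_derive_beta_kernel.
  apply: cvgB; apply: cvgM;
    by [exact: cvg_cst | exact: continuous_beta_kernel].
rewrite -[X in _ --> X]subr0; apply: cvgB; last first.
  apply: cvg_trans (cvg_powR01 y0 x0); apply: near_eq_cvg; near=> n.
  by rewrite mulrC.
apply: cvg_trans (cvg_powR01 x0 y0); apply: near_eq_cvg; near=> n.
by rewrite subKr.
Unshelve. all: by end_near. Qed.

Lemma BetaSl x y : 0 < x -> 0 < y -> Beta (x + 1) y = x / (x + y) * Beta x y.
Proof.
move=> x0 y0; have xy0 : 0 < x + y by rewrite addr_gt0.
have := Beta_balance x0 y0; rewrite (BetaD x0 y0) => H.
by field: H; rewrite gt_eqF.
Qed.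

Lemma Beta1 y : 0 < y -> Beta 1 y = y^-1.
Proof.
move=> y0.
apply: (exhausts_FTC (F := fun v => y^-1 * v `^ y) exhausts_01 open_itv01).
- exact: integrable_beta_kernel.
- move=> u /=; rewrite in_itv /= => /[dup] u01 /andP[u0 _].
  have d1 := is_derive1_powR y u0; split; first exact: continuous_beta_kernel.
  apply: is_derive_eq; rewrite /GRing.scale /= /beta_kernel subrr powRr0.
  by field; rewrite gt_eqF.
rewrite -[X in _ --> X]subr0 -[X in X - _]mulr1 -[X in _ - X](mulr0 y^-1).
have L : (n.+3%:R^-1 : R) @[n --> \oo] --> 0.
  have := cvg_invn; rewrite -(@cvg_shiftn 1 _ (fun n => n.+2%:R^-1 : R)).
  by apply: cvg_trans; apply: near_eq_cvg; near=> n; rewrite /= addn1.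
apply: cvgB; apply: cvgM; try exact: cvg_cst.
  suff E : (1 - (n.+3%:R^-1 : R)) `^ y @[n --> \oo] --> (1 : R) `^ y by rewrite one_powR in E.
  have L1 : 1 - (n.+3%:R^-1 : R) @[n --> \oo] --> (1 : R).
    by rewrite -[X in _ --> X]subr0; apply: cvgB => //; exact: cvg_cst.
  apply: (@cvg_comp _ _ _ (fun n => 1 - (n.+3%:R^-1 : R)) (fun v : R => v `^ y) _ _ _ L1).
  exact: continuous_powR.
have := cvg_invn_powR y0; rewrite -(@cvg_shiftn 1 _ (fun n => (n.+2%:R^-1 : R) `^ y)).
by apply: cvg_trans; apply: near_eq_cvg; near=> n; rewrite /= addn1.
Unshelve. all: by end_near. Qed.

(** The tangent inequality at [x / (x + y)], the mean of [1 - u] for the Beta density. *)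
Lemma Beta_log_convex x y s : 0 < x -> 0 < y -> 0 <= s <= 1 ->
  Beta (x + s) y <= (x / (x + y)) `^ s * Beta x y.
Proof.
move=> x0 y0 s01; have [s0 s1] := andP s01.
have x1 : 0 < x + 1 by rewrite addr_gt0.
have xs0 : 0 < x + s by rewrite ltr_wpDr.
have xy0 : 0 < x + y by rewrite addr_gt0.
have i1 := integrable_beta_kernel x0 y0; have i2 := integrable_beta_kernel x1 y0.
pose c := x / (x + y); have c0 : 0 < c by rewrite divr_gt0.
pose a := c `^ s * (1 - s); pose b := c `^ s * (s / c).
have j1 := integrable_scale (measurable_itv _) a i1; have j2 := integrable_scale (measurable_itv _) b i2.
apply: (@le_trans _ _ (\int[mu]_(u in `]0, 1[)
    (a * beta_kernel x y u + b * beta_kernel (x + 1) y u))).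
  apply: le_Rintegral => //.
  - exact: integrable_beta_kernel.
  - exact: integrable_add.
  move=> u /=; rewrite in_itv /= => /andP[u0 u1].
  have v0 : 0 < 1 - u by rewrite subr_gt0.
  rewrite beta_kernelSl // {1}/beta_kernel (_ : x + s - 1 = s + (x - 1)); last by ring.
  rewrite (powR_add s (x - 1)) // -mulrA -/(beta_kernel x y u).
  apply: (@le_trans _ _ (c `^ s * (1 - s + s * ((1 - u) / c)) * beta_kernel x y u)).
    by rewrite ler_wpM2r ?beta_kernel_ge0 // powR_le_tangent.
  rewrite /a /b le_eqVlt; apply/orP; left; apply/eqP; ring.
rewrite RintegralD // !RintegralZl // -/(Beta x y) -/(Beta (x + 1) y) BetaSl //.
rewrite -/c /a /b le_eqVlt; apply/orP; left; apply/eqP; field.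
by rewrite gt_eqF.
Qed.

Opaque Beta.

Lemma gamma_like_Beta y : 0 < y ->
  gamma_like (fun x => euler_integral (x + y) * Beta x y).
Proof.
move=> y0; have [g0 gS gs] := gamma_like_euler_integral; split => [x x0|x x0|x s x0 s01].
- by rewrite mulr_gt0 ?Beta_gt0 // g0 // addr_gt0.
- have xy0 : 0 < x + y by rewrite addr_gt0.
  rewrite addrAC gS // BetaSl //; field; by rewrite gt_eqF.
- have xy0 : 0 < x + y by rewrite addr_gt0.
  have xs0 : 0 < x + s by rewrite ltr_wpDr //; case/andP: s01.
  rewrite addrAC.
  apply: (@le_trans _ _ ((x + y) `^ s * euler_integral (x + y) *
    ((x / (x + y)) `^ s * Beta x y))).
    apply: ler_pM; rewrite ?gs ?Beta_log_convex //; last exact/ltW/Beta_gt0.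
    apply/ltW/g0; by rewrite ltr_wpDr //; case/andP: s01.
  rewrite le_eqVlt; apply/orP; left; apply/eqP.
  have -> : x `^ s = (x + y) `^ s * (x / (x + y)) `^ s.
    by rewrite -powRM ?(ltW xy0) ?divr_ge0 ?(ltW x0) ?(ltW xy0) // mulrC divfK // gt_eqF.
  ring.
Qed.

(** Bohr-Mollerup in the variable [x]; at [x = 1] both sides are known. *)
Lemma Beta_euler_integral x y : 0 < x -> 0 < y ->
  Beta x y = euler_integral x * euler_integral y / euler_integral (x + y).
Proof.
move=> x0 y0; have [g0 gS gs] := gamma_like_euler_integral.
have := gamma_like_unique (gamma_like_Beta y0) gamma_like_euler_integral x0.
have gy := g0 _ y0; have gx := g0 _ x0.
have xy0 : 0 < euler_integral (x + y) by rewrite g0 // addr_gt0.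
rewrite /= Beta1 // euler_integral1 [1 + y]addrC gS // => H.
move: H gx gy xy0; move: (euler_integral x) (euler_integral y).
move: (euler_integral (x + y)) (Beta x y) => Gxy b Gx Gy H gx gy gxy.
have E : y * Gy / y / 1 = Gy by field; rewrite gt_eqF.
by rewrite E in H; rewrite -H; field; rewrite !gt_eqF.
Qed.

End GammaBeta.

(** * Gauss's summation theorem *)

Section Hypergeometric.
Context {R : realType}.
Implicit Types (p q r x y s : R) (u v : nat -> R).

Lemma ge0_series_cvg u (M : R) : (forall n, 0 <= u n) ->
  (forall n, series u n <= M) -> cvgn (series u).
Proof.
move=> u0 uM; apply: nondecreasing_is_cvgn; first exact: nondecreasing_series.
by exists M => _ [n _ <-].
Qed.

Lemma ge0_series_le_lim u n : (forall k, 0 <= u k) -> cvgn (series u) ->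
  series u n <= limn (series u).
Proof.
by move=> u0 cu; apply: nondecreasing_cvgn_le => //; exact: nondecreasing_series.
Qed.

(** Raabe's test: the hypothesis bounds the terms by the steps of the
    decreasing sequence [k * u k]. *)
Lemma raabe_cvg u (d : R) (N : nat) : 0 < d -> (forall k, 0 <= u k) ->
  (forall k, (N <= k)%N -> d * u k <= k%:R * u k - k.+1%:R * u k.+1) ->
  cvgn (series u).
Proof.
move=> d0 u0 H.
have E n : d * (series u (N + n)%N - series u N) <= N%:R * u N - (N + n)%:R * u (N + n)%N.
  elim: n => [|n IH]; first by rewrite addn0 !subrr mulr0.
  rewrite addnS seriesSr.
  have := H (N + n)%N (leq_addr _ _); lra.
apply: (ge0_series_cvg (M := series u N + N%:R * u N / d)) => // n.
apply: (@le_trans _ _ (series u (N + n)%N)).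
  by apply: nondecreasing_series => //; exact: leq_addl.
rewrite -lerBlDl ler_pdivlMr // mulrC; apply: le_trans (E n) _.
by rewrite lerBlDr lerDl mulr_ge0.
Qed.

(** Otherwise the terms eventually exceed [l / (2 * k)], and the harmonic series
    would converge. *)
Lemma series_cvg_natM_lim u (l : R) : (forall k, 0 <= u k) ->
  cvgn (series u) -> k%:R * u k @[k --> \oo] --> l -> l = 0.
Proof.
move=> u0 cu ul.
have l0 : 0 <= l by apply: (cvgr_to_ge ul); near=> k; rewrite mulr_ge0.
apply/eqP; rewrite eq_le l0 andbT leNgt; apply/negP => lp.
have l2 : l / 2 < l by rewrite ltr_pdivrMr // ltr_pMr // ltr1n.
have [N _ HN] := cvgr_gt l ul _ l2.
apply: (@dvg_harmonic R); rewrite -(is_cvg_series_restrict N).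
apply: nondecreasing_is_cvgn; first by apply: nondecreasing_series => k _ _; exact: harmonic_ge0.
exists (2 / l * limn (series u)) => _ [n _ <-].
apply: (@le_trans _ _ (\sum_(N <= k < n) 2 / l * u k.+1)).
  rewrite /= big_nat [leRHS]big_nat; apply: ler_sum => k /andP[Nk kn].
  have := HN k.+1 (leqW Nk); rewrite /= => h.
  rewrite -[leLHS]mul1r ler_pdivrMr // mulrAC.
  rewrite (_ : 2 / l * k.+1%:R * u k.+1 = (k.+1%:R * u k.+1) / (l / 2)).
    by rewrite ler_pdivlMr ?mul1r ?ltW // divr_gt0.
  by field; rewrite gt_eqF.
rewrite -mulr_sumr ler_pM2l ?divr_gt0 //.
apply: le_trans (ge0_series_le_lim n.+1 u0 cu).
rewrite seriesEnat /= big_nat_recl // ler_wpDl //.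
have [nN|Nn] := leqP n N; first by rewrite big_geq // sumr_ge0.
have -> : \sum_(0 <= i < n) u i.+1 = \sum_(0 <= i < N) u i.+1 + \sum_(N <= i < n) u i.+1.
  by apply: big_cat_nat; rewrite ?leq0n ?(ltnW Nn).
by rewrite lerDr; apply: sumr_ge0.
Unshelve. all: by end_near. Qed.

Lemma risingS x k : rising x k.+1 = rising x k * (x + k%:R).
Proof. by rewrite /rising big_ord_recr. Qed.

Lemma rising0 x : rising x 0 = 1.
Proof. by rewrite /rising big_ord0. Qed.

Lemma rising_gt0 x k : 0 < x -> 0 < rising x k.
Proof. by move=> x0; apply: prodr_gt0 => i _; rewrite ltr_wpDr. Qed.

Lemma rising_shift x k : x * rising (x + 1) k = rising x k * (x + k%:R).
Proof.
rewrite -risingS /rising big_ord_recl addr0; congr (_ * _).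
by apply: eq_bigr => i _; rewrite lift0 -natr1 addrAC addrA.
Qed.

(** The coefficients of the Gauss hypergeometric series. *)
Definition hcoef p q r k : R := rising p k * rising q k / rising r k / k`!%:R.

Lemma hcoef0 p q r : hcoef p q r 0 = 1.
Proof. by rewrite /hcoef !rising0 fact0 !divr1 mulr1. Qed.

Lemma hcoefS p q r k : 0 < r ->
  (k.+1%:R * (r + k%:R)) * hcoef p q r k.+1 =
    (p + k%:R) * (q + k%:R) * hcoef p q r k.
Proof.
move=> r0; rewrite /hcoef !risingS factS natrM.
have f0 : k`!%:R != 0 :> R by rewrite pnatr_eq0 -lt0n fact_gt0.
have k0 : k.+1%:R != 0 :> R by rewrite pnatr_eq0.
have rk : r + k%:R != 0 by rewrite gt_eqF // ltr_wpDr.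
have rr : rising r k != 0 by rewrite gt_eqF // rising_gt0.
move: (rising r k) (rising p k) (rising q k) k`!%:R k.+1%:R k%:R f0 k0 rk rr => a b c f m n *.
by field; apply/and4P; split.
Qed.

(** The contiguous relation behind Gauss's theorem: combined with weights, the terms
    for the parameters [r] and [r + 1] differ by a telescoping term. *)
Lemma hcoef_telescope p q r k : 0 < r ->
  r * (r - p - q) * hcoef p q r k - (r - p) * (r - q) * hcoef p q (r + 1) k =
  r * (k%:R * hcoef p q r k - k.+1%:R * hcoef p q r k.+1).
Proof.
move=> r0; have rk : 0 < r + k%:R by rewrite ltr_wpDr.
have E : hcoef p q (r + 1) k = r / (r + k%:R) * hcoef p q r k.
  rewrite /hcoef; have := rising_shift r k.
  have f0 : k`!%:R != 0 :> R by rewrite pnatr_eq0 -lt0n fact_gt0.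
  have rr := rising_gt0 k r0; have rr1 := rising_gt0 k (addr_gt0 r0 ltr01).
  move: (rising (r + 1) k) (rising r k) (rising p k) (rising q k) k`!%:R k%:R
     f0 rr rr1 rk => a b c d f n f0 b0 a0 rn0 H.
  have -> : a = b * (r + n) / r by rewrite -H mulrC mulKf // gt_eqF.
  by field; rewrite f0 !gt_eqF.
have F : k.+1%:R * hcoef p q r k.+1 =
    (p + k%:R) * (q + k%:R) * hcoef p q r k / (r + k%:R).
  by rewrite -hcoefS // mulrAC mulrK // unitfE gt_eqF.
rewrite E F; move: (hcoef p q r k) k%:R rk => h n rn.
by field; rewrite gt_eqF.
Qed.

(** The quotient of consecutive terms is [1 - (r - p - q + 1) / k + O(1 / k ^ 2)], so
    that Raabe's criterion holds with any constant below [r - p - q]. *)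
Lemma raabe_hcoef p q r : 0 < r -> 0 < r - p - q ->
  exists N : nat, forall k, (N <= k)%N ->
   (r - p - q) / 2 * `|hcoef p q r k| <=
   k%:R * `|hcoef p q r k| - k.+1%:R * `|hcoef p q r k.+1|.
Proof.
move=> r0 d0; pose d := r - p - q.
pose B := Num.max (Num.max (- p) (- q)) (2 * p * q / d + r).
exists (Num.truncn `|B|).+1 => k Nk.
have kB : B <= k%:R.
  apply: le_trans (ler_norm _) _; apply: le_trans (ltW (truncnS_gt _)) _.
  by rewrite ler_nat.
move: kB; rewrite !ge_max => /andP[/andP[kp kq] kd].
have rk : 0 < r + k%:R by rewrite ltr_wpDr.
have F : k.+1%:R * `|hcoef p q r k.+1| =
    (p + k%:R) * (q + k%:R) * `|hcoef p q r k| / (r + k%:R).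
  have := hcoefS p q k r0 => /(congr1 Num.norm).
  have pk : 0 <= p + k%:R by lra.
  have qk : 0 <= q + k%:R by lra.
  have e1 : 0 <= k.+1%:R * (r + k%:R) by rewrite mulr_ge0 // ltW.
  have e2 := mulr_ge0 pk qk.
  rewrite (normrM _ (hcoef _ _ _ _)) (normrM _ (hcoef _ _ _ k)) (ger0_norm e1) (ger0_norm e2).
  move: `|hcoef p q r k.+1| => h' H.
  by rewrite -H mulrAC mulrK // unitfE gt_eqF.
rewrite F; have := normr_ge0 (hcoef p q r k); set h := `|_| => h0.
have -> : k%:R * h - (p + k%:R) * (q + k%:R) * h / (r + k%:R) =
   (d * k%:R - p * q) / (r + k%:R) * h.
  by rewrite /d; field; rewrite gt_eqF.
rewrite ler_wpM2r // ler_pdivlMr //.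
have kd' : 2 * p * q <= d * (k%:R - r).
  by move: kd; rewrite -lerBrDr ler_pdivrMr // [_ * d]mulrC.
rewrite -/d; move: kd'; move: (k%:R) => n; lra.
Qed.

Lemma cvg_norm_hcoef p q r : 0 < r -> 0 < r - p - q ->
  cvgn (series (fun k => `|hcoef p q r k|)).
Proof.
move=> r0 d0; have [N H] := raabe_hcoef r0 d0.
by apply: raabe_cvg H; rewrite ?divr_gt0.
Qed.

Lemma cvg_hcoef p q r : 0 < r -> 0 < r - p - q -> cvgn (series (hcoef p q r)).
Proof.
move=> r0 d0; apply: (@normed_cvg R R^o (hcoef p q r)).
exact: cvg_norm_hcoef.
Qed.

Definition gauss_sum p q r : R := limn (series (hcoef p q r)).

(** The telescoped sum leaves [n * hcoef p q r n], whose limit exists and is therefore 0. *)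
Lemma gauss_sumS p q r : 0 < r -> 0 < r - p - q ->
  r * (r - p - q) * gauss_sum p q r = (r - p) * (r - q) * gauss_sum p q (r + 1).
Proof.
move=> r0 d0; have r1 : 0 < r + 1 by rewrite addr_gt0.
have d1 : 0 < r + 1 - p - q by lra.
have c0 := cvg_hcoef r0 d0; have c1 := cvg_hcoef r1 d1.
have T n : r * (r - p - q) * series (hcoef p q r) n -
    (r - p) * (r - q) * series (hcoef p q (r + 1)) n =
    - (r * (n%:R * hcoef p q r n)).
  elim: n => [|n IH].
    by rewrite !seriesEnat /= !big_geq // !mulr0 mul0r !mulr0 subrr oppr0.
  rewrite !seriesSr; have := hcoef_telescope p q n r0; move: IH; lra.
pose l := r * (r - p - q) * gauss_sum p q r -
    (r - p) * (r - q) * gauss_sum p q (r + 1).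
have L : - (r * (n%:R * hcoef p q r n)) @[n --> \oo] --> l.
  under eq_cvg do rewrite -T.
  by apply: cvgB; apply: cvgM => //; exact: cvg_cst.
have L2 : n%:R * hcoef p q r n @[n --> \oo] --> - l / r.
  have L1 : - (- (r * (n%:R * hcoef p q r n))) / r @[n --> \oo] --> - l / r.
    by apply: cvgM; [exact: cvgN | exact: cvg_cst].
  apply: cvg_near_eq L1; near=> n.
  by rewrite opprK mulrC mulKf // gt_eqF.
have := series_cvg_natM_lim (fun k => normr_ge0 _) (cvg_norm_hcoef r0 d0) (l := `|- l / r|).
move=> H; have : `|- l / r| = 0.
  apply: H; apply: cvg_near_eq (cvg_norm L2).
  by near=> n; rewrite /= normrM normr_nat.
move/eqP; rewrite normr_eq0 mulf_eq0 invr_eq0 (gt_eqF r0) orbF oppr_eq0 subr_eq0.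
by move/eqP.
Unshelve. all: by end_near. Qed.

Lemma cvg_shift_inv y : (y + n%:R)^-1 @[n --> \oo] --> (0 : R).
Proof.
apply/gtr0_cvgV0.
  near=> n; rewrite -ltrBlDl sub0r.
  by near: n; exact: nbhs_infty_gtr.
apply/cvgryPge => M; near=> n; rewrite -lerBlDl.
by near: n; exact: nbhs_infty_ger.
Unshelve. all: by end_near. Qed.

Lemma norm_hcoefS_le p q r s k : 0 < r -> r <= s ->
  `|hcoef p q s k.+1| <= r / s * `|hcoef p q r k.+1|.
Proof.
move=> r0 rs; have s0 : 0 < s by exact: lt_le_trans rs.
have e1 := rising_gt0 k.+1 r0; have e2 := rising_gt0 k.+1 s0.
rewrite /hcoef !normrM !normfV (gtr0_norm e1) (gtr0_norm e2).
rewrite (risingS r) (risingS s) -!rising_shift.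
have F0 : 0 < `|k.+1`!%:R| :> R by rewrite normr_gt0 pnatr_eq0 -lt0n fact_gt0.
have le1 : rising (r + 1) k <= rising (s + 1) k.
  by apply: ler_prod => i _; rewrite ?addr_ge0 ?(ltW r0) //= !lerD2r.
have g1 : 0 < rising (r + 1) k by rewrite rising_gt0 // addr_gt0.
have g2 : 0 < rising (s + 1) k by rewrite rising_gt0 // addr_gt0.
have P0 := normr_ge0 (rising p k.+1); have Q0 := normr_ge0 (rising q k.+1).
move: (rising (r + 1) k) (rising (s + 1) k) g1 g2 le1 F0 P0 Q0 => g h g0 h0 gh.
move: `|k.+1`!%:R| `|rising p _| `|rising q _| => F P Q F0 P0 Q0.
have -> : P * Q / (s * h) / F = P * Q / F / s * h^-1.
  by field; rewrite !gt_eqF.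
have -> : r / s * (P * Q / (r * g) / F) = P * Q / F / s * g^-1.
  by field; rewrite !gt_eqF.
by rewrite ler_wpM2l ?lef_pV2 ?posrE // !mulr_ge0 ?invr_ge0 ?(ltW F0) ?(ltW s0).
Qed.

(** All terms but the first decrease at least by the factor [r / (r + n)]. *)
Lemma cvg_gauss_sum p q r : 0 < r -> 0 < r - p - q ->
  gauss_sum p q (r + n%:R) @[n --> \oo] --> (1 : R).
Proof.
move=> r0 d0; pose a := limn (series (fun k => `|hcoef p q r k|)).
have a0 := cvg_norm_hcoef r0 d0.
have H n : `|gauss_sum p q (r + n%:R) - 1| <= r * a * (r + n%:R)^-1.
  have rn : 0 < r + n%:R by rewrite ltr_wpDr.
  have dn : 0 < r + n%:R - p - q by rewrite addrAC addrAC -addrA addrAC ltr_wpDr //; lra.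
  have c := cvg_hcoef rn dn.
  have B m : `|series (hcoef p q (r + n%:R)) m.+1 - 1| <= r * a * (r + n%:R)^-1.
    rewrite seriesEnat /= big_nat_recl // hcoef0 addrC addKr.
    apply: le_trans (ler_norm_sum _ _ _) _.
    apply: (@le_trans _ _ (\sum_(0 <= k < m) r / (r + n%:R) * `|hcoef p q r k.+1|)).
      by apply: ler_sum => k _; apply: norm_hcoefS_le => //; rewrite lerDl.
    have -> : r * a / (r + n%:R) = r / (r + n%:R) * a by rewrite mulrAC.
    rewrite -mulr_sumr ler_pM2l ?divr_gt0 //.
    apply: le_trans (ge0_series_le_lim m.+1 (fun k => normr_ge0 _) a0).
    by rewrite seriesEnat /= big_nat_recl // lerDr normr_ge0.
  have L : `|series (hcoef p q (r + n%:R)) m - 1| @[m --> \oo] -->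
      `|gauss_sum p q (r + n%:R) - 1|.
    by apply: cvg_norm; apply: cvgB => //; exact: cvg_cst.
  apply: (cvgr_to_le L); near=> m.
  have m0 : (0 < m)%N by near: m; exact: nbhs_infty_gt.
  by rewrite -(prednK m0).
apply/subr_cvg0/norm_cvg0P.
apply: squeeze_cvgr (cvg_cst 0) (_ : r * a * (r + n%:R)^-1 @[n --> \oo] --> 0).
  by near=> n; rewrite normr_ge0 /= H.
rewrite -[X in _ --> X](mulr0 (r * a)).
by apply: cvgM; [exact: cvg_cst | exact: cvg_shift_inv].
Unshelve. all: by end_near. Qed.

(** Wendel's inequalities squeeze the quotient for [0 <= s <= 1]; the recursion
    of Gamma carries the limit to all real [s]. *)
Lemma cvg_euler_integral_quotient y s :
  0 < y -> euler_integral (y + n%:R + s) /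
    ((y + n%:R) `^ s * euler_integral (y + n%:R)) @[n --> \oo] --> (1 : R).
Proof.
move=> y0; have [g0 gS gs] := @gamma_like_euler_integral R.
have yn n : 0 < y + n%:R by rewrite ltr_wpDr.
pose Q s n := euler_integral (y + n%:R + s) /
    ((y + n%:R) `^ s * euler_integral (y + n%:R)).
have unit s0 : 0 <= s0 <= 1 -> Q s0 n @[n --> \oo] --> (1 : R).
  move=> /andP[s0p s01].
  apply: (@squeeze_cvgr _ _ _ _ (fun n => 1 - (y + 1 + n%:R)^-1) (fun=> 1));
    [|  | exact: cvg_cst].
    near=> n; have z0 := yn n; rewrite /Q; have -> : y + 1 + n%:R = y + n%:R + 1 by ring.
    move: (y + n%:R) z0 => z z0.
    have zs : 0 < z + s0 by rewrite ltr_wpDr.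
    have gz := g0 _ z0; have gzs := g0 _ zs; have pz := powR_gt0 s0 z0.
    apply/andP; split; last first.
      by rewrite ler_pdivrMr ?mulr_gt0 // mul1r gs // s0p.
    have h1 : z * euler_integral z <= (z + s0) `^ (1 - s0) * euler_integral (z + s0).
      rewrite -gS // (_ : z + 1 = z + s0 + (1 - s0)); last by ring.
      by apply: gs => //; apply/andP; split; lra.
    have h2 : z `^ s0 * (z + s0) `^ (1 - s0) <= z + 1.
      apply: (@le_trans _ _ ((z + s0) `^ s0 * (z + s0) `^ (1 - s0))).
        rewrite ler_wpM2r ?powR_ge0 // ge0_ler_powR ?nnegrE ?(ltW z0) ?(ltW zs) //.
        by rewrite lerDl.
      rewrite -powR_add // (_ : s0 + (1 - s0) = 1); last by ring.
      by rewrite powRr1 ?(ltW zs) // lerD2l.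
    have z1 : 0 < z + 1 by rewrite addr_gt0.
    have -> : 1 - (z + 1)^-1 = z / (z + 1) by field; rewrite gt_eqF.
    rewrite ler_pdivlMr ?mulr_gt0 // mulrAC ler_pdivrMr //.
    have pzs := powR_gt0 (1 - s0) zs.
    move: h1 h2 gz gzs pz pzs.
    move: (euler_integral z) (euler_integral (z + s0)) (z `^ s0) ((z + s0) `^ (1 - s0)).
    move=> a b c d h1 h2 a0 b0 c0 d0.
    apply: (@le_trans _ _ (c * (d * b))).
      by rewrite mulrCA ler_wpM2l // ltW.
    by rewrite mulrA [b * _]mulrC ler_wpM2r // ltW.
  rewrite -[X in _ --> X]subr0; apply: cvgB; first exact: cvg_cst.
  exact: cvg_shift_inv.
have ratio c : (y + n%:R + c) / (y + n%:R) @[n --> \oo] --> (1 : R).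
  have L : 1 + c * (y + n%:R)^-1 @[n --> \oo] --> (1 + c * 0 : R).
    apply: cvgD; first exact: cvg_cst.
    by apply: cvgM; [exact: cvg_cst | exact: cvg_shift_inv].
  rewrite mulr0 addr0 in L; apply: cvg_near_eq L; near=> n.
  by have z0 := yn n; move: (y + n%:R) z0 => z z0; field; rewrite gt_eqF.
have large c : \forall n \near \oo, 0 < y + n%:R + c.
  near=> n; have : - c < n%:R by near: n; exact: nbhs_infty_gtr.
  by rewrite -subr_gt0 opprK => h; rewrite -addrA ltr_wpDl ?(ltW y0).
have up s0 : Q s0 n @[n --> \oo] --> (1 : R) -> Q (s0 + 1) n @[n --> \oo] --> (1 : R).
  move=> L; have L1 := cvgM (ratio s0) L; rewrite mulr1 in L1.
  apply: cvg_near_eq (L1 _); near=> n.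
  have z0 := yn n; have zs : 0 < y + n%:R + s0 by near: n; exact: large.
  rewrite /= /Q addrA gS // powR_add // powRr1 ?(ltW z0) //.
  have gz := g0 _ z0; have pz := powR_gt0 s0 z0.
  move: (y + n%:R) (euler_integral (y + n%:R)) (euler_integral (y + n%:R + s0)) gz pz z0 zs.
  move=> z a b; move: (z `^ s0) => c a0 c0 z0 zs.
  by field; rewrite !gt_eqF.
have down s0 : Q s0 n @[n --> \oo] --> (1 : R) -> Q (s0 - 1) n @[n --> \oo] --> (1 : R).
  move=> L; have L1 := cvgM (cvgV (oner_neq0 _) (ratio (s0 - 1))) L.
  rewrite invr1 mulr1 in L1; apply: cvg_near_eq (L1 _ _); near=> n.
  have z0 := yn n; have zs : 0 < y + n%:R + (s0 - 1) by near: n; exact: large.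
  have E : y + n%:R + s0 = y + n%:R + (s0 - 1) + 1 by ring.
  have E' : (y + n%:R) `^ s0 = (y + n%:R) `^ (s0 - 1) * (y + n%:R).
    by rewrite -{3}(powRr1 (ltW z0)) -powR_add // addrNK.
  rewrite /= /Q E gS // E'.
  have gz := g0 _ z0; have pz := powR_gt0 (s0 - 1) z0.
  have gzs := g0 _ zs.
  move: gz pz z0 zs gzs; move: (euler_integral (y + n%:R)) (euler_integral _) => a b.
  move: (y + n%:R) => z.
  move: (z `^ _) => c a0 c0 z0 zs b0.
  by field; rewrite !gt_eqF.
have upn s0 m : 0 <= s0 <= 1 -> Q (s0 + m%:R) n @[n --> \oo] --> (1 : R).
  move=> h; elim: m => [|m IH]; first by rewrite addr0; exact: unit.
  by rewrite -natr1 addrA; exact: up.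
have downn s0 m : 0 <= s0 <= 1 -> Q (s0 - m%:R) n @[n --> \oo] --> (1 : R).
  move=> h; elim: m => [|m IH]; first by rewrite subr0; exact: unit.
  by rewrite -natr1 opprD addrA; exact: down.
have [sp|sn] := leP 0 s.
  have /andP[a b] := truncn_itv sp.
  rewrite -[s](subrK (Num.truncn s)%:R); apply: upn.
  by rewrite subr_ge0 a lerBlDl natr1 ltW.
have sn' : 0 <= - s by rewrite oppr_ge0 ltW.
have /andP[a b] := truncn_itv sn'.
rewrite -[s](addrK (Num.truncn (- s)).+1%:R); apply: downn.
rewrite -natr1 in b *; apply/andP; split; lra.
Unshelve. all: by end_near. Qed.

(** Both sides satisfy the recursion [gauss_sumS] in [r], so their quotient takes the
    same value along [r + n]; its limit is 1 by [cvg_gauss_sum] and the growth of Gamma. *)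
Theorem gauss_summation p q r : 0 < r -> 0 < r - p -> 0 < r - q -> 0 < r - p - q ->
  gauss_sum p q r = euler_integral r * euler_integral (r - p - q) /
    (euler_integral (r - p) * euler_integral (r - q)).
Proof.
move=> r0 p0 q0 d0; have [g0 gS gs] := @gamma_like_euler_integral R.
pose f x := euler_integral (x - p) * euler_integral (x - q) /
  (euler_integral x * euler_integral (x - p - q)).
have P n : gauss_sum p q (r + n%:R) * f (r + n%:R) = gauss_sum p q r * f r.
  elim: n => [|n <-]; first by rewrite addr0.
  rewrite -natr1 addrA.
  have n0 : 0 <= n%:R :> R by [].
  have a0 : 0 < r + n%:R by lra.
  have a1 : 0 < r + n%:R - p by lra.
  have a2 : 0 < r + n%:R - q by lra.
  have a3 : 0 < r + n%:R - p - q by lra.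
  have := gauss_sumS a0 a3; rewrite /f.
  move: (r + n%:R) a0 a1 a2 a3 => x x0 x1 x2 x3.
  have -> : x + 1 - p - q = x - p - q + 1 by ring.
  have -> : x + 1 - p = x - p + 1 by ring.
  have -> : x + 1 - q = x - q + 1 by ring.
  rewrite !gS //.
  have := g0 _ x0; have := g0 _ x1; have := g0 _ x2; have := g0 _ x3.
  move: (euler_integral x) (euler_integral (x - p - q)) (euler_integral (x - p))
    (euler_integral (x - q)) (gauss_sum p q x) (gauss_sum p q (x + 1)).
  move=> a b c d S S1 b0 d0' c0 a0 H.
  have -> : S = (x - p) * (x - q) * S1 / (x * (x - p - q)).
    by rewrite -H; field; rewrite !gt_eqF.
  by field; rewrite !gt_eqF.
have L1 : gauss_sum p q (r + n%:R) * f (r + n%:R) @[n --> \oo] --> (1 : R).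
  rewrite -[X in _ --> X]mulr1; apply: cvgM; first exact: cvg_gauss_sum.
  have L := cvgM (cvgM (cvg_euler_integral_quotient (- p) r0)
    (cvg_euler_integral_quotient (- q) r0))
    (cvgV (oner_neq0 _) (cvg_euler_integral_quotient (- p - q) r0)).
  rewrite invr1 !mulr1 in L; apply: cvg_near_eq (L _ _ _); near=> n.
  rewrite /= /f addrA.
  have n0 : 0 <= n%:R :> R by [].
  have a0 : 0 < r + n%:R by lra.
  have a1 : 0 < r + n%:R - p by lra.
  have a2 : 0 < r + n%:R - q by lra.
  have a3 : 0 < r + n%:R - p - q by lra.
  rewrite powR_add //; have := powR_gt0 (- p) a0; have := powR_gt0 (- q) a0.
  have := g0 _ a0; have := g0 _ a1; have := g0 _ a2; have := g0 _ a3.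
  move: (r + n%:R) => x.
  move: (euler_integral x) (euler_integral (x - p - q)) (euler_integral (x - p))
    (euler_integral (x - q)) (x `^ (- p)) (x `^ (- q)).
  move=> a b c d e h b0 d0' c0 a0' h0 e0.
  by field; rewrite !gt_eqF.
have E : gauss_sum p q r * f r = 1.
  have L2 : gauss_sum p q r * f r @[n --> \oo] --> (1 : R).
    by apply: cvg_near_eq L1; near=> n; exact: P.
  by apply: cvg_unique L2 => //; exact: cvg_cst.
have := g0 _ r0; have := g0 _ p0; have := g0 _ q0; have := g0 _ d0.
move: E; rewrite /f; move: (gauss_sum p q r) (euler_integral r) => S a.
move: (euler_integral (r - p - q)) (euler_integral (r - p)) (euler_integral (r - q)).
move=> b c d E b0 d0' c0 a0.
have -> : S = S * (c * d / (a * b)) * (a * b / (c * d)) by field; rewrite !gt_eqF.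
by rewrite E mul1r.
Unshelve. all: by end_near. Qed.

End Hypergeometric.

(** * Integrals over the unit interval and power series kernels *)

Section Kernels.
Context {R : realType}.
Local Notation mu := (@lebesgue_measure R).
Local Notation I01 := (`]0, 1[%classic : set R).
Implicit Types (a b c p q r x y s t u : R) (f g : R -> R).

(** Substitution is done measure-theoretically: the push-forward of Lebesgue measure by
    a dilation is a multiple of it, whence the type [measurableTypeR R]. *)
Definition dilation t : R -> measurableTypeR R := fun s => s / t.

Lemma measurable_dilation t : measurable_fun setT (dilation t).
Proof. exact: mulrr_measurable. Qed.

HB.instance Definition _ t :=
  @isMeasurableFun.Build _ _ _ _ (dilation t) (measurable_dilation t).

Lemma lebesgue_measure_dilation t (A : set R) : 0 < t -> measurable A ->
  pushforward mu (dilation t) A = (t%:E * mu A)%E.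
Proof.
move=> t0 mA; have ti0 : 0 < t^-1 by rewrite invr_gt0.
pose tv := NngNum (ltW ti0).
suff -> : mu A = (t^-1%:E * pushforward mu (dilation t) A)%E.
  by rewrite muleA -EFinM divff ?gt_eqF // mul1e.
apply: (@lebesgue_measure_unique R (mscale tv (pushforward mu (dilation t))));
  [exact: measurable_dilation | | by []].
move=> ? _ [[x y] _ <-] /=; rewrite /mscale /= /pushforward.
have -> : dilation t @^-1` `]x, y] = `]x * t, y * t]%classic.
  by apply/seteqP; split => s /=; rewrite /dilation !in_itv /= ltr_pdivlMr // ler_pdivrMr.
rewrite !lebesgue_measure_itv /= !lte_fin ltr_pM2r //.
case: ifP => _; last by rewrite mule0.
by rewrite -!EFinB -EFinM -mulrBl mulrCA mulVf ?gt_eqF // mulr1.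
Qed.

Lemma ge0_integral_dilation t (f : R -> \bar R) : 0 < t -> measurable_fun I01 f ->
  (forall u, I01 u -> (0 <= f u)%E) ->
  (\int[mu]_(s in `]0%R, t[) f (s / t)%R = t%:E * \int[mu]_(u in I01) f u)%E.
Proof.
move=> t0 mf f0.
have mphi := measurable_dilation t.
rewrite -(@ge0_integral_mscale _ _ R mu I01 _ (NngNum (ltW t0))) //.
transitivity (\int[pushforward mu (dilation t)]_(u in I01) f u)%E; last first.
  by apply: eq_measure_integral => A mA _; exact: lebesgue_measure_dilation.
rewrite ge0_integral_pushforward //; last by move=> u; rewrite inE; exact: f0.
congr integral; apply/seteqP; split => s /=;
  by rewrite /dilation !in_itv /= ltr_pdivrMr // pmulr_lgt0 ?invr_gt0 // mul1r.
Qed.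

Lemma Rintegral_dilation t f : 0 < t -> mu.-integrable I01 (EFin \o f) ->
  \int[mu]_(s in `]0, t[) f (s / t) = t * \int[mu]_(u in I01) f u.
Proof.
move=> t0 fi; have mf : measurable_fun I01 (EFin \o f) by case/integrableP: fi.
rewrite /Rintegral [X in X * _](_ : t = fine t%:E) // -fineM //;
  last exact: integrable_fin_num.
congr fine; rewrite integralE [in RHS]integralE.
have mI : measurable I01 by exact: measurable_itv.
have ip := @integrable_pos_fin_num _ _ _ mu I01 mI _ fi.
have iN := @integrable_neg_fin_num _ _ _ mu I01 mI _ fi.
rewrite muleBr //; last by rewrite fin_num_adde_defr.
rewrite -(ge0_integral_dilation t0) //; last exact: measurable_funepos.
rewrite -(ge0_integral_dilation t0); [|exact: measurable_funeneg|by []].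
by congr (_ - _)%E; apply: eq_integral => s _; rewrite ?funeposE ?funenegE.
Qed.

Lemma cvg_series_eq (u v : nat -> R) : (forall n, u n = v n) ->
  cvgn (series u) -> cvgn (series v).
Proof. by move=> uv; have -> : u = v by apply/funext. Qed.

Lemma measurable_series (D : set R) (f_ : nat -> R -> R) n :
  (forall n, measurable_fun D (f_ n)) ->
  measurable_fun D (fun x => series (fun n => f_ n x) n).
Proof.
move=> mf; elim: n => [|n IH].
  have -> : (fun x => series (fun n => f_ n x) 0%N) = (fun=> 0).
    by apply/funext => x; rewrite seriesEnat /= big_geq.
  exact: measurable_cst.
have -> : (fun x => series (fun n => f_ n x) n.+1) =
    (fun x => series (fun n => f_ n x) n + f_ n x).
  by apply/funext => x; rewrite seriesSr.
exact: measurable_funD.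
Qed.

(** The sum [G] of the absolute values is integrable by monotone convergence, and
    dominates all the partial sums. *)
Lemma integral_series (D : set R) (f_ : nat -> R -> R) f : measurable D ->
  (forall n, mu.-integrable D (EFin \o f_ n)) ->
  (forall x, D x -> cvgn (series (fun n => `|f_ n x|))) ->
  (forall x, D x -> f x = limn (series (fun n => f_ n x))) ->
  cvgn (series (fun n => \int[mu]_(x in D) `|f_ n x|)) ->
  mu.-integrable D (EFin \o f) /\
  series (fun n => \int[mu]_(x in D) f_ n x) n @[n --> \oo] -->
    \int[mu]_(x in D) f x.
Proof.
move=> mD fi cf fE cI.
pose G x := limn (series (fun n => `|f_ n x|)).
pose g n x := series (fun n => `|f_ n x|) n.
have gi n : mu.-integrable D (EFin \o g n).
  elim: n => [|n IH].
    apply: (eq_integrable_on mD (f := fun=> 0)); last exact: integrable0.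
    by move=> x _; rewrite /g seriesEnat /= big_geq.
  apply: (eq_integrable_on mD (f := fun x => g n x + `|f_ n x|)).
    by move=> x _; rewrite /g seriesSr.
  by apply: integrable_add => //; exact: integrable_norm.
have gG x : D x -> g n x @[n --> \oo] --> G x by move=> Dx; exact: cf.
have mg n : measurable_fun D (g n) by exact: integrable_measurable.
have mG : measurable_fun D G by apply: measurable_fun_cvg mg gG.
have Ig n : \int[mu]_(x in D) g n x = series (fun n => \int[mu]_(x in D) `|f_ n x|) n.
  elim: n => [|n IH].
    rewrite seriesEnat /= big_geq //.
    rewrite (eq_Rintegral_on (g := fun=> 0)); last first.
      by move=> x _; rewrite /g seriesEnat /= big_geq.
    by rewrite /Rintegral integral0.
  rewrite seriesSr -IH -RintegralD //; last exact: integrable_norm.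
  by apply: eq_Rintegral_on => // x _; rewrite /g seriesSr.
have Gi : mu.-integrable D (EFin \o G).
  apply/integrableP; split; first exact/measurable_EFinP.
  have G0 x : D x -> 0 <= G x.
    by move=> Dx; apply: (cvgr_to_ge (gG x Dx)); near=> n; exact: sumr_ge0.
  have -> : (\int[mu]_(x in D) `|(EFin \o G) x| =
      \int[mu]_(x in D) limn (fun n => (g n x)%:E))%E.
    apply: eq_integral => x; rewrite inE => Dx; rewrite /= ger0_norm ?G0 //.
    by apply/esym/cvg_lim => //; apply: cvg_EFin; [near=> n | exact: gG].
  have mc := @cvg_monotone_convergence _ _ R mu D mD (fun n => EFin \o g n).
  apply: (@le_lt_trans _ _ (limn (series (fun n => \int[mu]_(x in D) `|f_ n x|)))%:E);
    last by rewrite ltry.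
  apply: (cvge_le _ (mc _ _ _)).
  - near=> n.
    have h k : 0 <= \int[mu]_(x in D) `|f_ k x| by exact: Rintegral_ge0.
    have H := ge0_series_le_lim n h cI.
    rewrite -Ig -lee_fin in H; apply: le_trans H.
    have fn : (\int[mu]_(x in D) (g n x)%:E)%E \is a fin_num.
      by have := gi n; exact: integrable_fin_num.
    by rewrite /Rintegral fineK.
  - by move=> n; apply/measurable_EFinP; exact: mg.
  - by move=> n x Dx; rewrite lee_fin; exact: sumr_ge0.
  - move=> x Dx m n mn; rewrite lee_fin.
    by apply: nondecreasing_series => // k _ _.
have Sf n : \int[mu]_(x in D) series (fun n => f_ n x) n =
    series (fun n => \int[mu]_(x in D) f_ n x) n /\
    mu.-integrable D (EFin \o (fun x => series (fun n => f_ n x) n)).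
  elim: n => [|n [IH1 IH2]].
    split.
      rewrite seriesEnat /= big_geq //.
      rewrite (eq_Rintegral_on (g := fun=> 0)); last first.
        by move=> x _; rewrite seriesEnat /= big_geq.
      by rewrite /Rintegral integral0.
    apply: (eq_integrable_on mD (f := fun=> 0)); last exact: integrable0.
    by move=> x _; rewrite seriesEnat /= big_geq.
  split; last first.
    apply: (eq_integrable_on mD (f := fun x => series (fun n => f_ n x) n + f_ n x)).
      by move=> x _; rewrite seriesSr.
    exact: integrable_add.
  rewrite seriesSr -IH1 -RintegralD //.
  by apply: eq_Rintegral_on => // x _; rewrite seriesSr.
have [|x Dx|n x Dx|Hi Hl] := @Rdominated_cvg R D
    (fun n x => series (fun n => f_ n x) n) f G mD _ Gi.
- by move=> n; apply: integrable_measurable; exact: (Sf n).2.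
- rewrite fE //; have := @normed_cvg R R^o (fun n => f_ n x) (cf x Dx); exact.
- apply: le_trans (ler_norm_sum _ _ _) _.
  by have := ge0_series_le_lim n (fun k => normr_ge0 (f_ k x)) (cf x Dx).
split => //; apply: cvg_near_eq Hl; near=> n; exact: (Sf n).1.
Unshelve. all: by end_near. Qed.

Lemma Beta_natD a y n : 0 < a -> 0 < y ->
  Beta (a + n%:R) y = rising a n / rising (a + y) n * Beta a y.
Proof.
move=> a0 y0; elim: n => [|n IH]; first by rewrite addr0 !rising0 divr1 mul1r.
rewrite -natr1 addrA BetaSl ?ltr_wpDr // IH !risingS.
rewrite addrAC; have e0 : 0 < a + y + n%:R by rewrite ltr_wpDr // addr_gt0.
have e1 : 0 < rising (a + y) n by rewrite rising_gt0 // addr_gt0.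
by field; rewrite !gt_eqF.
Qed.

(** In [k], Beta decreases like a power, hence more slowly than a geometric sequence: this makes
    series that converge against Beta converge at every [1 - u < 1]. *)
Lemma geometric_le_Beta a y (z : R) : 0 < a -> 0 < y -> 0 <= z < 1 ->
  exists2 C, 0 < C & forall k : nat, z ^+ k <= C * Beta (a + k%:R) y.
Proof.
move=> a0 y0 /andP[z0 z1].
pose N := (Num.truncn (y / (1 - z))).+1.
have z1' : 0 < 1 - z by rewrite subr_gt0.
have ak (k : nat) : 0 < a + k%:R by rewrite ltr_wpDr.
have B0 (k : nat) : 0 < Beta (a + k%:R) y by exact: Beta_gt0.
have BS (k : nat) : Beta (a + k.+1%:R) y = (a + k%:R) / (a + k%:R + y) * Beta (a + k%:R) y.
  by rewrite -natr1 addrA BetaSl.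
have decr (k : nat) : Beta (a + k.+1%:R) y <= Beta (a + k%:R) y.
  rewrite BS; apply: ler_piMl; first exact: ltW.
  have e : 0 < a + k%:R + y by rewrite addr_gt0.
  by rewrite ler_pdivrMr // mul1r lerDl ltW.
have big (k : nat) : (N <= k)%N -> z * Beta (a + k%:R) y <= Beta (a + k.+1%:R) y.
  move=> Nk; have e : 0 < a + k%:R + y by rewrite addr_gt0.
  rewrite BS ler_pM2r // ler_pdivlMr //.
  have : y / (1 - z) <= k%:R.
    by apply: le_trans (ltW (truncnS_gt _)) _; rewrite ler_nat.
  rewrite ler_pdivrMr // => H.
  have : 0 <= a * (1 - z) by rewrite mulr_ge0 ?ltW.
  have : z * y <= y by rewrite ler_piMl ?ltW.
  nra.
exists (Beta (a + N%:R) y)^-1; first by rewrite invr_gt0.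
move=> k; rewrite mulrC ler_pdivlMr //.
have [Nk|kN] := leqP N k; last first.
  apply: (@le_trans _ _ (Beta (a + N%:R) y)).
    by rewrite ler_piMl ?exprn_ile1 ?(ltW (B0 _)) // ltW.
  elim: {big} N kN => // n IH; rewrite ltnS leq_eqVlt => /orP[/eqP -> //|/IH].
  exact: le_trans (decr _).
elim: k Nk => [|k IH]; first by rewrite leqn0 => /eqP ->; rewrite expr0 mul1r.
rewrite leq_eqVlt => /orP[/eqP <-|Nk].
  by rewrite ler_piMl ?exprn_ile1 ?(ltW (B0 _)) // ltW.
rewrite exprS -mulrA; apply: le_trans (big _ Nk).
by rewrite ler_wpM2l // IH.
Qed.

Lemma beta_kernel_natD a y n u : u < 1 ->
  beta_kernel (a + n%:R) y u = (1 - u) ^+ n * beta_kernel a y u.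
Proof.
move=> u1; elim: n => [|n IH]; first by rewrite addr0 expr0 mul1r.
by rewrite -natr1 addrA beta_kernelSl // IH exprS mulrA.
Qed.

(** The expansion is at the endpoint [u = 1], where the power may be singular. *)
Definition series_kernel a (c : nat -> R) u : R :=
  (1 - u) `^ (a - 1) * limn (series (fun n => c n * (1 - u) ^+ n)).

(** Term-by-term integration: each power [(1 - u) ^+ n] shifts the first parameter of a
    Beta integral. *)
Lemma series_kernel_moment a (c : nat -> R) y : 0 < a -> 0 < y ->
  cvgn (series (fun n => `|c n| * Beta (a + n%:R) y)) ->
  [/\ measurable_fun I01 (series_kernel a c),
   mu.-integrable I01 (EFin \o (fun u => series_kernel a c u * u `^ (y - 1))) &
   series (fun n => c n * Beta (a + n%:R) y) n @[n --> \oo] -->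
   \int[mu]_(u in I01) (series_kernel a c u * u `^ (y - 1))].
Proof.
move=> a0 y0 cc; have ak (n : nat) : 0 < a + n%:R by rewrite ltr_wpDr.
have ik n := integrable_beta_kernel (ak n) y0.
have mI : measurable I01 by exact: measurable_itv.
have absc u : I01 u -> cvgn (series (fun n => `|c n * (1 - u) ^+ n|)).
  rewrite /= in_itv /= => /andP[u0 u1].
  have z01 : 0 <= 1 - u < 1 by apply/andP; split; lra.
  have [C C0 HC] := geometric_le_Beta a0 y0 z01.
  apply: (series_le_cvg (v_ := fun n => C * (`|c n| * Beta (a + n%:R) y))).
  - by move=> n.
  - by move=> n; rewrite !mulr_ge0 ?(ltW C0) // ltW // Beta_gt0.
  - move=> n; rewrite normrM mulrCA ler_wpM2l // ger0_norm ?HC // exprn_ge0 //.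
    by case/andP: z01.
  - by have := is_cvg_seriesZ (k := C) cc.
have EI n : \int[mu]_(u in I01) (c n * beta_kernel (a + n%:R) y u) =
    c n * Beta (a + n%:R) y by rewrite RintegralZl.
have EIa n : \int[mu]_(u in I01) `|c n * beta_kernel (a + n%:R) y u| =
    `|c n| * Beta (a + n%:R) y.
  rewrite -RintegralZl //; apply: eq_Rintegral_on => // u _.
  by rewrite normrM (ger0_norm (beta_kernel_ge0 _ _ _)).
have termE u n : u < 1 -> c n * beta_kernel (a + n%:R) y u =
    beta_kernel a y u * (c n * (1 - u) ^+ n).
  by move=> u1; rewrite beta_kernel_natD //; ring.
have [|u Iu|u Iu||Hi Hl] := @integral_series I01
   (fun n u => c n * beta_kernel (a + n%:R) y u)
   (fun u => series_kernel a c u * u `^ (y - 1)) mI.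
- by move=> n; exact: integrable_scale.
- apply: cvg_series_eq (is_cvg_seriesZ (k := `|beta_kernel a y u|) (absc u Iu)) => n.
  rewrite termE; last by move: Iu; rewrite /= in_itv /= => /andP[].
  by rewrite [RHS]normrM.
- have u1 : u < 1 by move: Iu; rewrite /= in_itv /= => /andP[].
  have cu : cvgn (series (fun n => c n * (1 - u) ^+ n)).
    exact: (@normed_cvg R R^o _ (absc u Iu)).
  have -> : (fun n => c n * beta_kernel (a + n%:R) y u) =
      (fun n => beta_kernel a y u *: (c n * (1 - u) ^+ n : R^o)).
    by apply/funext => n; rewrite termE.
  have := lim_seriesZ (beta_kernel a y u) cu => /= ->.
  by rewrite /series_kernel /beta_kernel mulrAC.
- by apply: cvg_series_eq cc => n; rewrite EIa.
split => //.
- apply: measurable_funM.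
    apply: continuous_measurable_on; first exact: open_itv01.
    by move=> u /=; rewrite in_itv /= => /andP[_ u1]; exact: continuous_onem_powR.
  apply: (@measurable_fun_cvg _ _ R I01 (fun n u => series (fun n => c n * (1 - u) ^+ n) n)).
    move=> n; apply: measurable_series => {}n; apply: measurable_funM => //.
    apply: measurable_funX; exact: measurable_funB.
  by move=> u Iu; exact: (@normed_cvg R R^o _ (absc u Iu)).
- apply: cvg_near_eq Hl; near=> n; congr (series _ n).
  by apply/funext => m; rewrite EI.
Unshelve. all: by end_near. Qed.

End Kernels.

(** * Weierstrass approximation *)

Section Weierstrass.
Context {R : realType}.
Implicit Types (f g : nat -> R) (h : R -> R) (n : nat) (w c e : R).

(** The Bernstein polynomial of degree [n] with values [f], that is, the mean
    of [f] at a binomial variable with parameters [n] and ['X], defined by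
    conditioning on the first trial. *)
Fixpoint bernstein n f : {poly R} :=
  if n is n'.+1 then
    'X * bernstein n' (fun k => f k.+1) + (1 - 'X) * bernstein n' f
  else (f 0%N)%:P.

Lemma bernsteinS n f w : (bernstein n.+1 f).[w] =
  w * (bernstein n (fun k => f k.+1)).[w] + (1 - w) * (bernstein n f).[w].
Proof. by rewrite /= !hornerE. Qed.

(** A mean of the values [f k], [k <= n], with nonnegative weights. *)
Lemma ler_bernstein n f g w : 0 <= w <= 1 ->
  (forall k, (k <= n)%N -> f k <= g k) -> (bernstein n f).[w] <= (bernstein n g).[w].
Proof.
move=> /andP[w0 w1]; elim: n f g => [|n IH] f g fg; first by rewrite /= !hornerE fg.
rewrite !bernsteinS lerD // ler_wpM2l ?subr_ge0 // IH // => k kn; apply: fg => //.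
exact: leqW.
Qed.

Lemma bernstein_affine n f g (a b : R) w :
  (bernstein n (fun k => a * f k + b * g k)).[w] =
  a * (bernstein n f).[w] + b * (bernstein n g).[w].
Proof.
elim: n f g => [|n IH] f g; first by rewrite /= !hornerE.
by rewrite !bernsteinS !IH; ring.
Qed.

Lemma bernstein_cst n c w : (bernstein n (fun=> c)).[w] = c.
Proof.
elim: n => [|n IH]; first by rewrite /= !hornerE.
by rewrite bernsteinS !IH; ring.
Qed.

(** The second moment about [c] of a binomial variable. *)
Lemma bernstein_variance n c w :
  (bernstein n (fun k => (k%:R - c) ^+ 2)).[w] =
  n%:R * (w * (1 - w)) + (n%:R * w - c) ^+ 2.
Proof.
elim: n c => [|n IH] c; first by rewrite /= !hornerE; ring.
rewrite bernsteinS IH.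
have -> : (fun k => (k.+1%:R - c) ^+ 2) = (fun k : nat => (k%:R - (c - 1)) ^+ 2).
  by apply/funext => k; rewrite -natr1; ring.
by rewrite IH -natr1; ring.
Qed.

Lemma unif_continuous01 h e : continuous h -> 0 < e ->
  exists2 d, 0 < d & forall x y, 0 <= x <= 1 -> `|y - x| < d -> `|h y - h x| <= e.
Proof.
move=> ch e0.
have /compact_near_coveringP/(_ R (0^'+) (fun d x => forall y, `|y - x| < d -> `|h y - h x| <= e)) :=
  @segment_compact R 0 1.
case=> [x _|d d0 H].
  have e2 : 0 < e / 2 by rewrite divr_gt0.
  have := cvgr_dist_le _ _ (ch x) _ e2 => -[r /= r0 Hr].
  have r2 : 0 < r / 2 by rewrite divr_gt0.
  exists (ball x (r / 2), [set d | 0 < d < r / 2]).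
    split; first exact: nbhsx_ballx.
    by exists (r / 2) => // d /=; rewrite sub0r normrN => dr d0; rewrite d0 /= (le_lt_trans (ler_norm d)).
  move=> [x' d] /= [xx' /andP[d0 dr]] y yx'.
  have hx' : `|h x - h x'| <= e / 2 by apply: Hr; apply: lt_le_trans xx' _; lra.
  have hy : `|h x - h y| <= e / 2.
    apply: Hr; rewrite /ball /= (_ : x - y = (x - x') - (y - x')); last by ring.
    apply: le_lt_trans (ler_normB _ _) _; move: xx' yx'; rewrite /ball /=; lra.
  rewrite (_ : h y - h x' = (h x - h x') - (h x - h y)); last by ring.
  apply: le_trans (ler_normB _ _) _; lra.
have [d' /andP[d'0 d'd]] : exists d' : R, 0 < d' < d.
  by exists (d / 2); apply/andP; split; [rewrite divr_gt0 | rewrite ltr_pdivrMr // ltr_pMr // ltr1n].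
exists d' => // x y x01 yx; apply: (H d') => //.
by rewrite /= sub0r normrN gtr0_norm.
Qed.

Theorem weierstrass01 h e : continuous h -> 0 < e ->
  exists Q : {poly R}, forall w, 0 <= w <= 1 -> `|h w - Q.[w]| <= e.
Proof.
move=> ch e0; have e2 : 0 < e / 2 by rewrite divr_gt0.
have [d d0 Hd] := unif_continuous01 ch e2.
have [M M0 HM] : exists2 M, 0 < M & forall w, 0 <= w <= 1 -> `|h w| <= M.
  have [|c _ Hc] := @EVT_max R (fun w => `|h w|) 0 1 ler01.
    apply: continuous_subspaceT => x.
    by apply: (@continuous_comp _ _ _ h); [exact: ch | exact: norm_continuous].
  exists (`|h c| + 1) => [|w w01]; first by rewrite ltr_wpDl.
  by rewrite (le_trans (Hc w _)) ?lerDl // in_itv.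
pose C := 2 * M / d ^+ 2.
have C0 : 0 < C by rewrite divr_gt0 ?mulr_gt0 ?exprn_gt0.
pose n := (Num.truncn (C / (e / 2))).+1.
have n0 : 0 < n%:R :> R by rewrite ltr0n.
have Cn : C / n%:R <= e / 2.
  rewrite ler_pdivrMr // mulrC -ler_pdivrMr //.
  exact: ltW (truncnS_gt _).
exists (bernstein n (fun k => h (k%:R / n%:R))) => w /[dup] w01 /andP[w0 w1].
(* Chebyshev's argument: away from [w] the squared deviation, divided by [d ^ 2],
   is at least 1. *)
have key k : (k <= n)%N ->
    `|h (k%:R / n%:R) - h w| <= e / 2 * 1 + C / n%:R ^+ 2 * (k%:R - n%:R * w) ^+ 2.
  move=> kn; have [lt|ge] := ltP `|k%:R / n%:R - w| d.
    by rewrite mulr1 ler_wpDr ?Hd // mulr_ge0 ?sqr_ge0 // divr_ge0 ?exprn_ge0 // ltW.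
  have kn01 : 0 <= (k%:R / n%:R : R) <= 1.
    by rewrite divr_ge0 //= ler_pdivrMr // mul1r ler_nat.
  apply: (@le_trans _ _ (2 * M)).
    apply: le_trans (ler_normB _ _) _.
    have := HM _ kn01; have := HM _ w01; lra.
  apply: ler_wpDl; first by rewrite mulr1 ltW.
  have -> : C / n%:R ^+ 2 * (k%:R - n%:R * w) ^+ 2 =
      2 * M * (`|k%:R / n%:R - w| / d) ^+ 2.
    rewrite /C expr_div_n real_normK ?num_real //; field.
    by rewrite !gt_eqF.
  rewrite ler_peMr ?mulr_ge0 ?(ltW M0) // exprn_ege1 // ler_pdivlMr // mul1r.
  exact: ge.
rewrite distrC.
have -> : (bernstein n (fun k => h (k%:R / n%:R))).[w] - h w =
    (bernstein n (fun k => h (k%:R / n%:R) - h w)).[w].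
  have -> : (fun k : nat => h (k%:R / n%:R) - h w) =
      (fun k : nat => 1 * h (k%:R / n%:R) + (-1) * h w).
    by apply/funext => k; ring.
  by rewrite (bernstein_affine _ _ (fun=> h w)) bernstein_cst; ring.
pose g k := e / 2 * 1 + C / n%:R ^+ 2 * (k%:R - n%:R * w) ^+ 2.
have gE : (bernstein n g).[w] <= e.
  rewrite /g (bernstein_affine _ (fun=> 1)) bernstein_cst bernstein_variance.
  rewrite subrr expr0n addr0.
  have -> : C / n%:R ^+ 2 * (n%:R * (w * (1 - w))) = C / n%:R * (w * (1 - w)).
    by field; rewrite gt_eqF.
  have : C / n%:R * (w * (1 - w)) <= e / 2 * 1.
    apply: ler_pM => //; [by rewrite divr_ge0 ?ltW | by rewrite mulr_ge0 ?subr_ge0 |].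
    nra.
  lra.
rewrite ler_norml; apply/andP; split; last first.
  apply: le_trans gE; apply: ler_bernstein => // k kn.
  exact: le_trans (ler_norm _) (key k kn).
apply: (@le_trans _ _ (- (bernstein n g).[w])); first by rewrite lerN2.
have -> : - (bernstein n g).[w] = (bernstein n (fun k => - g k)).[w].
  have -> : (fun k => - g k) = (fun k => (-1) * g k + 0 * 0) by apply/funext => k; ring.
  by rewrite (bernstein_affine _ _ (fun=> 0)); ring.
apply: ler_bernstein => // k kn; rewrite lerNl.
by apply: le_trans (key k kn); rewrite -normrN ler_norm.
Qed.

End Weierstrass.

(** * Mellin operators *)

Section MomentKernels.
Context {R : realType}.
Local Notation mu := (@lebesgue_measure R).
Local Notation I01 := (`]0, 1[%classic : set R).
Implicit Types (a b c p q x y s t u w : R) (k f psi : R -> R) (Q : {poly R}).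

Let mI : measurable I01. Proof. exact: measurable_itv. Qed.

Lemma in01 u : I01 u -> 0 < u /\ u < 1.
Proof. by rewrite /= in_itv /= => /andP. Qed.

(** The measure [c * dirac 1 + k v dv] on [0 < v <= 1] has Mellin transform [m] on
    [y0 <= y]. The point mass occurs for the derivative of order 1. *)
Definition moment_kernel c k y0 (m : R -> R) : Prop :=
  measurable_fun I01 k /\
  forall y, y0 <= y -> mu.-integrable I01 (EFin \o (fun v => k v * v `^ (y - 1))) /\
    c + \int[mu]_(v in I01) (k v * v `^ (y - 1)) = m y.

(** A multiplicative convolution, which multiplies the power [u `^ (y - 1)] by the
    moment [m y]. *)
Definition mellin_op c k psi u : R :=
  c * psi u + \int[mu]_(v in I01) (k v * psi (u * v)).

Definition moment_poly (m : R -> R) y0 Q : {poly R} :=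
  \poly_(i < size Q) (Q`_i * m (y0 + i%:R)).

(** The closure of the functions [w `^ (y0 - 1) * Q.[w]] for the norm with weight
    [w `^ (y0 - 1)]; on them an operator is determined by its moments. *)
Definition power_adherent y0 psi : Prop := forall e, 0 < e ->
  exists Q, forall w, 0 < w <= 1 -> `|psi w - w `^ (y0 - 1) * Q.[w]| <= e * w `^ (y0 - 1).

Lemma moment_kernel_sum c k y0 m (n : nat) (r : nat -> R) : moment_kernel c k y0 m ->
  mu.-integrable I01
    (EFin \o (fun v => k v * \sum_(i < n) r i * v `^ (y0 + i%:R - 1))) /\
  c * (\sum_(i < n) r i) +
    \int[mu]_(v in I01) (k v * \sum_(i < n) r i * v `^ (y0 + i%:R - 1)) =
  \sum_(i < n) r i * m (y0 + i%:R).
Proof.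
move=> [mk hk]; elim: n => [|n [IHi IHe]].
  split.
    apply: (eq_integrable_on mI (f := fun=> 0)); last exact: integrable0.
    by move=> v _; rewrite big_ord0 mulr0.
  rewrite !big_ord0 mulr0 add0r (eq_Rintegral_on (g := fun=> 0)).
    by rewrite /Rintegral integral0.
  by move=> v _; rewrite big_ord0 mulr0.
have [|hi he] := hk (y0 + n%:R); first by rewrite lerDl.
have E v : k v * (\sum_(i < n.+1) r i * v `^ (y0 + i%:R - 1)) =
   k v * (\sum_(i < n) r i * v `^ (y0 + i%:R - 1)) + r n * (k v * v `^ (y0 + n%:R - 1)).
  by rewrite big_ord_recr /= mulrDr; congr (_ + _); rewrite mulrCA.
have ri := integrable_scale mI (r n) hi.
split.
  apply: (eq_integrable_on mI _ (integrable_add mI IHi ri)) => v _; exact: (esym (E v)).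
rewrite (eq_Rintegral_on (fun v _ => E v)) RintegralD // RintegralZl //.
by rewrite !big_ord_recr /= -IHe -he; ring.
Qed.

Lemma moment_kernel_poly c k y0 m Q u : moment_kernel c k y0 m -> 0 < u ->
  mu.-integrable I01
    (EFin \o (fun v => k v * ((u * v) `^ (y0 - 1) * Q.[u * v]))) /\
  mellin_op c k (fun w => w `^ (y0 - 1) * Q.[w]) u =
    u `^ (y0 - 1) * (moment_poly m y0 Q).[u].
Proof.
move=> mk u0; have [hi he] := moment_kernel_sum (size Q) (fun i => Q`_i * u ^+ i) mk.
have E v : I01 v -> k v * ((u * v) `^ (y0 - 1) * Q.[u * v]) =
    u `^ (y0 - 1) * (k v * (\sum_(i < size Q) Q`_i * u ^+ i * v `^ (y0 + i%:R - 1))).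
  move=> /in01[v0 v1]; rewrite horner_coef powRM ?(ltW u0) ?(ltW v0) //.
  rewrite mulrCA -!mulrA; congr (_ * _); rewrite mulrCA; congr (_ * _).
  rewrite mulr_sumr; apply: eq_bigr => i _.
  rewrite (_ : y0 + i%:R - 1 = y0 - 1 + i%:R); last by ring.
  by rewrite (powR_add (y0 - 1) i%:R v0) powR_mulrn ?(ltW v0) // exprMn; ring.
split.
  by apply: (eq_integrable_on mI _ (integrable_scale mI (u `^ (y0 - 1)) hi)) => v Iv; exact: (esym (E v Iv)).
rewrite /mellin_op (eq_Rintegral_on E) RintegralZl //.
rewrite /moment_poly horner_poly (_ : \sum_(i < _) _ = \sum_(i < size Q) Q`_i * u ^+ i * m (y0 + i%:R)).
  rewrite -he horner_coef; ring.
by apply: eq_bigr => i _; ring.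
Qed.

Definition moment_norm c k y0 : R :=
  `|c| + \int[mu]_(v in I01) `|k v * v `^ (y0 - 1)|.

Lemma moment_norm_ge0 c k y0 : 0 <= moment_norm c k y0.
Proof. by rewrite addr_ge0 // Rintegral_ge0. Qed.

(** Boundedness for the weighted norm: the kernel is integrable against [v `^ (y0 - 1)]. *)
Lemma mellin_op_bound c k y0 m psi u (M : R) : moment_kernel c k y0 m ->
  0 < u -> measurable_fun I01 (fun v => psi (u * v)) ->
  `|psi u| <= M * u `^ (y0 - 1) ->
  (forall v, I01 v -> `|psi (u * v)| <= M * (u * v) `^ (y0 - 1)) ->
  mu.-integrable I01 (EFin \o (fun v => k v * psi (u * v))) /\
  `|mellin_op c k psi u| <= M * moment_norm c k y0 * u `^ (y0 - 1).
Proof.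
move=> [mk hk] u0 mpsi b1 b.
have [ki _] := hk y0 (lexx _).
have kni := integrable_scale mI (M * u `^ (y0 - 1)) (integrable_norm ki).
have B v : I01 v -> `|k v * psi (u * v)| <=
    M * u `^ (y0 - 1) * `|k v * v `^ (y0 - 1)|.
  move=> /[dup] Iv /in01[v0 v1].
  rewrite !normrM (ger0_norm (powR_ge0 v _)) mulrCA ler_wpM2l //.
  by rewrite -mulrA -powRM ?(ltW u0) ?(ltW v0) // b.
have i1 : mu.-integrable I01 (EFin \o (fun v => k v * psi (u * v))).
  by apply: (integrable_dominated mI _ kni) => //; exact: measurable_funM.
split => //; rewrite /mellin_op.
apply: le_trans (ler_normD _ _) _.
rewrite /moment_norm mulrDr mulrDl lerD //.
  by rewrite normrM mulrAC mulrC ler_wpM2r.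
apply: (@le_trans _ _ (\int[mu]_(v in I01) `|k v * psi (u * v)|)).
  exact: le_normr_Rintegral.
rewrite mulrAC -RintegralZl //; last exact: integrable_norm.
by apply: le_Rintegral => //; exact: integrable_norm.
Qed.

(** A locally uniform limit of continuous functions. *)
Lemma power_adherent_continuous y0 psi x : power_adherent y0 psi -> 0 < x < 1 ->
  {for x, continuous psi}.
Proof.
move=> ad /andP[x0 x1].
pose g w := psi w * w `^ (1 - y0).
have gE w : 0 < w -> psi w = g w * w `^ (y0 - 1).
  move=> w0; rewrite /g -mulrA -powR_add // (_ : 1 - y0 + (y0 - 1) = 0); last by ring.
  by rewrite powRr0 mulr1.
have cg : {for x, continuous g}.
  apply/cvgrPdist_le => e e0; have e3 : 0 < e / 3 by rewrite divr_gt0.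
  have [Q HQ] := ad _ e3.
  have HQ' w : 0 < w <= 1 -> `|g w - Q.[w]| <= e / 3.
    move=> /[dup] w01 /andP[w0 _].
    have -> : g w - Q.[w] = (psi w - w `^ (y0 - 1) * Q.[w]) * w `^ (1 - y0).
      rewrite mulrBl -/(g w) mulrAC -powR_add // (_ : y0 - 1 + (1 - y0) = 0); last by ring.
      by rewrite powRr0 mul1r.
    rewrite normrM (ger0_norm (powR_ge0 _ _)).
    apply: le_trans (ler_wpM2r (powR_ge0 _ _) (HQ w w01)) _.
    rewrite -mulrA -powR_add // (_ : y0 - 1 + (1 - y0) = 0); last by ring.
    by rewrite powRr0 mulr1.
  have /cvgrPdist_le/(_ _ e3) cQ := @continuous_horner R Q x.
  near=> w.
  have w0 : 0 < w by near: w; exact: lt_nbhsr.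
  have w1 : w < 1 by near: w; exact: lt_nbhsl.
  have h1 : `|g x - Q.[x]| <= e / 3 by apply: HQ'; rewrite x0 ltW.
  have h2 : `|g w - Q.[w]| <= e / 3 by apply: HQ'; rewrite w0 ltW.
  have h3 : `|Q.[x] - Q.[w]| <= e / 3 by near: w; exact: cQ.
  rewrite (_ : g x - g w = (g x - Q.[x]) + (Q.[x] - Q.[w]) - (g w - Q.[w])); last by ring.
  apply: le_trans (ler_normB _ _) _.
  apply: le_trans (lerD (ler_normD _ _) (lexx _)) _; lra.
suff : psi w @[w --> x] --> psi x by [].
rewrite (gE x x0).
have cc : g w * w `^ (y0 - 1) @[w --> x] --> g x * x `^ (y0 - 1).
  by apply: cvgM => //; exact: continuous_powR.
apply: (@cvg_trans _ (g w * w `^ (y0 - 1) @[w --> x])).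
  apply: near_eq_cvg; near=> w; rewrite /= -gE //.
  by near: w; exact: lt_nbhsr.
exact: cc.
Unshelve. all: by end_near. Qed.

Lemma power_adherent_measurable y0 psi u : power_adherent y0 psi -> 0 < u <= 1 ->
  measurable_fun I01 (fun v => psi (u * v)).
Proof.
move=> ad /andP[u0 u1]; apply: continuous_measurable_on; first exact: open_itv01.
move=> v /in01[v0 v1].
apply: (@continuous_comp _ _ _ (fun v : R => u * v) psi).
  by apply: cvgM; [exact: cvg_cst | exact: cvg_id].
apply: power_adherent_continuous ad _; rewrite mulr_gt0 //=.
by apply: le_lt_trans v1; rewrite ler_piMl // ltW.
Qed.

(** An approximation of [psi] is carried to one of its image, by the exact action on
    powers and the bound [mellin_op_bound]. *)
Lemma mellin_op_approx c k y0 m psi Q e u : moment_kernel c k y0 m ->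
  power_adherent y0 psi -> 0 < u <= 1 ->
  (forall w, 0 < w <= 1 -> `|psi w - w `^ (y0 - 1) * Q.[w]| <= e * w `^ (y0 - 1)) ->
  mu.-integrable I01 (EFin \o (fun v => k v * psi (u * v))) /\
  `|mellin_op c k psi u - u `^ (y0 - 1) * (moment_poly m y0 Q).[u]| <=
    e * moment_norm c k y0 * u `^ (y0 - 1).
Proof.
move=> mk ad /[dup] u01 /andP[u0 u1] H.
have [pi pE] := moment_kernel_poly Q mk u0.
have mpsi := power_adherent_measurable ad u01.
have mpow : measurable_fun I01 (fun v => (u * v) `^ (y0 - 1) * Q.[u * v]).
  apply: continuous_measurable_on; first exact: open_itv01.
  move=> v /in01[v0 v1].
  apply: (@continuous_comp _ _ _ (fun v : R => u * v) (fun w => w `^ (y0 - 1) * Q.[w])).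
    by apply: cvgM; [exact: cvg_cst | exact: cvg_id].
  apply: cvgM; last exact: continuous_horner.
  by apply: continuous_powR; rewrite mulr_gt0.
have [||v /in01[v0 v1]|di dB] :=
    @mellin_op_bound c k y0 m (fun w => psi w - w `^ (y0 - 1) * Q.[w]) u e mk u0.
- exact: measurable_funB.
- exact: H.
- apply: H; rewrite mulr_gt0 //=.
  by apply: le_trans (ltW v1); rewrite ler_piMl // ltW.
have ki : mu.-integrable I01 (EFin \o (fun v => k v * psi (u * v))).
  by apply: (eq_integrable_on mI _ (integrable_add mI di pi)) => v _; ring.
split => //; move: dB; congr (`|_| <= _).
rewrite -pE /mellin_op.
have -> : \int[mu]_(v in I01) (k v * (psi (u * v) - (u * v) `^ (y0 - 1) * Q.[u * v])) =
  \int[mu]_(v in I01) (k v * psi (u * v)) -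
  \int[mu]_(v in I01) (k v * ((u * v) `^ (y0 - 1) * Q.[u * v])).
  by rewrite -RintegralB //; apply: eq_Rintegral_on => v _; ring.
ring.
Qed.

Lemma power_adherent_op c k y0 m psi : moment_kernel c k y0 m ->
  power_adherent y0 psi -> power_adherent y0 (mellin_op c k psi).
Proof.
move=> mk ad e e0; pose C := moment_norm c k y0 + 1.
have C0 : 0 < C by rewrite ltr_wpDl // moment_norm_ge0.
have [|Q HQ] := ad (e / C); first by rewrite divr_gt0.
exists (moment_poly m y0 Q) => w w01.
have [_] := mellin_op_approx mk ad w01 HQ; move/le_trans; apply.
rewrite ler_wpM2r ?powR_ge0 // mulrAC ler_pdivrMr // ler_wpM2l ?(ltW e0) //.
by rewrite lerDl.
Qed.

Lemma power_adherent_mul y0 s psi : power_adherent y0 psi ->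
  power_adherent (y0 + s) (fun w => w `^ s * psi w).
Proof.
move=> ad e e0; have [Q HQ] := ad e e0; exists Q => w /[dup] w01 /andP[w0 _].
rewrite (_ : y0 + s - 1 = s + (y0 - 1)); last by ring.
rewrite powR_add // -mulrA -mulrBr normrM (ger0_norm (powR_ge0 _ _)) mulrCA.
by rewrite ler_wpM2l ?powR_ge0 // HQ.
Qed.

(** Both sides act on powers by the same factor, and both are bounded; so they agree
    on the closure of the powers. The factor [w `^ s] shifts the exponents. *)
Lemma mellin_op_comp c1 k1 m1 c2 k2 m2 c3 k3 m3 y0 s psi :
  moment_kernel c1 k1 (y0 + s) m1 -> moment_kernel c2 k2 y0 m2 ->
  moment_kernel c3 k3 y0 m3 -> (forall y, y0 <= y -> m1 (y + s) * m2 y = m3 y) ->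
  power_adherent y0 psi ->
  mellin_op c1 k1 (fun w => w `^ s * mellin_op c2 k2 psi w) 1 = mellin_op c3 k3 psi 1.
Proof.
move=> mk1 mk2 mk3 E ad.
set L1 := LHS; set L3 := RHS.
pose C := moment_norm c2 k2 y0 * moment_norm c1 k1 (y0 + s) + moment_norm c3 k3 y0.
have u01 : 0 < (1 : R) <= 1 by rewrite ltr01 lexx.
(* Both sides are within a multiple of [e] of the same value, the image of the
   approximating combination of powers. *)
have key e : 0 < e -> `|L1 - L3| <= e * C.
  move=> e0; have [Q HQ] := ad e e0.
  have [_ B3] := mellin_op_approx mk3 ad u01 HQ.
  have H2 w : 0 < w <= 1 -> `|w `^ s * mellin_op c2 k2 psi w -
      w `^ (y0 + s - 1) * (moment_poly m2 y0 Q).[w]| <=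
      e * moment_norm c2 k2 y0 * w `^ (y0 + s - 1).
    move=> /[dup] w01 /andP[w0 _]; have [_ B2] := mellin_op_approx mk2 ad w01 HQ.
    rewrite (_ : y0 + s - 1 = s + (y0 - 1)); last by ring.
    rewrite powR_add // -mulrA -mulrBr normrM (ger0_norm (powR_ge0 _ _)) mulrCA.
    by rewrite ler_wpM2l ?powR_ge0.
  have [_ B1] := mellin_op_approx mk1 (power_adherent_mul s (power_adherent_op mk2 ad)) u01 H2.
  rewrite !one_powR !mul1r !mulr1 -/L3 in B3.
  rewrite !one_powR !mul1r !mulr1 -/L1 in B1.
  have P13 : (moment_poly m1 (y0 + s) (moment_poly m2 y0 Q)).[1] = (moment_poly m3 y0 Q).[1].
    have expand (m : R -> R) z (P : {poly R}) n : (size P <= n)%N ->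
        (moment_poly m z P).[1] = \sum_(i < n) P`_i * m (z + i%:R).
      move=> Pn; rewrite (horner_coef_wide _ (leq_trans (size_poly _ _) Pn)).
      apply: eq_bigr => i _; rewrite expr1n mulr1 coef_poly.
      by case: ltnP => // Pi; rewrite nth_default ?mul0r.
    rewrite (expand m1 _ _ (size Q)) ?size_poly // (expand m3 _ _ (size Q)) //.
    apply: eq_bigr => i _; rewrite coef_poly ltn_ord -mulrA; congr (_ * _).
    by rewrite addrAC mulrC E // lerDl.
  rewrite P13 in B1; set z := (moment_poly _ _ _).[1] in B1 B3.
  rewrite (_ : L1 - L3 = (L1 - z) - (L3 - z)); last by ring.
  apply: le_trans (ler_normB _ _) _; rewrite /C mulrDr mulrA; exact: lerD.
have C0 : 0 <= C by rewrite addr_ge0 ?mulr_ge0 ?moment_norm_ge0.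
apply/eqP; rewrite -subr_eq0 -normr_le0 leNgt; apply/negP => d0.
have C1 : 0 < C + 1 by rewrite ltr_wpDl.
have := key (`|L1 - L3| / (C + 1)) (divr_gt0 d0 C1).
rewrite mulrAC ler_pdivlMr // ler_pM2l // leNgt => /negP; apply.
by rewrite ltrDl.
Qed.

Lemma moment_kernel1 y0 : 0 < y0 -> moment_kernel 0 (fun=> 1) y0 (fun y => y^-1).
Proof.
move=> y00; split; first exact: measurable_cst.
move=> y yy0; have y0' : 0 < y by exact: lt_le_trans yy0.
have i1 := integrable_powR01 y0'.
have E (v : R) : I01 v -> v `^ (y - 1) = 1 * v `^ (y - 1) by rewrite mul1r.
split; first exact: (eq_integrable_on mI E i1).
rewrite add0r -(eq_Rintegral_on E) -Beta1 //; apply: eq_Rintegral_on => v _.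
by rewrite /beta_kernel subrr powRr0 mul1r.
Qed.

(** Divided by [w `^ (y0 - 1)], the function extends continuously by 0 at [w = 0], since
    [s] exceeds [y0 - 1]; Weierstrass's theorem applies to the extension. *)
Lemma power_adherent_bigO f y0 s t : 0 < t ->
  (forall x, 0 < x -> {for x, continuous f}) ->
  f =O_ (0^'+) (fun x => x `^ s) -> y0 - 1 < s ->
  power_adherent y0 (fun w => f (t * w)).
Proof.
move=> t0 cf fO ys e e0.
pose h w := if w <= 0 then 0 else f (t * w) * w `^ (1 - y0).
have c2 (x : R) : 0 < x ->
    f (t * w) * w `^ (1 - y0) @[w --> x] --> f (t * x) * x `^ (1 - y0).
  move=> x0; apply: cvgM; last exact: continuous_powR.
  apply: (@continuous_comp _ _ _ (fun v : R => t * v) f).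
    by apply: cvgM; [exact: cvg_cst | exact: cvg_id].
  by apply: cf; rewrite mulr_gt0.
have ch : continuous h.
  move=> x; have [x0|x0|->] := ltgtP x 0.
  - rewrite /continuous_at /h (ltW x0); apply: cvg_near_cst; near=> w.
    by rewrite ifT // ltW //; near: w; exact: lt_nbhsl.
  - rewrite /continuous_at {2}/h leNgt x0 /=.
    apply: (@cvg_trans _ (f (t * w) * w `^ (1 - y0) @[w --> x])).
      apply: near_eq_cvg; near=> w; rewrite /h ifF //; apply/negbTE.
      by rewrite -ltNge; near: w; exact: lt_nbhsr.
    exact: c2.
  - rewrite /continuous_at {2}/h lexx; apply/cvgrPdist_le => d d0.
    have [M M0 HM] := (eqO_exP _ _ _).1 fO.
    have s0 : 0 < s + 1 - y0 by lra.
    have M' : 0 < M * t `^ s + 1 by rewrite ltr_wpDl // mulr_ge0 ?powR_ge0 // ltW.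
    have /cvgrPdist_le/(_ _ (divr_gt0 d0 M')) H1 := powR_cvg0 s0.
    have H2 : \forall w \near 0^'+, `|f (t * w)| <= M * `|(t * w) `^ s|.
      have [r r0 Hr] := HM; exists (r / t); first by rewrite /= divr_gt0.
      move=> w /= wr w0; apply: Hr; rewrite /= ?mulr_gt0 //.
      by rewrite sub0r normrN normrM (gtr0_norm t0) mulrC -ltr_pdivlMr // -normrN -sub0r.
    have [r1 /= r10 H1'] := H1; have [r2 /= r20 H2'] := H2.
    exists (Num.min r1 r2); first by rewrite /= lt_min r10.
    move=> w /= wr; rewrite sub0r normrN /h; have [w0|w0] := leP w 0.
      by rewrite normr0 ltW.
    move: wr; rewrite lt_min => /andP[wr1 wr2].
    have := H1' w wr1 w0; have := H2' w wr2 w0.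
    rewrite /= sub0r normrN !(ger0_norm (powR_ge0 _ _)) powRM ?(ltW t0) ?(ltW w0) // => B1 B2.
    rewrite normrM (ger0_norm (powR_ge0 _ _)).
    apply: le_trans (ler_wpM2r (powR_ge0 _ _) B1) _.
    rewrite -!mulrA -powR_add // (_ : s + (1 - y0) = s + 1 - y0); last by ring.
    apply: (@le_trans _ _ ((M * t `^ s + 1) * w `^ (s + 1 - y0))).
      by rewrite mulrA ler_wpM2r ?powR_ge0 // lerDl.
    by rewrite mulrC -ler_pdivlMr.
have [Q HQ] := weierstrass01 ch e0; exists Q => w /andP[w0 w1].
have := HQ w; rewrite (ltW w0) w1 => /(_ isT).
rewrite /h (lt_geF w0) => H.
have -> : f (t * w) = (f (t * w) * w `^ (1 - y0)) * w `^ (y0 - 1).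
  rewrite -mulrA -powR_add // (_ : 1 - y0 + (y0 - 1) = 0); last by ring.
  by rewrite powRr0 mulr1.
rewrite [_ * Q.[w]]mulrC -mulrBl normrM (ger0_norm (powR_ge0 _ _)).
by rewrite ler_wpM2r ?powR_ge0.
Unshelve. all: by end_near. Qed.

End MomentKernels.

(** * Moments of the hypergeometric kernels *)

Section HypergeometricKernels.
Context {R : realType}.
Local Notation mu := (@lebesgue_measure R).
Local Notation I01 := (`]0, 1[%classic : set R).
Local Notation Ga := (@euler_integral R).
Implicit Types (a b c p q x y s t u w : R).

Let mI : measurable I01. Proof. exact: measurable_itv. Qed.

Lemma Gamma_pos x : 0 < x -> Gamma x = Ga x.
Proof. by rewrite /Gamma => ->. Qed.

(** Integration of [(1 - u) ^+ n] replaces the lower parameter [a] by [a + y]. *)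
Lemma hcoef_Beta p q a y (n : nat) : 0 < a -> 0 < y ->
  hcoef p q a n * Beta (a + n%:R) y = Beta a y * hcoef p q (a + y) n.
Proof.
move=> a0 y0; rewrite Beta_natD // /hcoef.
have h1 : rising a n != 0 by rewrite gt_eqF // rising_gt0.
have h2 : rising (a + y) n != 0 by rewrite gt_eqF // rising_gt0 // addr_gt0.
have h3 : n`!%:R != 0 :> R by rewrite pnatr_eq0 -lt0n fact_gt0.
move: h1 h2 h3; move: (rising a n) (rising (a + y) n) (n`!%:R : R) (Beta a y) => *.
by field; apply/and3P.
Qed.

(** The kernel of the Saigo integral in the variable [u = s / t], without the factor
    [1 / Gamma a]. *)
Definition hyp_kernel a b c : R -> R := series_kernel a (hcoef (a + b) (- c) a).

Definition hyp_moment a b c y : R :=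
  Ga y * Ga (y - b + c) / (Ga (y - b) * Ga (a + y + c)).

Lemma hyp_kernelE a b c u :
  hyp_kernel a b c u = (1 - u) `^ (a - 1) * hyp2F1 (a + b) (- c) a (1 - u).
Proof.
rewrite /hyp_kernel /series_kernel /hyp2F1.
rewrite (_ : (fun n => _) = (fun k => rising (a + b) k * rising (- c) k / rising a k * ((1 - u) ^+ k / k`!%:R))) //.
apply/funext => n; rewrite /hcoef.
by rewrite -!mulrA; congr (_ * (_ * (_ * _))); rewrite mulrC.
Qed.

(** The hypergeometric series at 1 with lower parameter [a + y] converges absolutely when
    [(a + y) - (a + b) + c] is positive. *)
Lemma cvg_hyp_series a b c y : 0 < a -> 0 < y -> 0 < y - b + c ->
  cvgn (series (fun n => `|hcoef (a + b) (- c) a n| * Beta (a + n%:R) y)).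
Proof.
move=> a0 y0 h.
have := @cvg_norm_hcoef _ (a + b) (- c) (a + y) (addr_gt0 a0 y0).
rewrite (_ : a + y - (a + b) - - c = y - b + c) => [/(_ h) cc|]; last by ring.
apply: cvg_series_eq (is_cvg_seriesZ (k := Beta a y) cc) => n /=.
have E := hcoef_Beta (a + b) (- c) n a0 y0.
rewrite -[Beta (a + _) _]gtr0_norm; last by rewrite Beta_gt0 // ltr_wpDr.
rewrite -normrM E normrM gtr0_norm //; exact: Beta_gt0.
Qed.

Lemma hyp_kernel_integrable a b c y : 0 < a -> 0 < y -> 0 < y - b + c ->
  measurable_fun I01 (hyp_kernel a b c) /\
  mu.-integrable I01 (EFin \o (fun u => hyp_kernel a b c u * u `^ (y - 1))).
Proof.
by move=> a0 y0 h; have [] := series_kernel_moment a0 y0 (cvg_hyp_series a0 y0 h).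
Qed.

Lemma hyp_kernel_series a b c y : 0 < a -> 0 < y ->
  0 < y - b + c -> 0 < y - b -> 0 < a + y + c ->
  series (fun n => hcoef (a + b) (- c) a n * Beta (a + n%:R) y) n @[n --> \oo] -->
    Ga a * hyp_moment a b c y.
Proof.
move=> a0 y0 h1 h2 h3; have ay := addr_gt0 a0 y0.
have h1' : 0 < a + y - (a + b) - - c by rewrite (_ : _ - _ = y - b + c) //; ring.
have := @gauss_summation _ (a + b) (- c) (a + y) ay.
rewrite (_ : a + y - (a + b) = y - b); last by ring.
rewrite opprK => /(_ h2 h3 h1) G.
have -> : Ga a * hyp_moment a b c y = Beta a y * gauss_sum (a + b) (- c) (a + y).
  rewrite G (Beta_euler_integral a0 y0) /hyp_moment.
  have := euler_integral_gt0 ay; have := euler_integral_gt0 h2; have := euler_integral_gt0 h3.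
  move: (Ga (a + y)) (Ga (y - b)) (Ga (a + y + c)) (Ga a) (Ga y) (Ga (y - b + c)) => *.
  by field; rewrite !gt_eqF.
have -> : (fun n => hcoef (a + b) (- c) a n * Beta (a + n%:R) y) =
   (fun n => Beta a y *: (hcoef (a + b) (- c) (a + y) n : R^o)).
  by apply/funext => n; exact: hcoef_Beta.
have cc := cvg_hcoef ay h1'.
have := is_cvg_seriesZ (k := Beta a y) cc; rewrite /gauss_sum.
move=> h; have E := lim_seriesZ (Beta a y) cc; rewrite -[X in _ --> X]E; exact: h.
Qed.

Lemma cvg_series_shift (v : nat -> R) : cvgn (series v) ->
  cvgn (series (fun n => v n.+1)).
Proof.
move=> cv; apply/cvg_ex; exists (limn (series v) - v 0%N).
have L : series v n.+1 @[n --> \oo] --> limn (series v) by rewrite cvg_shiftS.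
have L2 : series v n.+1 - v 0%N @[n --> \oo] --> limn (series v) - v 0%N.
  by apply: cvgB => //; exact: cvg_cst.
apply: cvg_near_eq L2; near=> n.
by rewrite /= !seriesEnat /= big_nat_recl // addrAC subrr add0r.
Unshelve. all: by end_near. Qed.

Lemma hyp_kernel_moment a b c y0 : 0 < a -> 0 < y0 -> 0 < y0 - b + c ->
  0 < y0 - b -> 0 < a + y0 + c ->
  moment_kernel 0 (fun u => (Ga a)^-1 * hyp_kernel a b c u) y0 (hyp_moment a b c).
Proof.
move=> a0 y00 h1 h2 h3; split.
  by apply: measurable_funM => //; exact: (hyp_kernel_integrable a0 y00 h1).1.
move=> y yy0; have [k1 k2 k3 k4] : [/\ 0 < y, 0 < y - b + c, 0 < y - b & 0 < a + y + c].
  by split; lra.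
have [_ ki kl] := series_kernel_moment a0 k1 (cvg_hyp_series a0 k1 k2).
have E u : I01 u -> (Ga a)^-1 * hyp_kernel a b c u * u `^ (y - 1) =
  (Ga a)^-1 * (hyp_kernel a b c u * u `^ (y - 1)) by rewrite -mulrA.
split; first by apply: (eq_integrable_on mI _ (integrable_scale mI (Ga a)^-1 ki)) => u Iu; exact: (esym (E u Iu)).
rewrite add0r (eq_Rintegral_on E) RintegralZl //.
have <- : Ga a * hyp_moment a b c y = \int[mu]_(u in I01) (hyp_kernel a b c u * u `^ (y - 1)).
  apply: cvg_unique kl => //; exact: hyp_kernel_series.
by rewrite mulKf // gt_eqF // euler_integral_gt0.
Qed.

(** The kernel of the derivative of [t |-> t `^ (s + 1) * \int k (v) f (t * v) dv], up to the
    power of [t], where [k] is the hypergeometric kernel with first parameter 1: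
    integrating [k v * (t * v * f^`() (t * v))] by parts moves the derivative to [k], and
    the value [k 1 = 1] becomes the point mass. On moments this is the factor [y + s]. *)
Lemma hyp_kernel_derived b c s y0 : 0 < y0 -> 0 < y0 - b + c -> 0 < y0 - b ->
  0 < 1 + y0 + c ->
  moment_kernel 1 (fun u => s * hyp_kernel 1 b c u +
     u * series_kernel 1 (fun n => n.+1%:R * hcoef (1 + b) (- c) 1 n.+1) u) y0
   (fun y => (y + s) * hyp_moment 1 b c y).
Proof.
move=> y00 h1 h2 h3; pose C := hcoef (1 + b) (- c) 1.
have main y : y0 <= y ->
  [/\ measurable_fun I01 (series_kernel 1 (fun n => n.+1%:R * C n.+1)),
   mu.-integrable I01 (EFin \o (fun u =>
     u * series_kernel 1 (fun n => n.+1%:R * C n.+1) u * u `^ (y - 1))) &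
   \int[mu]_(u in I01) (u * series_kernel 1 (fun n => n.+1%:R * C n.+1) u * u `^ (y - 1)) =
   y * hyp_moment 1 b c y - 1].
  move=> yy0.
  have [k1 k2 k3 k4] : [/\ 0 < y, 0 < y - b + c, 0 < y - b & 0 < 1 + y + c].
    by split; lra.
  have y1 : 0 < y + 1 by lra.
  have BE (n : nat) : n.+1%:R * Beta (1 + n%:R) (y + 1) = y * Beta (1 + n.+1%:R) y.
    have n0 : 0 < n.+1%:R :> R by rewrite ltr0n.
    have := Beta_balance n0 k1; rewrite -!nat1r addrC [1 + (1 + _)]addrC => ->.
    by [].
  have c1 : cvgn (series (fun n => `|n.+1%:R * C n.+1| * Beta (1 + n%:R) (y + 1))).
    have cc := cvg_hyp_series ltr01 k1 k2.
    have cs : cvgn (series (fun n => `|C n.+1| * Beta (1 + n.+1%:R) y)).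
      exact: (cvg_series_shift cc).
    apply: cvg_series_eq (is_cvg_seriesZ (k := y) cs) => n.
    by rewrite normrM ger0_norm // -mulrA mulrCA BE mulrCA.
  have [s1 s2 s3] := series_kernel_moment ltr01 y1 c1.
  have E u : I01 u -> series_kernel 1 (fun n => n.+1%:R * C n.+1) u * u `^ (y + 1 - 1) =
     u * series_kernel 1 (fun n => n.+1%:R * C n.+1) u * u `^ (y - 1).
    move=> /in01[u0 u1]; rewrite (_ : y + 1 - 1 = 1 + (y - 1)); last by ring.
    by rewrite (powR_add 1 (y - 1) u0) powRr1 ?(ltW u0) //; ring.
  split => //; first exact: (eq_integrable_on mI E s2).
  rewrite -(eq_Rintegral_on E); apply: esym; apply: cvg_unique s3 => //.
  have L := hyp_kernel_series ltr01 k1 k2 k3 k4.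
  rewrite euler_integral1 mul1r in L.
  have L1 : series (fun n => C n * Beta (1 + n%:R) y) n.+1 @[n --> \oo] --> hyp_moment 1 b c y.
    by rewrite cvg_shiftS.
  have L2 : y * series (fun n => C n * Beta (1 + n%:R) y) n.+1 - 1 @[n --> \oo] -->
     y * hyp_moment 1 b c y - 1.
    by apply: cvgB; [apply: cvgM; [exact: cvg_cst | exact: L1] | exact: cvg_cst].
  apply: cvg_near_eq L2; near=> n.
  rewrite /= !seriesEnat /= big_nat_recl // mulrDr /C hcoef0 addr0 mul1r Beta1 //.
  rewrite divff ?gt_eqF // addrAC subrr add0r mulr_sumr; apply: eq_bigr => i _.
  by rewrite mulrCA -BE; ring.
split.
  have [s1 _ _] := main y0 (lexx _).
  apply: measurable_funD; apply: measurable_funM => //.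
  exact: (hyp_kernel_integrable ltr01 y00 h1).1.
move=> y yy0; have [s1 s2 s3] := main y yy0.
have [k1 k2 k3 k4] : [/\ 0 < y, 0 < y - b + c, 0 < y - b & 0 < 1 + y + c].
  by split; lra.
have [_ /(_ y (lexx _))[ki ke]] := hyp_kernel_moment ltr01 k1 k2 k3 k4.
have E u : I01 u -> s * ((Ga 1)^-1 * hyp_kernel 1 b c u * u `^ (y - 1)) +
   u * series_kernel 1 (fun n => n.+1%:R * C n.+1) u * u `^ (y - 1) =
   (s * hyp_kernel 1 b c u +
     u * series_kernel 1 (fun n => n.+1%:R * C n.+1) u) * u `^ (y - 1).
  by move=> _; rewrite euler_integral1 invr1; ring.
have si := integrable_scale mI s ki.
split; first exact: (eq_integrable_on mI E (integrable_add mI si s2)).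
rewrite -(eq_Rintegral_on E) RintegralD // RintegralZl // s3.
by rewrite add0r in ke; rewrite ke; ring.
Unshelve. all: by end_near. Qed.

End HypergeometricKernels.

(** * The Saigo integral and the Caputo-type derivative as Mellin operators *)

Section SaigoKernels.
Context {R : realType}.
Local Notation mu := (@lebesgue_measure R).
Local Notation I01 := (`]0, 1[%classic : set R).
Local Notation Ga := (@euler_integral R).
Implicit Types (a b c p q x y s t u w alpha beta gamma : R).

Let mI : measurable I01. Proof. exact: measurable_itv. Qed.

Lemma integrable_dilation t (f : R -> R) : 0 < t -> mu.-integrable I01 (EFin \o f) ->
  mu.-integrable `]0, t[ (EFin \o (fun s => f (s / t))).
Proof.
move=> t0 fi; apply/integrableP; split.
  apply/measurable_EFinP.
  apply: (@measurable_comp _ _ _ _ _ _ I01 f _ (dilation t)) => //.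
  - move=> _ [s /= + <-]; rewrite /dilation !in_itv /= => /andP[s0 st].
    by rewrite divr_gt0 // ltr_pdivrMr ?mul1r.
  - exact: integrable_measurable fi.
  - exact: measurable_funS (measurable_dilation t).
have mn : measurable_fun I01 (fun u => `|(EFin \o f) u|%E).
  by apply: measurableT_comp => //; case/integrableP: fi.
rewrite (ge0_integral_dilation t0 mn) //.
by case/integrableP: fi => _ fi; rewrite lte_mul_pinfty // lee_fin ltW.
Qed.

Lemma mellin_op1E c k (psi : R -> R) :
  mellin_op c k psi 1 = c * psi 1 + \int[mu]_(v in I01) (k v * psi v).
Proof.
by rewrite /mellin_op; congr (_ + _); apply: eq_Rintegral_on => v _; rewrite mul1r.
Qed.

Lemma mellin_op_dilation c k (f : R -> R) t w :
  mellin_op c k (fun v => f (t * v)) w = mellin_op c k (fun v => f (t * w * v)) 1.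
Proof.
rewrite /mellin_op mulr1; congr (_ + _).
by apply: eq_Rintegral_on => v _; rewrite mul1r mulrA.
Qed.

(** The substitution [s = t * u]. *)
Lemma saigo_integralE a b c (f : R -> R) t : 0 < a -> 0 < t ->
  mu.-integrable I01 (EFin \o (fun u => hyp_kernel a b c u * f (t * u))) ->
  saigo_integral a b c f t =
  t `^ (- b) * mellin_op 0 (fun u => (Ga a)^-1 * hyp_kernel a b c u) (fun v => f (t * v)) 1.
Proof.
move=> a0 t0 fi; rewrite /saigo_integral Gamma_pos // mellin_op1E mul0r add0r.
have tn : t != 0 by rewrite gt_eqF.
have -> : \int[mu]_(s in `]0, t[)
    ((t - s) `^ (a - 1) * hyp2F1 (a + b) (- c) a (1 - s / t) * f s) =
    \int[mu]_(s in `]0, t[)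
    (t `^ (a - 1) * (hyp_kernel a b c (s / t) * f (t * (s / t)))).
  apply: eq_Rintegral_on => s /=; rewrite in_itv /= => /andP[s0 st].
  rewrite hyp_kernelE [t * (s / t)]mulrCA divff // mulr1.
  have -> : t - s = t * (1 - s / t) by rewrite mulrBr mulr1 mulrCA divff // mulr1.
  rewrite powRM ?(ltW t0) //; first by rewrite -!mulrA.
  by rewrite ltW // subr_gt0 ltr_pdivrMr // mul1r.
rewrite (Rintegral_dilation (f := fun u => t `^ (a - 1) * (hyp_kernel a b c u * f (t * u)))) //;
  last exact: integrable_scale.
rewrite RintegralZl // -RintegralZl //.
have -> : \int[mu]_(v in I01) ((Ga a)^-1 * hyp_kernel a b c v * f (t * v)) =
   (Ga a)^-1 * \int[mu]_(u in I01) (hyp_kernel a b c u * f (t * u)).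
  by rewrite -RintegralZl //; apply: eq_Rintegral_on => v _; rewrite mulrA.
rewrite RintegralZl //.
have -> : t `^ (- b) = t `^ (- a - b) * (t `^ (a - 1) * t).
  rewrite -[X in _ * (_ * X)](powRr1 (ltW t0)) -!powR_add //; congr (_ `^ _); ring.
by ring.
Qed.

Definition caputo_moment alpha beta gamma y : R :=
  hyp_moment (1 - alpha) (- beta - 1) (alpha + gamma) y.

Lemma caputo_index1 alpha : 0 < alpha <= 1 -> caputo_index alpha = 1%N.
Proof.
move=> /andP[a0 a1]; rewrite /caputo_index (_ : Num.ceil alpha = 1) //.
by apply: ceil_def; rewrite subrr a0.
Qed.

(** For order less than 1 the derivative is a Saigo integral of [f^`()], of order
    [1 - alpha]. *)
Lemma caputo_saigo_kernel_lt1 alpha beta gamma eps y0 : 0 < alpha < 1 ->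
  0 < y0 -> 0 < y0 + beta + 1 + alpha + gamma -> 0 < y0 + beta + 1 -> 0 < y0 + 1 + gamma ->
  y0 - 1 < eps ->
  exists c k, moment_kernel c k y0 (caputo_moment alpha beta gamma) /\
   forall f : R -> R, (forall x, 0 < x -> {for x, continuous (derive1 f)}) ->
     derive1 f =O_ (0^'+) (fun x => x `^ eps) ->
     forall t, 0 < t -> caputo_saigo alpha beta gamma f t =
       t `^ (beta + 1) * mellin_op c k (fun v => derive1 f (t * v)) 1.
Proof.
move=> /andP[al0 al1] h1 h2 h3 h4 ye; have a0 : 0 < 1 - alpha by rewrite subr_gt0.
have [k1 k2 k3] : [/\ 0 < y0 - (- beta - 1) + (alpha + gamma), 0 < y0 - (- beta - 1) &
  0 < 1 - alpha + y0 + (alpha + gamma)] by split; lra.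
have K := hyp_kernel_moment a0 h1 k1 k2 k3.
exists 0, (fun u => (Ga (1 - alpha))^-1 * hyp_kernel (1 - alpha) (- beta - 1) (alpha + gamma) u).
split => //.
move=> f cf fO t t0; rewrite /caputo_saigo caputo_index1; last by rewrite al0 ltW.
rewrite /saigo gt_eqF // saigo_integralE //.
  by rewrite (_ : - (- beta - 1) = beta + 1) //; ring.
have ad := power_adherent_bigO t0 cf fO ye.
have u01 : 0 < (1 : R) <= 1 by rewrite ltr01 lexx.
have [Q HQ] := ad 1 ltr01.
have [ki _] := mellin_op_approx K ad u01 HQ.
apply: (eq_integrable_on mI _ (integrable_scale mI (Ga (1 - alpha)) ki)) => u _.
by rewrite mul1r -mulrA mulVKf // gt_eqF // euler_integral_gt0.
Qed.


Lemma power_adherent_scale y0 c k m (f : R -> R) t : moment_kernel c k y0 m -> 0 < t ->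
  power_adherent y0 (fun v => f (t * v)) ->
  power_adherent y0 (fun w => mellin_op c k (fun v => f (t * w * v)) 1).
Proof.
move=> mk t0 /(power_adherent_op mk) ad e /ad[Q HQ]; exists Q => w /HQ.
by rewrite mellin_op_dilation.
Qed.

(** The right-hand side of the equation for [h] is the integral of [s `^ b * g s] over
    [0 < s < t], rescaled to the unit interval. *)
Lemma is_derive_primitive b (g h : R -> R) y0 :
  (forall t, 0 < t -> power_adherent y0 (fun w => g (t * w))) -> 0 < y0 + b ->
  (forall t, 0 < t -> h t = t `^ (b + 1) * mellin_op 0 (fun=> 1) (fun w => w `^ b * g (t * w)) 1) ->
  forall t, 0 < t -> derive1 h t = t `^ b * g t.
Proof.
move=> ad yb hE.
have K := moment_kernel1 yb; have u01 : 0 < (1 : R) <= 1 by rewrite ltr01 lexx.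
have gi t : 0 < t -> mu.-integrable I01 (EFin \o (fun w => w `^ b * g (t * w))).
  move=> t0; have adb := power_adherent_mul b (ad t t0).
  have [Q HQ] := adb 1 ltr01; have [ki _] := mellin_op_approx K adb u01 HQ.
  by apply: (eq_integrable_on mI _ ki) => u _; rewrite !mul1r.
pose G s := s `^ b * g s.
have hE' t : 0 < t -> h t = \int[mu]_(s in `]0, t[) G s.
  move=> t0; rewrite hE // mellin_op1E mul0r add0r.
  rewrite (eq_Rintegral_on (g := fun w => w `^ b * g (t * w))); last by move=> w _; rewrite mul1r.
  have -> : \int[mu]_(s in `]0, t[) G s =
      \int[mu]_(s in `]0, t[) (t `^ b * ((s / t) `^ b * g (t * (s / t)))).
    apply: eq_Rintegral_on => s /=; rewrite in_itv /= => /andP[s0 st].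
    rewrite /G mulrA -powRM ?divr_ge0 ?(ltW t0) ?(ltW s0) //.
    by rewrite [t * (s / t)]mulrCA divff ?gt_eqF // mulr1.
  rewrite (Rintegral_dilation (f := fun w => t `^ b * (w `^ b * g (t * w)))) //;
    last by apply: integrable_scale => //; exact: gi.
  rewrite RintegralZl //; last exact: gi.
  rewrite (powR_add _ _ t0) powRr1 ?(ltW t0) // mulrA [t * _]mulrC; reflexivity.
have Gi T : 0 < T -> mu.-integrable `]0, T[ (EFin \o G).
  move=> T0; have := integrable_dilation T0 (integrable_scale mI (T `^ b) (gi T T0)).
  apply: (eq_integrable_on (measurable_itv _)) => s /=; rewrite in_itv /= => /andP[s0 sT].
  rewrite /G mulrA -powRM ?divr_ge0 ?(ltW T0) ?(ltW s0) //.
  by rewrite [T * (s / T)]mulrCA divff ?gt_eqF // mulr1.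
move=> t t0.
have cG : {for t, continuous G}.
  suff cg : {for t, continuous g} by apply: cvgM cg; exact: continuous_powR.
  (* Continuity at [t] is that of [w |-> g (2 * t * w)] at the interior point [1 / 2]. *)
  have t20 : 0 < 2 * t by rewrite mulr_gt0.
  have h12 : 0 < (2 : R)^-1 < 1 by rewrite invr_gt0 ltr0n invf_lt1 ?ltr0n // ltr1n.
  have c1 := power_adherent_continuous (ad _ t20) h12.
  have gE : g = (fun w => g (2 * t * w)) \o (fun s => s / (2 * t)).
    by apply/funext => s /=; rewrite mulrCA divff ?mulr1 // gt_eqF.
  rewrite gE; apply: (@continuous_comp _ _ _ (fun s => s / (2 * t)) (fun w => g (2 * t * w))).
    by apply: cvgM; [exact: cvg_id | exact: cvg_cst].
  by rewrite (_ : t / (2 * t) = 2^-1) // invfM mulrCA divff ?mulr1 // gt_eqF.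
have i2 : mu.-integrable `]0, (2 * t)] (EFin \o G).
  have t30 : 0 < 3 * t by rewrite mulr_gt0.
  apply: integrableS (Gi _ t30) => //.
  by move=> s /=; rewrite !in_itv /= => /andP[-> /= /le_lt_trans]; apply; rewrite ltr_pM2r // ltr_nat.
have t2 : t < 2 * t by rewrite ltr_pMl // ltr1n.
have b0 : (BRight 0 < BRight t)%O by rewrite bnd_simp.
have [_ D] := @continuous_FTC1 R G (BRight 0) t (2 * t) t2 i2 b0 cG.
rewrite -/(G t) -D !derive1E; apply: near_eq_derive; near=> s.
have s0 : 0 < s by near: s; exact: lt_nbhsr.
have st : s < 2 * t by near: s; exact: lt_nbhsl.
have H := @Rintegral_itv_bndo_bndc R (BRight 0) s G (Gi s s0).
by rewrite -H; exact: hE'.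
Unshelve. all: by end_near. Qed.

(** For order 1 the derivative is defined as the derivative of a Saigo integral. It is
    the primitive of [s `^ (beta + 1) * g s], where [g] comes from the kernel [kd]: the
    moments of [kd] are those of the Saigo kernel multiplied by [y + beta + 1], and the
    primitive divides by this factor. *)
Lemma caputo_saigo_kernel_1 beta gamma eps y0 :
  0 < y0 -> 0 < y0 + beta + 1 + 1 + gamma -> 0 < y0 + beta + 1 -> 0 < y0 + 1 + gamma ->
  y0 - 1 < eps ->
  exists c k, moment_kernel c k y0 (caputo_moment 1 beta gamma) /\
   forall f : R -> R, (forall x, 0 < x -> {for x, continuous (derive1 f)}) ->
     derive1 f =O_ (0^'+) (fun x => x `^ eps) ->
     forall t, 0 < t -> caputo_saigo 1 beta gamma f t =
       t `^ (beta + 1) * mellin_op c k (fun v => derive1 f (t * v)) 1.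
Proof.
move=> h1 h2 h3 h4 ye.
have [k1 k2 k3] : [/\ 0 < y0 - (- beta - 1 - 1) + gamma, 0 < y0 - (- beta - 1 - 1) &
  0 < 1 + y0 + gamma] by split; lra.
have K2 := hyp_kernel_moment ltr01 h1 k1 k2 k3.
have := hyp_kernel_derived (beta + 1) h1 k1 k2 k3.
set kd := (fun u => _); move=> Kd; exists 1, kd; split.
  have [md Hd] := Kd; split => // y yy; have [? ->] := Hd y yy; split => //.
  rewrite /caputo_moment /hyp_moment.
  have y1 : 0 < y + (beta + 1) by lra.
  rewrite (_ : y - (- beta - 1 - 1) = y + (beta + 1) + 1); last by ring.
  rewrite euler_integralS // (_ : y - (- beta - 1) = y + (beta + 1)); last by ring.
  rewrite (_ : y + (beta + 1) + 1 + gamma = y + (beta + 1) + (1 + gamma)); last by ring.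
  rewrite (_ : 1 - 1 + y + (1 + gamma) = 1 + y + gamma); last by ring.
  have z2 : 0 < 1 + y + gamma by lra.
  have := euler_integral_gt0 y1; have := euler_integral_gt0 z2.
  move: (Ga _) (Ga _) (Ga _) (Ga _) => g1 g2 g3 g4 p1 p2.
  by field; rewrite !gt_eqF.
move=> f cf fO t t0; rewrite /caputo_saigo caputo_index1 ?ltr01 ?lexx // /saigo subrr eqxx.
rewrite -[f^`(1)%classic]/(derive1 f); move: (derive1 f) cf fO => phi cf fO; clearbody kd.
have ad s : 0 < s -> power_adherent y0 (fun w => phi (s * w)).
  by move=> s0; exact: power_adherent_bigO s0 cf fO ye.
have u01 : 0 < (1 : R) <= 1 by rewrite ltr01 lexx.
have b1 : 0 < y0 + (beta + 1) by lra.
apply: (@is_derive_primitive (beta + 1) (fun s => mellin_op 1 kd (fun v => phi (s * v)) 1) _ y0) => //.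
  by move=> s s0; apply: power_adherent_scale Kd s0 (ad s s0).
move=> s s0; rewrite saigo_integralE //; last first.
  rewrite (_ : 1 + gamma - 1 = gamma); last by ring.
  have [Q HQ] := ad s s0 1 ltr01; have [ki _] := mellin_op_approx K2 (ad s s0) u01 HQ.
  by apply: (eq_integrable_on mI _ ki) => u _; rewrite euler_integral1 invr1 !mul1r.
rewrite (_ : 1 + gamma - 1 = gamma); last by ring.
rewrite (_ : - (- beta - 1%:R - 1) = beta + 1 + 1); last by ring.
congr (_ * _).
rewrite -(mellin_op_comp (moment_kernel1 b1) Kd K2 _ (ad s s0)).
  have E : (fun w => w `^ (beta + 1) * mellin_op 1 kd (fun v => phi (s * v)) w) =
      (fun w => w `^ (beta + 1) * mellin_op 1 kd (fun v => phi (s * w * v)) 1).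
    by apply/funext => w; rewrite mellin_op_dilation.
  by rewrite E.
move=> y yy; rewrite mulKf // gt_eqF //; lra.
Qed.

End SaigoKernels.

(** * Inversion of the Caputo-type derivative *)

Section CaputoSaigo.
Context {R : realType}.
Local Notation mu := (@lebesgue_measure R).
Local Notation I01 := (`]0, 1[%classic : set R).
Local Notation Ga := (@euler_integral R).
Implicit Types (a b c p q x y s t u w alpha beta gamma eps : R).

Let mI : measurable I01. Proof. exact: measurable_itv. Qed.

(** These are the conditions under which all values of Gamma occurring in the moments of
    the derivative and of the integral have positive argument, for [y >= y0]. *)
Definition admissible alpha beta gamma y0 : Prop :=
  [/\ 0 < y0, 0 < y0 + beta + 1 + alpha + gamma, 0 < y0 + beta + 1 & 0 < y0 + 1 + gamma].

(** The conditions are strict inequalities that hold at [y0 = eps + 1], hence also slightly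
    below it; a value below is needed, because a function of order exactly [eps] need not
    be approximable with the weight [w `^ eps]. *)
Lemma admissible_exists alpha beta gamma eps :
  Num.max 0 (- beta - 1 - (alpha + gamma)) - 1 < eps ->
  Num.max 0 (beta - gamma) - 1 < eps + 1 + beta ->
  exists y0, admissible alpha beta gamma y0 /\ y0 - 1 < eps.
Proof.
rewrite !ltrBlDr !gt_max => /andP[h1 h2] /andP[h3 h4].
pose d := Num.min (Num.min (eps + 1) (eps + 1 + beta + 1 + alpha + gamma))
   (Num.min (eps + 1 + beta + 1) (eps + 1 + 1 + gamma)).
have d0 : 0 < d by rewrite !lt_min -!andbA; apply/and4P; split; lra.
have : d <= d by []; rewrite {2}/d !le_min -!andbA => /and4P[d1 d2 d3 d4].
by exists (eps + 1 - d / 2); split; [split|]; lra.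
Qed.

Lemma caputo_saigo_kernel alpha beta gamma eps y0 : 0 < alpha <= 1 ->
  admissible alpha beta gamma y0 -> y0 - 1 < eps ->
  exists c k, moment_kernel c k y0 (caputo_moment alpha beta gamma) /\
   forall f : R -> R, (forall x, 0 < x -> {for x, continuous (derive1 f)}) ->
     derive1 f =O_ (0^'+) (fun x => x `^ eps) ->
     forall t, 0 < t -> caputo_saigo alpha beta gamma f t =
       t `^ (beta + 1) * mellin_op c k (fun v => derive1 f (t * v)) 1.
Proof.
move=> /andP[a0]; rewrite le_eqVlt => /orP[/eqP-> | a1] [h1 h2 h3 h4] ye.
  exact: caputo_saigo_kernel_1 ye.
by apply: caputo_saigo_kernel_lt1 ye; rewrite // a0.
Qed.

(** The fundamental theorem of calculus for [w |-> f (t * w)]. *)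
Lemma increment_integral (f : R -> R) (l : R) t y0 : 0 < t -> 0 < y0 ->
  (forall x, 0 < x -> derivable f x 1) ->
  (forall x, 0 < x -> {for x, continuous (derive1 f)}) ->
  f x @[x --> 0^'+] --> l -> power_adherent y0 (fun w => derive1 f (t * w)) ->
  t * mellin_op 0 (fun=> 1) (fun w => derive1 f (t * w)) 1 = f t - l.
Proof.
move=> t0 y00 df cf fl ad; rewrite mellin_op1E mul0r add0r.
have u01 : 0 < (1 : R) <= 1 by rewrite ltr01 lexx.
have [Q HQ] := ad 1 ltr01; have [ki _] := mellin_op_approx (moment_kernel1 y00) ad u01 HQ.
have ki' : mu.-integrable I01 (EFin \o (fun w => t * derive1 f (t * w))).
  apply: integrable_scale => //; apply: (eq_integrable_on mI _ ki) => w _; by rewrite !mul1r.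
rewrite -RintegralZl //; last by apply: (eq_integrable_on mI _ ki) => w _; rewrite !mul1r.
rewrite (eq_Rintegral_on (g := fun w => t * derive1 f (t * w))); last by move=> w _; rewrite mul1r.
apply: (exhausts_FTC (F := fun w => f (t * w)) exhausts_01 (@open_itv01 R) ki').
  move=> w /in01[w0 w1]; have tw : 0 < t * w by rewrite mulr_gt0.
  split.
    apply: cvgM; first exact: cvg_cst.
    apply: (@continuous_comp _ _ _ (fun v : R => t * v) (derive1 f)); last exact: cf.
    by apply: cvgM; [exact: cvg_cst | exact: cvg_id].
  have dtw : is_derive (t * w) 1 f (derive1 f (t * w)).
    by rewrite derive1E; apply: DeriveDef => //; exact: df.
  have dlin : is_derive w 1 (fun v : R => t * v) t.
    by apply: is_derive_eq; rewrite /GRing.scale /= mulr1.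
  have := @is_derive1_comp R f (fun v => t * v) w (derive1 f (t * w)) t dtw dlin.
  by rewrite mulrC.
have in0 (n : nat) : 0 < n.+3%:R^-1 :> R by rewrite invr_gt0 ltr0n.
have cv : n.+3%:R^-1 @[n --> \oo] --> (0 : R) by have := @cvg_invn R; rewrite -cvg_shiftS.
apply: cvgB.
  have ct : {for t, continuous f}.
    by apply: differentiable_continuous; apply/derivable1_diffP; exact: df.
  have lt : t * (1 - n.+3%:R^-1) @[n --> \oo] --> t.
    rewrite -[X in _ --> X](_ : t * (1 - 0) = t); last by rewrite subr0 mulr1.
    by apply: cvgM; [exact: cvg_cst | apply: cvgB => //; exact: cvg_cst].
  exact: (cvg_comp _ _ lt ct).
have /cvg_at_rightP/(_ (fun n => t * n.+3%:R^-1)) := fl; apply; split.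
  by move=> n; rewrite mulr_gt0.
by rewrite -[X in _ --> X](mulr0 t); apply: cvgM; [exact: cvg_cst | ].
Qed.

(** The Saigo integral, rescaled to the unit interval. *)
Definition saigo_kernel alpha beta gamma u : R := (Ga alpha)^-1 * hyp_kernel alpha beta gamma u.

Definition saigo_op alpha beta gamma (g : R -> R) t : R :=
  t `^ (- beta) * mellin_op 0 (saigo_kernel alpha beta gamma) (fun u => g (t * u)) 1.

Lemma mellin_op_scale c k (psi : R -> R) a :
  mu.-integrable I01 (EFin \o (fun v => k v * psi v)) ->
  mellin_op c k (fun v => a * psi v) 1 = a * mellin_op c k psi 1.
Proof.
move=> i; rewrite !mellin_op1E mulrDr mulrCA -RintegralZl //; congr (_ + _).
by apply: eq_Rintegral_on => v _; rewrite mulrCA.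
Qed.

Lemma mellin_op_ext c k (psi1 psi2 : R -> R) : psi1 1 = psi2 1 ->
  (forall u, I01 u -> psi1 u = psi2 u) -> mellin_op c k psi1 1 = mellin_op c k psi2 1.
Proof.
move=> e1 e; rewrite !mellin_op1E e1; congr (_ + _).
by apply: eq_Rintegral_on => u Iu; rewrite e.
Qed.

(** The Saigo integral is a left inverse of the derivative, up to the initial value. On
    moments, the product of those of the integral at [y + beta + 1] and of the derivative
    at [y] is [1 / y], the moment of [\int f^`() (t * w) dw = (f t - l) / t]. *)
Lemma saigo_inversion alpha beta gamma eps y0 (f : R -> R) (l : R) t :
  0 < alpha <= 1 -> admissible alpha beta gamma y0 -> y0 - 1 < eps ->
  (forall x, 0 < x -> derivable f x 1) ->
  (forall x, 0 < x -> {for x, continuous (derive1 f)}) ->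
  derive1 f =O_ (0^'+) (fun x => x `^ eps) -> f x @[x --> 0^'+] --> l -> 0 < t ->
  saigo_op alpha beta gamma (caputo_saigo alpha beta gamma f) t = f t - l.
Proof.
move=> al adm ye df cf fO fl t0; have [h1 h2 h3 h4] := adm.
have al0 : 0 < alpha by case/andP: al.
have [c [k [Kc Ec]]] := caputo_saigo_kernel al adm ye.
have ad := power_adherent_bigO t0 cf fO ye.
have K1 : moment_kernel 0 (saigo_kernel alpha beta gamma) (y0 + (beta + 1))
    (hyp_moment alpha beta gamma) by apply: hyp_kernel_moment => //; lra.
rewrite /saigo_op -(increment_integral t0 h1 df cf fl ad).
have E u : 0 < u -> caputo_saigo alpha beta gamma f (t * u) =
    t `^ (beta + 1) * (u `^ (beta + 1) * mellin_op c k (fun v => derive1 f (t * v)) u).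
  move=> u0; rewrite Ec ?mulr_gt0 // powRM ?(ltW t0) ?(ltW u0) //.
  by rewrite (mellin_op_dilation c k (derive1 f) t u) mulrA.
rewrite (@mellin_op_ext _ _ _ (fun u => t `^ (beta + 1) *
   (u `^ (beta + 1) * mellin_op c k (fun v => derive1 f (t * v)) u))); first last.
- by move=> u /in01[u0 _]; exact: E.
- exact: E.
rewrite -(mellin_op_comp K1 Kc (moment_kernel1 h1) _ ad).
  have u01 : 0 < (1 : R) <= 1 by rewrite ltr01 lexx.
  have ad2 := power_adherent_mul (beta + 1) (power_adherent_op Kc ad).
  have [Q HQ] := ad2 1 ltr01; have [ki _] := mellin_op_approx K1 ad2 u01 HQ.
  rewrite mellin_op_scale; last by apply: (eq_integrable_on mI _ ki) => w _; rewrite mul1r.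
  rewrite mulrA -powR_add // (_ : - beta + (beta + 1) = 1); last by ring.
  by rewrite powRr1 // ltW.
move=> y yy; rewrite /caputo_moment /hyp_moment.
have y1 : 0 < y by lra.
rewrite (_ : y + (beta + 1) - beta = y + 1); last by ring.
rewrite euler_integralS // (_ : y - (- beta - 1) = y + (beta + 1)); last by ring.
rewrite (_ : y + (beta + 1) + (alpha + gamma) = alpha + (y + (beta + 1)) + gamma); last by ring.
rewrite (_ : 1 - alpha + y + (alpha + gamma) = y + 1 + gamma); last by ring.
have z1 : 0 < y + (beta + 1) by lra.
have z2 : 0 < alpha + (y + (beta + 1)) + gamma by lra.
have z3 : 0 < y + 1 + gamma by lra.
have := euler_integral_gt0 y1; have := euler_integral_gt0 z1.
have := euler_integral_gt0 z2; have := euler_integral_gt0 z3.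
move: (Ga _) (Ga _) (Ga _) (Ga _) => g1 g2 g3 g4 p1 p2 p3 p4.
by field; rewrite !gt_eqF.
Qed.

(** The derivative of order [alpha] of [f] is of the size of [t `^ (beta + 1) * f^`() t]. *)
Lemma caputo_saigo_bound alpha beta gamma eps y0 (f : R -> R) :
  0 < alpha <= 1 -> admissible alpha beta gamma y0 -> y0 - 1 < eps ->
  (forall x, 0 < x -> {for x, continuous (derive1 f)}) ->
  derive1 f =O_ (0^'+) (fun x => x `^ eps) ->
  exists C, \forall t \near 0^'+, `|caputo_saigo alpha beta gamma f t| <= C * t `^ (eps + 1 + beta).
Proof.
move=> al adm ye cf fO; have [c [k [Kc Ec]]] := caputo_saigo_kernel al adm ye.
have [M M0 HM] := (eqO_exP _ _ _).1 fO; have [r /= r0 Hr] := HM.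
exists (M * moment_norm c k y0); exists r => // t /= tr t0.
have b v : 0 < v <= 1 -> `|derive1 f (t * v)| <= M * t `^ eps * v `^ (y0 - 1).
  move=> /andP[v0 v1]; have tv : 0 < t * v by rewrite mulr_gt0.
  have := Hr (t * v); rewrite /ball_ /= sub0r normrN gtr0_norm // => /(_ _ tv) H.
  apply: le_trans (H _) _.
    apply: le_lt_trans tr; rewrite sub0r normrN gtr0_norm //.
    by rewrite ler_piMr // ltW.
  rewrite ger0_norm ?powR_ge0 // powRM ?(ltW t0) ?(ltW v0) // mulrA.
  rewrite ler_wpM2l ?mulr_ge0 ?powR_ge0 ?(ltW M0) //.
  rewrite (_ : eps = eps - (y0 - 1) + (y0 - 1)); last by ring.
  rewrite (powR_add _ _ v0) ler_piMl ?powR_ge0 // powR_le1 ?(ltW v0) // subr_ge0; exact: ltW.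
have u01 : 0 < (1 : R) <= 1 by rewrite ltr01 lexx.
have ad := power_adherent_bigO t0 cf fO ye.
have [|||_ B] := @mellin_op_bound _ c k y0 _ (fun v => derive1 f (t * v)) 1 (M * t `^ eps) Kc ltr01.
- exact: power_adherent_measurable ad u01.
- exact: b.
- by move=> v /in01[v0 v1]; rewrite mul1r; apply: b; rewrite v0 ltW.
rewrite Ec // normrM ger0_norm ?powR_ge0 //.
apply: le_trans (ler_wpM2l (powR_ge0 _ _) B) _.
rewrite one_powR mulr1 (_ : eps + 1 + beta = beta + 1 + eps); last by ring.
rewrite (powR_add (beta + 1) eps t0) le_eqVlt; apply/orP; left; apply/eqP; ring.
Qed.

End CaputoSaigo.

(** * Iteration of the integral equations *)

Section Iteration.
Context {R : realType}.
Local Notation mu := (@lebesgue_measure R).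
Local Notation I01 := (`]0, 1[%classic : set R).
Local Notation Ga := (@euler_integral R).
Implicit Types (g : R -> R) (t s : R) (j n m r : nat).

(** The terms eventually decrease at least by a factor [1 / 2]. *)
Lemma cvg0_ratio (x r : nat -> R) : (forall n, x n.+1 = x n * r n) ->
  r n @[n --> \oo] --> (0 : R) -> x n @[n --> \oo] --> (0 : R).
Proof.
move=> xr r0.
have /cvgrPdist_le/(_ 2^-1) := r0; rewrite invr_gt0 ltr0n => /(_ isT)[N _ HN].
rewrite -(cvg_shiftn N).
have xb n : `|x (n + N)%N| <= `|x N| * 2^-1 ^+ n.
  elim: n => [|n IH]; first by rewrite expr0 mulr1.
  rewrite addSn xr normrM exprSr mulrA; apply: ler_pM => //.
  by have := HN (n + N)%N (leq_addl _ _); rewrite /= sub0r normrN.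
apply/norm_cvg0P.
have c : `|x N| * 2^-1 ^+ n @[n --> \oo] --> `|x N| * 0.
  apply: cvgM; [exact: cvg_cst | apply: cvg_expr].
  by rewrite ger0_norm ?invr_ge0 ?ler0n // invf_lt1 ?ltr0n // ltr1n.
rewrite mulr0 in c; apply: (squeeze_cvgr _ (cvg_cst 0) c).
by near=> n; rewrite normr_ge0 xb.
Unshelve. all: by end_near. Qed.

Context (alpha beta gamma : R).
Context (alpha_gt0 : 0 < alpha) (beta_lt0 : beta < 0)
  (gamma_beta : 0 < 1 + gamma - beta) (alpha_gamma : 0 < 1 + alpha + gamma).

Let mI : measurable I01. Proof. exact: measurable_itv. Qed.
Let kern := saigo_kernel alpha beta gamma.
Let kern_moment : moment_kernel 0 kern 1 (hyp_moment alpha beta gamma).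
Proof.
have [h1 h2 h3] : [/\ 0 < 1 - beta + gamma, 0 < 1 - beta & 0 < alpha + 1 + gamma].
  by move: alpha_gt0 beta_lt0 gamma_beta alpha_gamma => *; split; lra.
exact: hyp_kernel_moment.
Qed.

(* The powers [t `^ (- (j * beta))] of the series correspond to the moments at [y_ j]. *)
Let y_ j : R := 1 - j%:R * beta.

Let y_ge1 j : 1 <= y_ j.
Proof. by rewrite /y_ lerBrDr gerDl mulr_ge0_le0 // ltW. Qed.

Let kern_moment_ j : moment_kernel 0 kern (y_ j) (hyp_moment alpha beta gamma).
Proof.
have [mk hk] := kern_moment; split => // y yy; apply: hk; exact: le_trans (y_ge1 j) yy.
Qed.

Lemma continuous_scale_measurable g t : 0 < t -> (forall s, 0 < s -> {for s, continuous g}) ->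
  measurable_fun I01 (fun u => g (t * u)).
Proof.
move=> t0 cg; apply: continuous_measurable_on; first exact: open_itv01.
move=> v /in01[v0 v1].
apply: (@continuous_comp _ _ _ (fun v : R => t * v) g).
  by apply: cvgM; [exact: cvg_cst | exact: cvg_id].
by apply: cg; rewrite mulr_gt0.
Qed.

Lemma saigo_op_bound g t j (B : R) : 0 < t -> (forall s, 0 < s -> {for s, continuous g}) ->
  (forall s, 0 < s -> `|g s| <= B * s `^ (- (j%:R * beta))) ->
  mu.-integrable I01 (EFin \o (fun u => kern u * g (t * u))) /\
  `|saigo_op alpha beta gamma g t| <=
    B * moment_norm 0 kern (y_ j) * t `^ (- (j.+1%:R * beta)).
Proof.
move=> t0 cg bg.
have yE : y_ j - 1 = - (j%:R * beta) by rewrite /y_; ring.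
have b v : 0 < v -> `|g (t * v)| <= B * t `^ (- (j%:R * beta)) * v `^ (y_ j - 1).
  move=> v0; rewrite yE -mulrA -powRM ?(ltW t0) ?(ltW v0) //.
  by apply: bg; rewrite mulr_gt0.
have [|||ki kb] := @mellin_op_bound _ 0 kern (y_ j) _ (fun u => g (t * u)) 1
    (B * t `^ (- (j%:R * beta))) (kern_moment_ j) ltr01.
- have := continuous_scale_measurable t0 cg; congr measurable_fun.
  by apply/funext => v; rewrite mul1r.
- exact: b.
- by move=> v /in01[v0 _]; rewrite mul1r; exact: b.
split; first by apply: (eq_integrable_on mI _ ki) => v _; rewrite mul1r.
rewrite /saigo_op normrM (ger0_norm (powR_ge0 _ _)).
apply: le_trans (ler_wpM2l (powR_ge0 _ _) kb) _.
rewrite one_powR mulr1 -natr1.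
rewrite (_ : - ((j%:R + 1) * beta) = - beta + - (j%:R * beta)); last by ring.
rewrite (powR_add (- beta) _ t0) le_eqVlt; apply/orP; left; apply/eqP; ring.
Qed.

(** The exponents [- (j * beta)] tend to infinity, so the powers tend to 0 on the open
    interval: dominated convergence. *)
Lemma moment_norm_cvg0 : moment_norm 0 kern (y_ j) @[j --> \oo] --> (0 : R).
Proof.
have [mk hk] := kern_moment; have [i1 _] := hk 1 (lexx _).
have E v : kern v * v `^ (1 - 1) = kern v by rewrite subrr powRr0 mulr1.
have yE j : y_ j - 1 = - beta * j%:R by rewrite /y_; ring.
have e0 : 0 < - beta by rewrite oppr_gt0.
have p01 (v : R) : I01 v -> 0 <= v `^ (- beta) < 1.
  move=> /in01[v0 v1]; rewrite powR_ge0 /= -(one_powR (- beta)).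
  by rewrite gt0_ltr_powR // ?nnegrE ?ltW.
have pE (v : R) j : v `^ (y_ j - 1) = (v `^ (- beta)) ^+ j.
  by rewrite yE powRrM powR_mulrn // powR_ge0.
have [|v Iv|j v Iv|_] := @Rdominated_cvg R I01 (fun j v => `|kern v * v `^ (y_ j - 1)|)
    (fun=> 0) (fun v => `|kern v * v `^ (1 - 1)|) mI _ (integrable_norm i1).
- move=> j; have [ij _] := hk _ (y_ge1 j).
  exact: integrable_measurable (integrable_norm ij).
- rewrite -[X in _ --> X](mulr0 `|kern v|).
  have /andP[q0 q1] := p01 v Iv.
  have : (v `^ (- beta)) ^+ j @[j --> \oo] --> (0 : R) by apply: cvg_expr; rewrite ger0_norm.
  move=> c; have c2 : `|kern v| * (v `^ (- beta)) ^+ j @[j --> \oo] --> `|kern v| * 0.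
    by apply: cvgM => //; exact: cvg_cst.
  apply: cvg_near_eq c2; near=> j.
  by rewrite pE (normrM (kern v) (v `^ (- beta) ^+ j)) (ger0_norm (exprn_ge0 _ q0)).
- rewrite normr_id E pE (normrM (kern v) (v `^ (- beta) ^+ j)).
  rewrite (ger0_norm (exprn_ge0 _ (powR_ge0 _ _))).
  have /andP[q0 q1] := p01 v Iv.
  by rewrite ler_piMr // exprn_ile1 // ltW.
rewrite /Rintegral integral0 /= => c.
apply: cvg_near_eq c; near=> j; by rewrite /moment_norm normr0 add0r.
Unshelve. all: by end_near. Qed.

Lemma saigo_op_powR j t : 0 < t ->
  saigo_op alpha beta gamma (fun s => s `^ (- (j%:R * beta))) t =
  hyp_moment alpha beta gamma (y_ j) * t `^ (- (j.+1%:R * beta)).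
Proof.
move=> t0; have [_ /(_ _ (lexx _))[ki ke]] := kern_moment_ j.
have yE : - (j%:R * beta) = y_ j - 1 by rewrite /y_; ring.
rewrite -ke add0r /saigo_op mellin_op1E mul0r add0r -/kern.
rewrite (eq_Rintegral_on (g := fun v => t `^ (y_ j - 1) * (kern v * v `^ (y_ j - 1)))); last first.
  by move=> v /in01[v0 v1]; rewrite yE powRM ?(ltW t0) ?(ltW v0) // mulrCA.
rewrite RintegralZl // mulrA -powR_add // mulrC; congr (_ * _ `^ _).
rewrite -yE -natr1; ring.
Qed.

Lemma saigo_op_sum n (a : nat -> R) (g_ : nat -> R -> R) t :
  (forall r, mu.-integrable I01 (EFin \o (fun u => kern u * g_ r (t * u)))) ->
  mu.-integrable I01 (EFin \o (fun u => kern u * \sum_(r < n) a r * g_ r (t * u))) /\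
  saigo_op alpha beta gamma (fun s => \sum_(r < n) a r * g_ r s) t =
  \sum_(r < n) a r * saigo_op alpha beta gamma (g_ r) t.
Proof.
move=> gi; elim: n => [|n [IHi IHe]].
  split.
    apply: (eq_integrable_on mI (f := fun=> 0)); last exact: integrable0.
    by move=> v _; rewrite big_ord0 mulr0.
  rewrite big_ord0 /saigo_op mellin_op1E mul0r add0r (eq_Rintegral_on (g := fun=> 0)).
    by rewrite /Rintegral integral0 mulr0.
  by move=> v _; rewrite big_ord0 mulr0.
have E v : kern v * (\sum_(r < n.+1) a r * g_ r (t * v)) =
   kern v * (\sum_(r < n) a r * g_ r (t * v)) + a n * (kern v * g_ n (t * v)).
  by rewrite big_ord_recr /= mulrDr; congr (_ + _); rewrite mulrCA.
have ri := integrable_scale mI (a n) (gi n).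
split; first by apply: (eq_integrable_on mI _ (integrable_add mI IHi ri)) => v _; exact: (esym (E v)).
rewrite [RHS]big_ord_recr /= -IHe /saigo_op !mellin_op1E !mul0r !add0r -/kern.
by rewrite (eq_Rintegral_on (fun v _ => E v)) RintegralD // RintegralZl //; ring.
Qed.

Context (F : nat -> R -> R) (a : nat -> R).
Context (F_continuous : forall n s, 0 < s -> {for s, continuous (F n)})
  (F_bound : forall n s, 0 < s -> `|F n s| <= 1)
  (F_eq : forall n t, 0 < t -> F n t - (n == 0)%:R =
     saigo_op alpha beta gamma (fun s => \sum_(r < n.+1) a r * F (n - r) s) t).

(** The coefficients of the successive approximations of the solution of the integral
    equations, which start from the initial values. *)
Fixpoint iterate_coef j n : R :=
  if j is j'.+1 then
    hyp_moment alpha beta gamma (y_ j') * \sum_(r < n.+1) a r * iterate_coef j' (n - r)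
  else (n == 0)%:R.

(** The remainder after [j] iterations. *)
Let err j n s := F n s - \sum_(i < j) iterate_coef i n * s `^ (- (i%:R * beta)).

Let err_continuous j n s : 0 < s -> {for s, continuous (err j n)}.
Proof.
move=> s0; apply: cvgB; first exact: F_continuous.
elim: j => [|j IH].
  have -> : (fun s : R => \sum_(i < 0) iterate_coef i n * s `^ (- (i%:R * beta))) = fun=> 0.
    by apply/funext => x; rewrite big_ord0.
  rewrite big_ord0; exact: cvg_cst.
rewrite big_ord_recr /=.
have -> : (fun s : R => \sum_(i < j.+1) iterate_coef i n * s `^ (- (i%:R * beta))) =
  (fun s : R => \sum_(i < j) iterate_coef i n * s `^ (- (i%:R * beta)) +
     iterate_coef j n * s `^ (- (j%:R * beta))).
  by apply/funext => x; rewrite big_ord_recr.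
by apply: cvgD => //; apply: cvgM; [exact: cvg_cst | exact: continuous_powR].
Qed.

Let F_integrable n t : 0 < t ->
  mu.-integrable I01 (EFin \o (fun u => kern u * F n (t * u))).
Proof.
move=> t0; have [|s s0|] := @saigo_op_bound (F n) t 0 1 t0 => //.
- by move=> s; exact: F_continuous.
- by rewrite mul0r oppr0 powRr0 mulr1; exact: F_bound.
Qed.

Let pow_integrable j t : 0 < t ->
  mu.-integrable I01 (EFin \o (fun u => kern u * (t * u) `^ (- (j%:R * beta)))).
Proof.
move=> t0; have [|s s0|] := @saigo_op_bound (fun s => s `^ (- (j%:R * beta))) t j 1 t0 => //.
- by move=> s; exact: continuous_powR.
- by rewrite mul1r ger0_norm // powR_ge0.
Qed.

Let saigo_op_err j n t : 0 < t ->
  mu.-integrable I01 (EFin \o (fun u => kern u * err j n (t * u))) /\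
  saigo_op alpha beta gamma (err j n) t = saigo_op alpha beta gamma (F n) t -
    \sum_(i < j) iterate_coef i n * (hyp_moment alpha beta gamma (y_ i) * t `^ (- (i.+1%:R * beta))).
Proof.
move=> t0.
have [si se] := @saigo_op_sum j (fun i => iterate_coef i n) (fun i s => s `^ (- (i%:R * beta))) t
   (fun i => pow_integrable i t0).
have E u : kern u * F n (t * u) - kern u * (\sum_(r < j) iterate_coef r n * (t * u) `^ (- (r%:R * beta))) =
   kern u * err j n (t * u) by rewrite /err mulrBr.
split; first exact: (eq_integrable_on mI (fun u _ => E u) (integrable_sub mI (F_integrable n t0) si)).
under eq_bigr do rewrite -saigo_op_powR //.
rewrite -se.
rewrite /saigo_op !mellin_op1E !mul0r !add0r -/kern -mulrBr; congr (_ * _).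
rewrite -RintegralB //; last exact: F_integrable.
by apply: eq_Rintegral_on => u _; rewrite E.
Qed.

(** The partial sums are the iterates, so the remainders satisfy the homogeneous equation. *)
Let errS j n t : 0 < t ->
  err j.+1 n t = \sum_(r < n.+1) a r * saigo_op alpha beta gamma (err j (n - r)) t.
Proof.
move=> t0.
under eq_bigr do rewrite (saigo_op_err _ _ t0).2 mulrBr.
rewrite sumrB.
have [_ <-] := @saigo_op_sum n.+1 a (fun r => F (n - r)) t (fun r => F_integrable (n - r) t0).
rewrite -F_eq // /err big_ord_recl /= mul0r oppr0 powRr0 mulr1 opprD addrA.
congr (_ - _).
under [RHS]eq_bigr do rewrite mulr_sumr.
rewrite exchange_big /=; apply: eq_bigr => i _.
rewrite /bump add1n mulrAC mulr_sumr.
by apply: eq_bigr => r _; ring.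
Qed.

Let abound N := \sum_(r < N.+1) `|a r|.
Let ebound N j := \prod_(i < j) (abound N * moment_norm 0 kern (y_ i)).

(** Each iteration costs the norm of the operator on functions of order
    [s `^ (- (j * beta))], which tends to 0; the initial remainder is a probability.
    The bound is uniform in [n <= N], because the equations couple these states. *)
Let err_bound N j n t : (n <= N)%N -> 0 < t ->
  `|err j n t| <= ebound N j * t `^ (- (j%:R * beta)).
Proof.
elim: j n t => [|j IH] n t nN t0.
  by rewrite /err /ebound !big_ord0 subr0 mul0r oppr0 powRr0 mulr1 F_bound.
rewrite errS // (_ : ebound N j.+1 * _ = abound N * (ebound N j * moment_norm 0 kern (y_ j) * t `^ (- (j.+1%:R * beta)))).
  apply: le_trans (ler_norm_sum _ _ _) _; rewrite mulr_suml.
  apply: (@le_trans _ _ (\sum_(r < n.+1) `|a r| * (ebound N j * moment_norm 0 kern (y_ j) * t `^ (- (j.+1%:R * beta))))).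
    apply: ler_sum => r _; rewrite normrM ler_wpM2l //.
    have [||_ H] := @saigo_op_bound (err j (n - r)) t j (ebound N j) t0 => //.
    - by move=> s; exact: err_continuous.
    - by move=> s s0; apply: IH => //; exact: leq_trans (leq_subr _ _) nN.
  rewrite -!mulr_suml ler_wpM2r //.
    by rewrite !mulr_ge0 ?powR_ge0 ?moment_norm_ge0 // prodr_ge0 // => i _; rewrite mulr_ge0 ?moment_norm_ge0 // sumr_ge0.
  rewrite /abound -!(big_mkord xpredT (fun r => `|a r|)) (big_cat_nat (n := n.+1) (p := N.+1)) //=.
  by rewrite lerDl sumr_ge0.
by rewrite /ebound big_ord_recr /=; ring.
Qed.

(** The norms in [err_bound] tend to 0, so their products, and the remainders, do. *)
Theorem iterate_series n t : 0 < t ->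
  series (fun j => iterate_coef j n * t `^ (- (j%:R * beta))) j @[j --> \oo] --> F n t.
Proof.
move=> t0.
have c0 : ebound n j * t `^ (- (j%:R * beta)) @[j --> \oo] --> (0 : R).
  apply: (@cvg0_ratio _ (fun j => abound n * t `^ (- beta) * moment_norm 0 kern (y_ j))).
    move=> j; rewrite /ebound big_ord_recr /= -natr1.
    rewrite (_ : - ((j%:R + 1) * beta) = - beta + - (j%:R * beta)); last by ring.
    by rewrite (powR_add (- beta) _ t0); ring.
  rewrite -[X in _ --> X](mulr0 (abound n * t `^ (- beta))).
  by apply: cvgM; [exact: cvg_cst | exact: moment_norm_cvg0].
have e0 : err j n t @[j --> \oo] --> (0 : R).
  apply/norm_cvg0P; apply: (squeeze_cvgr _ (cvg_cst 0) c0).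
  by near=> j; rewrite normr_ge0 err_bound.
have : F n t - err j n t @[j --> \oo] --> F n t - 0 by apply: cvgB => //; exact: cvg_cst.
rewrite subr0; apply: cvg_near_eq; near=> j.
by rewrite /err opprB addrCA subrr addr0 seriesEnat /= big_mkord.
Unshelve. all: by end_near. Qed.

End Iteration.

(** * Gamma on the real line, falling factorials and the coefficients *)

Section FallingFactorial.
Context {R : realType}.
Local Notation Ga := (@euler_integral R).
Implicit Types (x y a b : R) (n m k : nat).

Lemma fallingS x n : falling x n.+1 = falling x n * (x - n%:R).
Proof. by rewrite /falling big_ord_recr. Qed.

Lemma falling0 x : falling x 0 = 1.
Proof. by rewrite /falling big_ord0. Qed.

Lemma falling0n n : falling (0 : R) n = (n == 0)%:R.
Proof.
case: n => [|n]; first by rewrite falling0.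
by rewrite /falling big_ord_recl subrr mul0r.
Qed.

Lemma risingSl x n : rising x n.+1 = x * rising (x + 1) n.
Proof. by rewrite risingS rising_shift. Qed.

Lemma Gamma_neg x n : x <= 0 -> Num.floor x = - n%:Z ->
  Gamma x = Ga (x + n.+1%:R) / rising x n.+1.
Proof. by move=> x0 fx; rewrite /Gamma ltNge x0 /= fx abszN absz_nat. Qed.

(** Stated for the reciprocal, the functional equation holds at the poles too, where
    the reciprocal vanishes. *)
Lemma Gamma_inv x : (Gamma x)^-1 = x * (Gamma (x + 1))^-1.
Proof.
have [x0|x0] := ltP 0 x.
  by rewrite !Gamma_pos ?addr_gt0 // euler_integralS // invfM mulVKf // gt_eqF.
have [n fx] : exists n : nat, Num.floor x = - n%:Z.
  exists `|Num.floor x|%N; rewrite abszE ler0_norm ?opprK //.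
  by rewrite floor_le0 (le_lt_trans x0).
have := floor_itv x; rewrite fx => /andP[lx ux].
rewrite (Gamma_neg x0 fx) invf_div; case: n fx lx ux => [|n] fx lx ux.
  have -> : x = 0 by apply/eqP; rewrite eq_le x0 -[0]/(0%:~R) -oppr0.
  by rewrite risingSl !mul0r.
rewrite risingSl -mulrA; congr (_ * _).
have [x1|x1] := ltP 0 (x + 1); last first.
  have fx1 : Num.floor (x + 1) = - n%:Z.
    apply: floor_def; rewrite -[n.+1]addn1 PoszD opprD intrD in lx.
    rewrite -[n.+1]addn1 PoszD opprD -addrA addNr addr0 in ux.
    by rewrite intrD -lerBlDr ltrD2r ux andbT.
  by rewrite (Gamma_neg x1 fx1) invf_div -[n.+2%:R]nat1r addrA.
have n0 : n = 0%N.
  case: n fx lx ux => // n fx lx ux; exfalso.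
  rewrite -[n.+2]addn1 PoszD opprD -addrA addNr addr0 in ux.
  rewrite rmorphN /= in ux.
  have : 1 <= n.+1%:~R :> R by rewrite ler1n.
  move: ux; move: (n.+1%:~R : R) => z; lra.
have r1 : rising (x + 1) 1 = x + 1 by rewrite /rising big_ord1 addr0.
rewrite n0 (Gamma_pos x1) r1 -nat1r addrA (euler_integralS x1).
by rewrite invfM mulrA divff ?mul1r // gt_eqF.
Qed.

Lemma Gamma_quotient x n : 0 <= x -> Gamma (x + 1) / Gamma (x + 1 - n%:R) = falling x n.
Proof.
move=> x0; have x1 : 0 < x + 1 by lra.
elim: n => [|n IH].
  rewrite falling0 subr0 divff // Gamma_pos // gt_eqF //; exact: euler_integral_gt0.
rewrite fallingS -IH Gamma_inv -natr1.
rewrite (_ : x + 1 - (n%:R + 1) + 1 = x + 1 - n%:R); last by ring.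
rewrite (_ : x + 1 - (n%:R + 1) = x - n%:R); last by ring.
by rewrite mulrCA mulrC.
Qed.

(** The Chu-Vandermonde identity. Writing [n + 1 = r + (n + 1 - r)] in the [r]-th
    summand and applying [(r + 1) * A (r + 1) = (a - r) * A r] to each factor gives the
    recursion in [n] of the right-hand side. *)
Lemma falling_vandermonde a b n :
  \sum_(r < n.+1) (falling a r / r`!%:R) * (falling b (n - r) / (n - r)`!%:R) =
  falling (a + b) n / n`!%:R.
Proof.
pose A r := falling a r / r`!%:R; pose B r := falling b r / r`!%:R.
have rec (z : R) r : r.+1%:R * (falling z r.+1 / r.+1`!%:R) = (z - r%:R) * (falling z r / r`!%:R).
  have h : r`!%:R != 0 :> R by rewrite pnatr_eq0 -lt0n fact_gt0.
  have h1 : r.+1%:R != 0 :> R by rewrite pnatr_eq0.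
  rewrite fallingS factS natrM invfM.
  move: h h1; move: (r`!%:R : R) (r.+1%:R : R) => u v *; by field; apply/andP.
elim: n => [|n IH].
  by rewrite big_ord_recl big_ord0 !falling0 fact0 addr0 !divr1 mulr1.
have n0 : n.+1%:R != 0 :> R by rewrite pnatr_eq0.
apply: (mulfI n0); rewrite rec -IH mulr_sumr.
transitivity (\sum_(r < n.+2) (r%:R * A r * B (n.+1 - r)%N + A r * ((n.+1 - r)%:R * B (n.+1 - r)%N))).
  apply: eq_bigr => r _; rewrite -/(A _) -/(B _).
  have -> : n.+1%:R = r%:R + (n.+1 - r)%:R :> R by rewrite -natrD subnKC // -ltnS.
  by ring.
rewrite big_split /= big_ord_recl mul0r mul0r add0r.
rewrite [X in _ + X = _]big_ord_recr /= subnn mul0r mulr0 addr0 mulr_sumr -big_split /=.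
apply: eq_bigr => r _; rewrite /bump add1n subSS.
have rn : (r <= n)%N by rewrite -ltnS.
rewrite subSn // /A /B !rec natrB // -/(A r) -/(B (n - r)%N); ring.
Qed.

End FallingFactorial.

Section PoissonProcess.
Context {R : realType}.
Local Notation Ga := (@euler_integral R).
Implicit Types (t s lambda alpha beta gamma nu : R) (n k r : nat).

(** The coefficient of the [r]-th power of the backward shift in
    [- lambda `^ nu * (1 - B) ^ nu]. *)
Definition shift_coef lambda nu r : R :=
  - lambda `^ nu * ((-1) ^+ r * (falling nu r / r`!%:R)).

Lemma coefCS alpha beta gamma k : Defs.coefC alpha beta gamma k.+1 = Defs.coefC alpha beta gamma k *
  (Gamma (1 + gamma - k.+1%:R * beta) / Gamma (1 + gamma + alpha - (k.+1%:R - 1) * beta)).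
Proof. by rewrite /Defs.coefC big_nat_recr. Qed.

(** In an iteration the Vandermonde identity turns [k * nu] into [(k + 1) * nu], and the
    moment contributes the [k + 1]-st factor of [coefC] and a quotient of Gammas. *)
Lemma iterate_coefE lambda alpha beta gamma nu k n : 0 < alpha -> beta < 0 ->
  0 < 1 + gamma - beta -> 0 < 1 + alpha + gamma ->
  iterate_coef alpha beta gamma (shift_coef lambda nu) k n =
  (- lambda `^ nu) ^+ k * (-1) ^+ n * (falling (k%:R * nu) n / n`!%:R) *
  (Defs.coefC alpha beta gamma k / Gamma (1 - k%:R * beta)).
Proof.
move=> a0 b0 h1 h2; elim: k n => [|k IH] n /=.
  rewrite mul0r falling0n /Defs.coefC big_geq // mul0r subr0 Gamma_pos // euler_integral1.
  rewrite divr1 mulr1 expr0 mul1r; case: n => [|n]; last by rewrite mul0r mulr0.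
  by rewrite expr0 fact0 divr1 mulr1.
rewrite (eq_bigr (fun r : 'I_n.+1 => (- lambda `^ nu) ^+ k.+1 * (-1) ^+ n *
   (Defs.coefC alpha beta gamma k / Gamma (1 - k%:R * beta)) *
   ((falling nu r / r`!%:R) * (falling (k%:R * nu) (n - r) / (n - r)`!%:R)))); last first.
  move=> r _; rewrite IH /shift_coef.
  have -> : (-1) ^+ n = (-1) ^+ r * (-1) ^+ (n - r) :> R by rewrite -exprD subnKC // -ltnS.
  by rewrite exprS; ring.
rewrite -mulr_sumr falling_vandermonde coefCS.
have kb : 0 <= - (k%:R * beta) by rewrite oppr_ge0 mulr_ge0_le0 // ltW.
rewrite (_ : nu + k%:R * nu = k.+1%:R * nu); last by rewrite -nat1r mulrDl mul1r.
rewrite (_ : k.+1%:R - 1 = k%:R :> R); last by rewrite -natr1 addrK.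
rewrite (_ : 1 - k.+1%:R * beta = 1 - k%:R * beta - beta); last by rewrite -natr1; ring.
rewrite (_ : 1 + gamma - k.+1%:R * beta = 1 - k%:R * beta - beta + gamma);
  last by rewrite -natr1; ring.
rewrite (_ : 1 + gamma + alpha - k%:R * beta = alpha + (1 - k%:R * beta) + gamma); last by ring.
rewrite /hyp_moment.
have p1 : 0 < 1 - k%:R * beta by lra.
have p2 : 0 < 1 - k%:R * beta - beta by lra.
have p3 : 0 < 1 - k%:R * beta - beta + gamma by lra.
have p4 : 0 < alpha + (1 - k%:R * beta) + gamma by lra.
rewrite !Gamma_pos //.
have := euler_integral_gt0 p1; have := euler_integral_gt0 p2.
have := euler_integral_gt0 p3; have := euler_integral_gt0 p4.
move: (Ga _) (Ga _) (Ga _) (Ga _) => g1 g2 g3 g4 q1 q2 q3 q4.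
move: (falling _ _ / _) (_ ^+ _) (_ ^+ n) (Defs.coefC _ _ _ _) => x1 x2 x3 x4.
by field; rewrite !gt_eqF.
Qed.

Lemma pmf_termE lambda alpha beta gamma nu k n t : 0 < alpha -> beta < 0 -> 0 < nu ->
  0 < 1 + gamma - beta -> 0 < 1 + alpha + gamma -> 0 <= t ->
  (-1) ^+ n / n`!%:R * pmf_term lambda alpha beta gamma nu n t k =
  iterate_coef alpha beta gamma (shift_coef lambda nu) k n * (t `^ (- beta)) ^+ k.
Proof.
move=> a0 b0 nu0 h1 h2 t0; rewrite iterate_coefE // /pmf_term.
rewrite Gamma_quotient ?mulr_ge0 ?(ltW nu0) // exprMn.
by ring.
Qed.

End PoissonProcess.

(** * The process *)

Section Process.
Context {R : realType} {d : measure_display} {T : measurableType d} (P : probability T R).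
Implicit Types (N : R -> T -> nat).

Lemma caputo_saigo_dom1 (alpha beta gamma : R) (f : R -> R) : 0 < alpha <= 1 ->
  caputo_saigo_dom alpha beta gamma f ->
  (forall x, 0 < x -> derivable f x 1) /\
  exists eps, [/\ forall x, 0 < x -> {for x, continuous (derive1 f)},
    derive1 f =O_ (0^'+) (fun x => x `^ eps),
    Num.max 0 (- beta - 1 - (alpha + gamma)) - 1 < eps &
    Num.max 0 (beta - gamma) - 1 < eps + 1 + beta].
Proof.
move=> al; rewrite /caputo_saigo_dom caputo_index1 //= => -[df [eps [[cf fO h1] h2]]].
split; first by move=> x x0; have := df 0%N isT x x0.
exists eps; split => // x x0; apply: cf; by rewrite in_itv /= x0.
Qed.

Lemma state_prob_bound N n t : measurable_fun setT (N t) -> 0 <= state_prob P N n t <= 1.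
Proof.
move=> mN; have mA : measurable [set w | N t w = n].
  have := mN measurableT [set n] _; rewrite setTI; exact.
have h1 := probability_le1 P mA.
have h0 : (0 <= P [set w | N t w = n])%E by [].
rewrite /state_prob; move: h0 h1; case: (P _) => //= r; rewrite !lee_fin => -> ->; exact: isT.
Qed.

(** The domain condition at [n = 0] provides an order [eps] for the derivative of the state
    probability. If [eps + 1 + beta] were positive, its fractional derivative would tend to 0
    at 0, but by the equation it tends to [- lambda `^ nu]. So [eps <= - beta - 1], and the
    lower bounds on [eps] become bounds on the parameters. *)
Lemma SSTFPP_parameters (lambda alpha beta gamma nu : R) N : 0 < lambda -> 0 < alpha <= 1 ->
  is_SSTFPP P lambda alpha beta gamma nu N ->
  0 < 1 + gamma - beta /\ 0 < 1 + alpha + gamma.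
Proof.
move=> l0 al [mN init cvg0 dom eqn].
have [df [eps [cf fO h1 h2]]] := caputo_saigo_dom1 al (dom 0%N).
have [y0 [adm ye]] := admissible_exists h1 h2.
have [C HC] := caputo_saigo_bound al adm ye cf fO.
have e0 : eps + 1 + beta <= 0.
  rewrite leNgt; apply/negP => e0.
  have lim0 : caputo_saigo alpha beta gamma (state_prob P N 0) t @[t --> 0^'+] --> (0 : R).
    apply/norm_cvg0P.
    have c : C * t `^ (eps + 1 + beta) @[t --> 0^'+] --> C * 0.
      by apply: cvgM; [exact: cvg_cst | exact: powR_cvg0].
    rewrite mulr0 in c; apply: (squeeze_cvgr _ (cvg_cst 0) c).
    by near=> t; rewrite normr_ge0 /=; near: t; exact: HC.
  have lim1 : caputo_saigo alpha beta gamma (state_prob P N 0) t @[t --> 0^'+] --> - lambda `^ nu * 1.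
    have c := cvg0 0%N; rewrite init eqxx in c.
    have c2 : - lambda `^ nu * state_prob P N 0 t @[t --> 0^'+] --> - lambda `^ nu * 1.
      by apply: cvgM; [exact: cvg_cst | exact: c].
    apply: cvg_trans c2; apply: near_eq_cvg; near=> t.
    have t0 : 0 < t by near: t; exact: nbhs_right_gt.
    by rewrite eqn // big_ord_recl big_ord0 addr0 /= expr0 falling0 fact0 divr1 !mul1r.
  have E := cvg_unique _ lim0 lim1.
  have : 0 < lambda `^ nu by rewrite powR_gt0.
  have /eqP : - lambda `^ nu * 1 = 0 by rewrite -E.
  by rewrite mulr1 oppr_eq0 => /eqP ->; rewrite ltxx.
move: h1 h2; rewrite !ltrBlDr !gt_max => /andP[h1 h2] /andP[h3 h4].
by split; lra.
Unshelve. all: by end_near. Qed.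

(** The system and its initial conditions in the form of integral equations. *)
Lemma SSTFPP_inversion (lambda alpha beta gamma nu : R) N n t : 0 < alpha <= 1 ->
  is_SSTFPP P lambda alpha beta gamma nu N -> 0 < t ->
  state_prob P N n t - (n == 0)%:R = saigo_op alpha beta gamma
    (fun s => \sum_(r < n.+1) shift_coef lambda nu r * state_prob P N (n - r) s) t.
Proof.
move=> al [mN init cvg0 dom eqn] t0.
have [df [eps [cf fO h1 h2]]] := caputo_saigo_dom1 al (dom n).
have [y0 [adm ye]] := admissible_exists h1 h2.
have c := cvg0 n; rewrite init in c.
rewrite -(saigo_inversion al adm ye df cf fO c t0); congr (_ * _).
have E s : 0 < s -> caputo_saigo alpha beta gamma (state_prob P N n) s =
   \sum_(r < n.+1) shift_coef lambda nu r * state_prob P N (n - r) s.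
  by move=> s0; rewrite eqn // mulr_sumr; apply: eq_bigr => r _; rewrite mulrA.
apply: mellin_op_ext; first by rewrite E // mulr1.
by move=> u /in01[u0 _]; rewrite E // mulr_gt0.
Qed.

End Process.

Unset Implicit Arguments.

Theorem theorem4p2 (R : realType) (d : measure_display)
    (T : measurableType d) (P : probability T R)
    (lambda alpha beta gamma nu : R) (N : R -> T -> nat)
    (lambda_gt0 : 0 < lambda)
    (alpha_gt0 : 0 < alpha) (alpha_le1 : alpha <= 1)
    (nu_gt0 : 0 < nu) (nu_le1 : nu <= 1)
    (beta_lt0 : beta < 0)
    (N_SSTFPP : is_SSTFPP P lambda alpha beta gamma nu N)
    (n : nat) (t : R) (t_ge0 : 0 <= t) :
  cvgn (series (pmf_term lambda alpha beta gamma nu n t)) /\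
  state_prob P N n t =
    (-1) ^+ n / n`!%:R *
    limn (series (pmf_term lambda alpha beta gamma nu n t)).
Proof.
have al : 0 < alpha <= 1 by rewrite alpha_gt0.
have [h1 h2] := SSTFPP_parameters lambda_gt0 al N_SSTFPP.
have [mN init cvg0 dom eqn] := N_SSTFPP.
pose w : R := (-1) ^+ n / n`!%:R.
have w0 : w != 0.
  by rewrite mulf_neq0 ?signr_eq0 ?invr_eq0 // pnatr_eq0 -lt0n fact_gt0.
suff L : series (fun k => w * pmf_term lambda alpha beta gamma nu n t k) k @[k --> \oo] -->
    state_prob P N n t.
  have L2 : series (pmf_term lambda alpha beta gamma nu n t) k @[k --> \oo] -->
      w^-1 * state_prob P N n t.
    have : w^-1 * series (fun k => w * pmf_term lambda alpha beta gamma nu n t k) k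
        @[k --> \oo] --> w^-1 * state_prob P N n t.
      by apply: cvgM => //; exact: cvg_cst.
    apply: cvg_near_eq; near=> k; rewrite !seriesEnat /= -mulr_sumr mulKf //.
  split; first by apply/cvg_ex; exists (w^-1 * state_prob P N n t).
  have -> : limn (series (pmf_term lambda alpha beta gamma nu n t)) = w^-1 * state_prob P N n t.
    exact/cvg_lim.
  by rewrite mulVKf.
have wE k : w * pmf_term lambda alpha beta gamma nu n t k =
    iterate_coef alpha beta gamma (shift_coef lambda nu) k n * (t `^ (- beta)) ^+ k.
  exact: pmf_termE.
(* At [t = 0] every term but the first contains a positive power of [0 `^ (- beta) = 0]. *)
move: t_ge0; rewrite le_eqVlt => /orP[/eqP t0|t_gt0].
  rewrite -t0 init; apply: (@cvg_near_eq _ (fun=> (n == 0)%:R)); last exact: cvg_cst.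
  near=> k; have k0 : (0 < k)%N by near: k; exact: nbhs_infty_gt.
  rewrite seriesEnat /= -(prednK k0) big_nat_recl // big1 ?addr0.
    by rewrite t0 wE expr0 mulr1.
  move=> i _; rewrite t0 wE -t0 powR0 ?expr0n ?mulr0 //.
  by rewrite oppr_eq0 lt_eqF.
have F_cont m s : 0 < s -> {for s, continuous (state_prob P N m)}.
  move=> s0; apply: differentiable_continuous; apply/derivable1_diffP.
  by have [df _] := caputo_saigo_dom1 al (dom m); exact: df.
have F_bound m s : 0 < s -> `|state_prob P N m s| <= 1.
  move=> s0; have /andP[p0 p1] := @state_prob_bound R d T P N m s (mN s (ltW s0)).
  by rewrite ger0_norm.
have := iterate_series (n := n) alpha_gt0 beta_lt0 h1 h2 F_cont F_bound
  (fun m s s0 => SSTFPP_inversion m al N_SSTFPP s0) t_gt0.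
apply: cvg_near_eq; near=> k; congr (series _ k); apply/funext => j.
rewrite wE -powR_mulrn ?powR_ge0 // -powRrM; congr (_ * _ `^ _); ring.
Unshelve. all: by end_near. Qed.
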